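(* Let $n\ge 2$ be an integer and let $f \in L^1(\mathbb{R})$ be nonnegative with $t^{2n-2} f(t) \in L^1(\mathbb{R})$. Let $\nu_{n,a}(x):= \nu_n(f;x+a)$, $a\in\mathbb{R}$. (1) $W_n(\mathcal{F} f; x)$ has no real zeros if and only if the span of $\{\nu_{n,a}: a\in \mathbb{R}\}$ is dense in $L^1(\mathbb{R})$. (2) If $\nu_n(f) \in L^2(\mathbb{R})$, then the set of real zeros of $W_n(\mathcal{F} f; x)$ has Lebesgue measure zero if and only if the span of $\{\nu_{n,a}: a\in \mathbb{R}\}$ is dense in $L^2(\mathbb{R})$.
   Context: $\mathcal{F} f(x) = \int_{\mathbb{R}} e^{-ixt} f(t)\,dt$; $W_n(h;x) = \det[h^{(i+j)}(x)]_{i,j=0}^{n-1}$. The correlation function is $$ \nu_n(f;t) = \int_{\mathbb{R}^{n-1}} \prod_{1 \le i<j \le n}(s_i-s_j)^2\, f(s_1)\cdots f(s_n)\, ds_1\cdots ds_{n-1}, \qquad s_n := t-s_1-\cdots-s_{n-1}. $$ *)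

(* Defs.v *)
From HB Require Import structures.
From mathcomp Require Import all_boot all_order all_algebra.
From mathcomp Require Import all_classical all_reals all_analysis.
From mathcomp Require Import complex.
Set Implicit Arguments. Unset Strict Implicit. Unset Printing Implicit Defensive.
Import Order.TTheory GRing.Theory Num.Theory.
Local Open Scope ring_scope.

Section Defs.
Variable R : realType.
Local Notation leb := (@lebesgue_measure R).

Definition fourier (f : R -> R) (x : R) : R[i] :=
  Complex (Rintegral leb setT (fun t => cos (x * t) * f t))
          (- Rintegral leb setT (fun t => sin (x * t) * f t)).

Definition cderivn (k : nat) (h : R -> R[i]) (x : R) : R[i] :=
  Complex (derive1n k (fun y => @complex.Re R (h y)) x) (derive1n k (fun y => @complex.Im R (h y)) x).

Definition Wn (n : nat) (h : R -> R[i]) (x : R) : R[i] :=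
  \det (\matrix_(i < n, j < n) cderivn (i + j) h x).

Definition corr_integrand (f : R -> R) (s : seq R) : R :=
  (\prod_(0 <= i < size s) \prod_(i.+1 <= j < size s) (s`_i - s`_j) ^+ 2)
  * \prod_(x <- s) f x.

Fixpoint iint (k : nat) (F : seq R -> \bar R) : \bar R :=
  match k with
  | 0 => F [::]
  | k'.+1 => (\int[leb]_(x in setT) iint k' (fun s => F (x :: s)))%E
  end.

Definition nu_ext (n : nat) (f : R -> R) (t : R) : \bar R :=
  iint n.-1 (fun s => (corr_integrand f (rcons s (t - \sum_(x <- s) x)))%:E).

Definition nu (n : nat) (f : R -> R) (t : R) : R := fine (nu_ext n f t).

Definition transl_comb (phi : R -> R) (cs : seq (R * R)) (x : R) : R :=
  \sum_(p <- cs) p.1 * phi (x + p.2).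

Definition L1 (g : R -> R) : Prop := leb.-integrable setT (EFin \o g).

Definition L2 (g : R -> R) : Prop :=
  measurable_fun setT g /\ (\int[leb]_(x in setT) (`|g x| ^+ 2)%:E < +oo)%E.

Definition transl_dense_L1 (phi : R -> R) : Prop :=
  forall g, L1 g -> forall eps : R, 0 < eps ->
  exists cs : seq (R * R),
    (\int[leb]_(x in setT) (`|g x - transl_comb phi cs x|)%:E < eps%:E)%E.

Definition transl_dense_L2 (phi : R -> R) : Prop :=
  forall g, L2 g -> forall eps : R, 0 < eps ->
  exists cs : seq (R * R),
    (\int[leb]_(x in setT) (`|g x - transl_comb phi cs x| ^+ 2)%:E < eps%:E)%E.

End Defs.

(* Main.v *)
(* The statement is Wiener's Tauberian theorem for psi = nu_n(f), combined with the
   Andreief-Heine identity: expanding the two Vandermonde determinants in nu_n(f) and substituting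
   t = s_1 + ... + s_n gives F(nu_n(f)) = n! det[F(t^(i+j) f)] = +- n! W_n(F f), so W_n(F f) and
   F(nu_n(f)) have the same real zeros.

   Density of translates. Write psi~(t) = psi(-t). Convolutions psi * u are limits of combinations
   of translates, and the Fejer kernels k_0 (cosine transforms of l - x on [0, l]) form an
   approximate identity, so it is enough to approximate k_0 by convolutions psi * u. In L1, let
   psi' be a truncation of psi to a compact interval, P = |F psi'|^2, which is smooth and bounded
   below on [0, l], and k_m the cosine transform of (l - x) / P(x)^m. As psi' * psi'~ * k_(m+1) =
   k_m, a Neumann series argument gives k_0 - psi * psi~ * w_m = Q^m k_m where Q is the convolution
   with psi' * psi'~ - psi * psi~; the norm of Q is smaller than min P while the L1 norm of k_m is
   O(m^2 (min P)^-m), so the error tends to 0. In L2, Bessel's inequality allows u to be psi~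
   convolved with the cosine transform of (l - x) / (|F psi|^2 + eps).

   Conversely, if F psi vanishes at x, or on a set Z of positive measure, then all translates of
   psi are annihilated by e^(-ixt), respectively by the cosine transform of the indicator of a
   bounded part of Z. *)

Require Import Defs.
From HB Require Import structures.
From mathcomp Require Import all_boot all_order all_algebra fingroup perm.
From mathcomp Require Import all_classical all_reals all_analysis.
From mathcomp Require Import complex ring lra zify measurable_realfun.
Set Implicit Arguments. Unset Strict Implicit. Unset Printing Implicit Defensive.
Import Order.TTheory GRing.Theory Num.Theory.
Import numFieldNormedType.Exports.
Local Open Scope classical_set_scope.
Local Open Scope ring_scope.

(** * Integrals on the line *)

(** The obstacle in L1 is that F psi is only continuous, so the quotient (l - x) / |F psi|^2 need
    not have an integrable cosine transform. Truncating psi makes P twice continuously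
    differentiable, and two integrations by parts then bring the kernels k_m into L1; the Neumann
    series pays for having replaced psi by psi'. With c the minimum of |F psi|^2 on [0, l], the
    truncation is chosen so that P >= 3c/4 on [0, l] while Q has norm at most c/4: the factor m^2
    lost in the kernels is absorbed by 3^-m.

    All analysis uses real cosine and sine integrals. Convolving with psi * psi~ instead of psi
    makes the multiplier real, so that cosine transforms are sent to cosine transforms.

    The correlation function is an iterated integral with values in [0, +oo]. Its transform is first
    computed against nonnegative weights, where Tonelli asks for no integrability; integrability and
    finiteness almost everywhere come out as a by-product. *)

Section LebesgueInvariance.
Variable R : realType.
Local Notation leb := (@lebesgue_measure R).

Lemma pushforward_lebesgue_shift (a : R) (A : set R) : measurable A ->
  pushforward leb ((fun x => x + a) : measurableTypeR R -> measurableTypeR R) A = leb A.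
Proof.
move=> mA; apply/esym/lebesgue_measure_unique => //=; first exact: measurable_funD.
move=> _ _ [[u v]] _ <-.
rewrite /pushforward /=.
have -> : (fun x : R => x + a) @^-1` [set` `]u, v]] = [set` `]u - a, v - a]].
  by apply/funext => x /=; rewrite !in_itv /= ltrBlDr lerBrDr.
by rewrite !lebesgue_measure_itv /= !lte_fin ltrD2r -!EFinB opprB addrA addrNK.
Qed.

Lemma integral_invariant (phi : R -> R) (f : R -> \bar R) :
  measurable_fun setT phi ->
  (forall A : set R, measurable A -> pushforward leb phi A = leb A) ->
  measurable_fun setT f -> (\int[leb]_x f (phi x) = \int[leb]_x f x)%E.
Proof.
move=> mphi inv mf.
have ge0 (g : R -> \bar R) : measurable_fun setT g -> (forall x, 0 <= g x)%E ->
    (\int[leb]_x g (phi x) = \int[leb]_x g x)%E.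
  move=> mg g0.
  have mphi' : measurable_fun setT (phi : measurableTypeR R -> measurableTypeR R) by [].
  have g0' : {in [set: measurableTypeR R], forall y, (0 <= g y)%E} by move=> y _.
  have /esym := @ge0_integral_pushforward _ _ (measurableTypeR R) (measurableTypeR R) R phi mphi' leb setT g measurableT mg g0'.
  rewrite preimage_setT => ->.
  by apply: eq_measure_integral => A mA _; exact: inv.
rewrite integralE [RHS]integralE; congr (_ - _)%E.
  rewrite -(ge0 f^\+%E); first by apply: eq_integral => x _; rewrite !funeposE.
    exact: measurable_funepos.
  by move=> x; exact: funepos_ge0.
rewrite -(ge0 f^\-%E); first by apply: eq_integral => x _; rewrite !funenegE.
  exact: measurable_funeneg.
by move=> x; exact: funeneg_ge0.
Qed.

Lemma integral_shift (a : R) (f : R -> \bar R) : measurable_fun setT f ->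
  (\int[leb]_x f (x + a)%R = \int[leb]_x f x)%E.
Proof.
move=> mf; apply: (integral_invariant _ _ mf) => //; first exact: measurable_funD.
by move=> A mA; exact: pushforward_lebesgue_shift.
Qed.

Lemma integral_opp (f : R -> \bar R) : measurable_fun setT f ->
  (\int[leb]_x f (- x)%R = \int[leb]_x f x)%E.
Proof.
move=> mf; apply: (integral_invariant _ _ mf) => //.
by move=> A mA; exact: lebesgue_measureN.
Qed.

Lemma integral_reflect (a : R) (f : R -> \bar R) : measurable_fun setT f ->
  (\int[leb]_x f (a - x)%R = \int[leb]_x f x)%E.
Proof.
move=> mf; rewrite -(integral_shift a mf) -(integral_opp (f := fun x => f (x + a)%R)).
  by apply: eq_integral => x _; rewrite addrC.
by apply: (measurableT_comp mf); exact: measurable_funD.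
Qed.

End LebesgueInvariance.

(** * Integrable functions, shifts and integrals with a parameter *)

Section IntegralTools.
Variable R : realType.
Implicit Types (f g h k w : R -> R).
Local Notation leb := (@lebesgue_measure R).
Local Notation Int := (Rintegral leb setT).

(** Cosine transforms of integrable functions are of this kind. Convolving an integrable function
    with one of them converges at every point, so identities between convolutions hold pointwise and
    not only almost everywhere. *)
Definition bddm k := measurable_fun setT k /\ exists M, forall x, `|k x| <= M.

(** The p-th power of the L^p norm, used for p = 1 and p = 2. No root is taken; the price is a
    factor 2 in the triangle inequality [JpD], valid for both exponents. *)
Definition Jp (p : nat) g : \bar R := (\int[leb]_x (`|g x| ^+ p)%:E)%E.

Definition conv h k (x : R) : R := Int (fun s => h s * k (x - s)).

Lemma L1_measurable h : L1 h -> measurable_fun setT h.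
Proof. by move=> /integrableP[/measurable_EFinP]. Qed.

Lemma Jp1 h : Jp 1 h = (\int[leb]_x `|(h x)%:E|)%E.
Proof. by []. Qed.

Lemma L1P h : measurable_fun setT h -> (Jp 1 h < +oo)%E -> L1 h.
Proof. by move=> mh hoo; apply/integrableP; split => //; apply/measurable_EFinP. Qed.

Lemma L1_Jp1 h : L1 h -> (Jp 1 h < +oo)%E.
Proof. by move=> /integrableP[]. Qed.

Lemma Jp_ge0 p g : (0 <= Jp p g)%E.
Proof. by apply: integral_ge0 => x _; rewrite lee_fin exprn_ge0. Qed.

Lemma L1_le f g : measurable_fun setT f -> (forall x, `|f x| <= `|g x|) -> L1 g -> L1 f.
Proof.
move=> mf fg; apply: le_integrable => //; first exact/measurable_EFinP.
by move=> x _; rewrite /= lee_fin.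
Qed.

Lemma L1D f g : L1 f -> L1 g -> L1 (fun x => f x + g x).
Proof. by move=> Lf Lg; have := integrableD measurableT Lf Lg. Qed.

Lemma L1B f g : L1 f -> L1 g -> L1 (fun x => f x - g x).
Proof. by move=> Lf Lg; have := integrableB measurableT Lf Lg. Qed.

Lemma L1Z (c : R) f : L1 f -> L1 (fun x => c * f x).
Proof. by move=> Lf; have := integrableZl measurableT c Lf. Qed.

Lemma L1_0 : L1 (fun _ : R => 0 : R).
Proof. exact: integrable0. Qed.

Lemma L1_sum I (s : seq I) (F : I -> R -> R) : (forall i, L1 (F i)) ->
  L1 (fun x => \sum_(i <- s) F i x).
Proof.
move=> LF; elim: s => [|i s IH].
  by under eq_fun do rewrite big_nil; exact: L1_0.
by under eq_fun do rewrite big_cons; exact: L1D.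
Qed.

Lemma L1_norm f : L1 f -> L1 (fun x => `|f x|).
Proof. by move=> Lf; exact: integrable_norm. Qed.

Lemma L1_bddm h k : L1 h -> bddm k -> L1 (fun x => h x * k x).
Proof.
move=> Lh [mk [M kM]].
have M0 : 0 <= M by exact: le_trans (kM 0).
apply: (L1_le (g := fun x => M * h x)); last exact: L1Z.
  by apply: measurable_funM => //; exact: L1_measurable.
by move=> x; rewrite !normrM mulrC (ger0_norm M0) ler_wpM2r.
Qed.

Lemma Int_sum I (s : seq I) (F : I -> R -> R) : (forall i, L1 (F i)) ->
  Int (fun x => \sum_(i <- s) F i x) = \sum_(i <- s) Int (F i).
Proof.
move=> LF; elim: s => [|i s IH].
  rewrite big_nil; under eq_Rintegral do rewrite big_nil.
  by rewrite /Rintegral integral0.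
rewrite big_cons -IH -RintegralD; [|by []|exact: LF|exact: L1_sum].
by apply: eq_Rintegral => x _; rewrite big_cons.
Qed.

Lemma L1_Int f : L1 f -> ((Int f)%:E = \int[leb]_x (f x)%:E)%E.
Proof. by move=> Lf; rewrite /Rintegral fineK //; exact: integrable_fin_num. Qed.

Lemma L1_IntJ f : L1 f -> (Int (fun x => `|f x|))%:E = Jp 1 f.
Proof. by move=> Lf; rewrite L1_Int //; exact: L1_norm. Qed.

Lemma Int_norm_le f : measurable_fun setT f -> (`|Int f|%:E <= Jp 1 f)%E.
Proof.
move=> mf; rewrite Jp1; apply: le_trans (le_abse_integral _ _ _) => //; last first.
  exact/measurable_EFinP.
by rewrite /Rintegral; case: (integral _ _ _) => //=; rewrite ?normr0 leey.
Qed.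

Lemma measurable_shift d (Y : measurableType d) (f : R -> Y) (a : R) :
  measurable_fun setT f -> measurable_fun setT (fun x : R => f (x + a)).
Proof. by move=> mf; apply: (measurableT_comp mf); exact: measurable_funD. Qed.

Lemma measurable_reflect d (Y : measurableType d) (f : R -> Y) (a : R) :
  measurable_fun setT f -> measurable_fun setT (fun x : R => f (a - x)).
Proof. by move=> mf; apply: (measurableT_comp mf); exact: measurable_funB. Qed.

Lemma Jp_shift p g a : measurable_fun setT g -> Jp p (fun x => g (x + a)) = Jp p g.
Proof.
move=> mg; rewrite /Jp -[RHS](integral_shift a) //.
apply/measurable_EFinP; apply: measurable_funX; exact: measurableT_comp.
Qed.

Lemma Jp_reflect p g a : measurable_fun setT g -> Jp p (fun x => g (a - x)) = Jp p g.
Proof.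
move=> mg; rewrite /Jp -[RHS](integral_reflect a) //.
apply/measurable_EFinP; apply: measurable_funX; exact: measurableT_comp.
Qed.

Lemma L1_shift h a : L1 h -> L1 (fun x => h (x + a)).
Proof.
move=> Lh; have mh := L1_measurable Lh.
by apply: L1P; [exact: measurable_shift|rewrite Jp_shift //; exact: L1_Jp1].
Qed.

Lemma L1_reflect h a : L1 h -> L1 (fun x => h (a - x)).
Proof.
move=> Lh; have mh := L1_measurable Lh.
by apply: L1P; [exact: measurable_reflect|rewrite Jp_reflect //; exact: L1_Jp1].
Qed.

Lemma Int_shift f a : measurable_fun setT f -> Int (fun x => f (x + a)) = Int f.
Proof.
move=> mf; rewrite /Rintegral -(integral_shift a (f := EFin \o f)) //.
exact/measurable_EFinP.
Qed.

Lemma Int_reflect f a : measurable_fun setT f -> Int (fun x => f (a - x)) = Int f.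
Proof.
move=> mf; rewrite /Rintegral -(integral_reflect a (f := EFin \o f)) //.
exact/measurable_EFinP.
Qed.

Lemma convC h k x : measurable_fun setT h -> measurable_fun setT k -> conv h k x = conv k h x.
Proof.
move=> mh mk; rewrite /conv -(Int_reflect x (f := fun s => h s * k (x - s))).
  by apply: eq_Rintegral => s _; rewrite subKr mulrC.
by apply: measurable_funM => //; exact: measurable_reflect.
Qed.

Lemma measurable_paramE d (T : measurableType d) (F : T -> R -> \bar R) :
  measurable_fun setT (fun z : T * R => F z.1 z.2) ->
  measurable_fun setT (fun x => \int[leb]_s F x s)%E.
Proof.
move=> mF.
have -> : (fun x => \int[leb]_s F x s)%E =
    (fun x => \int[leb]_s (fun z : T * R => F z.1 z.2)^\+ (x, s) -
              \int[leb]_s (fun z : T * R => F z.1 z.2)^\- (x, s))%E.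
  apply/funext => x; rewrite integralE; congr (_ - _)%E.
    by apply: eq_integral => s _; rewrite !funeposE.
  by apply: eq_integral => s _; rewrite !funenegE.
apply: emeasurable_funB.
  have /= := @measurable_fun_fubini_tonelli_F _ _ T _ R leb (fun z : T * R => F z.1 z.2)^\+%E; apply.
    exact: measurable_funepos.
  by move=> z; exact: funepos_ge0.
have /= := @measurable_fun_fubini_tonelli_F _ _ T _ R leb (fun z : T * R => F z.1 z.2)^\-%E; apply.
  exact: measurable_funeneg.
by move=> z; exact: funeneg_ge0.
Qed.

Lemma measurable_param d (T : measurableType d) (F : T -> R -> R) :
  measurable_fun setT (fun z : T * R => F z.1 z.2) ->
  measurable_fun setT (fun x => Int (F x)).
Proof.
move=> mF; rewrite /Rintegral; apply: (measurableT_comp (f := fine)) => //.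
apply: (measurable_paramE (F := fun x s => (F x s)%:E)).
exact/measurable_EFinP.
Qed.

End IntegralTools.

(** * Fubini, Cauchy-Schwarz and Minkowski *)

Section FubiniMinkowski.
Variable R : realType.
Implicit Types (f g h k w : R -> R).
Local Notation leb := (@lebesgue_measure R).
Local Notation Int := (Rintegral leb setT).

Lemma measurable_fst_comp f : measurable_fun setT f ->
  measurable_fun setT (fun z : R * R => f z.1).
Proof. by move=> mf; exact: (measurableT_comp mf measurable_fst). Qed.

Lemma measurable_snd_comp f : measurable_fun setT f ->
  measurable_fun setT (fun z : R * R => f z.2).
Proof. by move=> mf; exact: (measurableT_comp mf measurable_snd). Qed.

Lemma measurable_uncurry_swap d (Y : measurableType d) (F : R -> R -> Y) :
  measurable_fun setT (fun z : R * R => F z.1 z.2) ->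
  measurable_fun setT (fun z : R * R => F z.2 z.1).
Proof.
by move=> mF; have := measurableT_comp mF (measurable_fun_pair measurable_snd measurable_fst); apply.
Qed.

Lemma measurable_section1 (F : R -> R -> R) x :
  measurable_fun setT (fun z : R * R => F z.1 z.2) -> measurable_fun setT (F x).
Proof.
by move=> mF; exact: (measurableT_comp mF (measurable_pair1 x)).
Qed.

Lemma measurable_section2 (F : R -> R -> R) y :
  measurable_fun setT (fun z : R * R => F z.1 z.2) -> measurable_fun setT (F ^~ y).
Proof.
by move=> mF; exact: (measurableT_comp mF (measurable_pair2 y)).
Qed.

Lemma L1_section1 (F : R -> R -> R) h g x :
  measurable_fun setT (fun z : R * R => F z.1 z.2) -> L1 g ->
  (forall x y, `|F x y| <= `|h x| * `|g y|) -> L1 (F x).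
Proof.
move=> mF Lg Fhg; apply: (L1_le (g := fun y => h x * g y)); last exact: L1Z.
  exact: measurable_section1.
by move=> y; rewrite normrM.
Qed.

(** Domination by a product of integrable functions makes every section integrable, not merely
    almost every one, so that the real-valued inner integrals agree with the extended ones at each
    point. *)
Lemma Int_Fubini (F : R -> R -> R) h g :
  measurable_fun setT (fun z : R * R => F z.1 z.2) -> L1 h -> L1 g ->
  (forall x y, `|F x y| <= `|h x| * `|g y|) ->
  Int (fun x => Int (fun y => F x y)) = Int (fun y => Int (fun x => F x y)).
Proof.
move=> mF Lh Lg Fhg.
have mF' : measurable_fun setT (fun z : R * R => (F z.1 z.2)%:E) by exact/measurable_EFinP.
have iF : (leb \x leb)%E.-integrable setT (fun z : R * R => (F z.1 z.2)%:E).
  apply/integrable12ltyP => //.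
  apply: (@le_lt_trans _ _ (\int[leb]_x ((Int (fun y => `|g y|)) * `|h x|)%:E)%E); last first.
    by have /L1_norm/(L1Z (Int (fun y => `|g y|)))/integrable_lty := Lh; apply.
  apply: ge0_le_integral => //.
  - by move=> x _; exact: integral_ge0.
  - apply: (measurable_paramE (F := fun x y => `|(F x y)%:E|%E)).
    exact: measurableT_comp.
  - apply/measurable_EFinP; apply: measurable_funM => //.
    by apply: measurableT_comp => //; exact: L1_measurable.
  - move=> x _; rewrite mulrC EFinM L1_Int; last exact: L1_norm.
    rewrite -ge0_integralZl //.
    + apply: ge0_le_integral => //.
      * apply/measurable_EFinP; apply: measurableT_comp => //; exact: measurable_section1.
      * apply/measurable_EFinP; apply: measurable_funM => //; apply: measurableT_comp => //.
        exact: L1_measurable.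
      * by move=> y _; rewrite /= lee_fin.
    + apply/measurable_EFinP; apply: measurableT_comp => //; exact: L1_measurable.
have Fgh x y : `|F y x| <= `|g x| * `|h y| by rewrite mulrC.
have mFs : measurable_fun setT (fun z : R * R => F z.2 z.1).
  exact: measurable_uncurry_swap.
rewrite /Rintegral; congr fine.
transitivity (\int[leb]_x \int[leb]_y (F x y)%:E)%E.
  apply: eq_integral => x _; rewrite -L1_Int //; exact: L1_section1 Fhg.
have /= -> := @Fubini _ _ _ _ R leb leb (fun z => (F z.1 z.2)%:E) iF.
apply: eq_integral => y _; rewrite -L1_Int //.
exact: (L1_section1 (F := fun y x => F x y) _ mFs Lh Fgh).
Qed.

(** Cauchy-Schwarz for the measure |w| ds, obtained from the variance of |k|; the right-hand side
    may be infinite. *)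
Lemma Int_sq_le w k : L1 w -> measurable_fun setT k ->
  ((`|Int (fun s => w s * k s)| ^+ 2)%:E <=
   (Int (fun s => `|w s|))%:E * \int[leb]_s (`|w s| * `|k s| ^+ 2)%:E)%E.
Proof.
move=> Lw mk; have mw := L1_measurable Lw.
have mwk : measurable_fun setT (fun s => w s * k s) by exact: measurable_funM.
have mwn : measurable_fun setT (fun s => `|w s|) by exact: measurableT_comp.
have mkn : measurable_fun setT (fun s => `|k s|) by exact: measurableT_comp.
have mwk2 : measurable_fun setT (fun s => `|w s| * `|k s| ^+ 2).
  apply: measurable_funM => //; exact: measurable_funX.
set N := Int (fun s => `|w s|); set A := (integral _ _ _).
have A0 : (0 <= A)%E by apply: integral_ge0 => s _; rewrite lee_fin mulr_ge0 ?exprn_ge0.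
have N0 : 0 <= N by exact: Rintegral_ge0.
(* If N = 0, then w vanishes almost everywhere and both sides are 0, even when A is infinite. *)
have := N0; rewrite le_eqVlt => /orP[/eqP N00|Npos].
  suff -> : Int (fun s => w s * k s) = 0 by rewrite normr0 expr0n /= -N00 mul0e.
  have w0 : ae_eq leb setT (EFin \o w) (cst 0%E).
    apply/ae_eq_integral_abs => //; first exact/measurable_EFinP.
    by have := L1_IntJ Lw; rewrite Jp1 => <-; rewrite -/N -N00.
  rewrite /Rintegral (ae_eq_integral (cst 0%E)) //; first by rewrite integral0.
    exact/measurable_EFinP.
  apply: filterS w0 => s /= ws0 _; case: (ws0 I) => ->; by rewrite mul0r.
have [Aoo|Afin] := eqVneq A +oo%E.
  by rewrite Aoo gt0_muley ?leey // lte_fin.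
have LA : L1 (fun s => `|w s| * `|k s| ^+ 2).
  apply: L1P => //; rewrite Jp1.
  rewrite (_ : integral _ _ _ = A) ?ltey //.
  by apply: eq_integral => s _; rewrite abse_EFin ger0_norm ?mulr_ge0 ?exprn_ge0.
have AE : A = (Int (fun s => `|w s| * `|k s| ^+ 2))%:E by rewrite L1_Int.
rewrite AE -EFinM lee_fin.
have Lwk : L1 (fun s => w s * k s).
  apply: (L1_le (g := fun s => `|w s| + `|w s| * `|k s| ^+ 2)) => //.
    move=> s; rewrite normrM [leRHS]ger0_norm; last by rewrite addr_ge0 ?mulr_ge0 ?exprn_ge0.
    rewrite -{2}(mulr1 `|w s|) -mulrDr ler_wpM2l //.
    have := sqr_ge0 (`|k s| - 1); rewrite expr2; have := normr_ge0 (k s); nra.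
  by apply: L1D => //; exact: L1_norm.
set B := Int (fun s => `|w s * k s|).
have B0 : 0 <= B by exact: Rintegral_ge0.
have IB : `|Int (fun s => w s * k s)| <= B by exact: le_normr_Rintegral.
set a := Int (fun s => `|w s| * `|k s| ^+ 2).
(* This integrates |w| (|k| - B / N)^2 >= 0, where B / N is the |w|-mean of |k|; it says B^2 / N <=
   a. *)
have key : B * (2 * (B / N)) <= a + (B / N) ^+ 2 * N.
  rewrite /B /a /N -RintegralZr //; last exact: L1_norm.
  rewrite -RintegralZl //; last exact: L1_norm.
  rewrite -RintegralD //; last by apply: L1Z; exact: L1_norm.
  apply: le_Rintegral => //.
  - under eq_fun do rewrite mulrC; apply: L1Z; exact: L1_norm.
  - by apply: L1D => //; apply: L1Z; exact: L1_norm.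
  - move=> s _; rewrite normrM.
    have := mulr_ge0 (normr_ge0 (w s)) (sqr_ge0 (`|k s| - B / N)); rewrite -/B -/N; nra.
apply: (@le_trans _ _ (B ^+ 2)).
  by rewrite ler_sqr ?nnegrE.
have e1 : B * (2 * (B / N)) = 2 * (B ^+ 2 / N) by ring.
have e2 : (B / N) ^+ 2 * N = B ^+ 2 / N by field; rewrite gt_eqF.
move: key; rewrite e1 e2 => key.
have : B ^+ 2 / N <= a by lra.
by rewrite ler_pdivrMr // mulrC.
Qed.

(* Minkowski's integral inequality for p = 1, 2, in the weighted Jensen form. *)
Lemma Jp_param (p : nat) w (K : R -> R -> R) : (p == 1)%N || (p == 2)%N -> L1 w ->
  measurable_fun setT (fun z : R * R => K z.1 z.2) ->
  (Jp p (fun x => Int (fun s => w s * K s x))%R <=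
   ((Int (fun s => `|w s|)) ^+ p.-1)%:E * \int[leb]_s ((`|w s|)%:E * Jp p (K s)))%E.
Proof.
move=> p12 Lw mK; have mw := L1_measurable Lw.
have mKs : measurable_fun setT (fun z : R * R => K z.2 z.1).
  exact: measurable_uncurry_swap.
have mwn : measurable_fun setT (fun s => `|w s|) by exact: measurableT_comp.
have mG : measurable_fun setT (fun z : R * R => (`|w z.2| * `|K z.2 z.1| ^+ p)%:E).
  apply/measurable_EFinP; apply: measurable_funM; first exact: (measurable_snd_comp mwn).
  by apply: measurable_funX; exact: measurableT_comp.
have N0 : 0 <= Int (fun s => `|w s|) by exact: Rintegral_ge0.
have pt x : ((`|Int (fun s => w s * K s x)| ^+ p)%:E <=
  ((Int (fun s => `|w s|)) ^+ p.-1)%:E * \int[leb]_s (`|w s| * `|K s x| ^+ p)%:E)%E.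
  case/orP: p12 => /eqP ->.
    rewrite expr1 expr0 mul1e; apply: le_trans (Int_norm_le _) _.
      apply: measurable_funM => //; exact: measurable_section2.
    by rewrite Jp1; under eq_integral do rewrite abse_EFin normrM -(expr1 `|K _ _|).
  apply: Int_sq_le => //; exact: measurable_section2.
set N := Int _ in N0 pt *.
apply: (@le_trans _ _ (\int[leb]_x ((N ^+ p.-1)%:E *
    \int[leb]_s (`|w s| * `|K s x| ^+ p)%:E))%E).
  apply: ge0_le_integral => //.
  - apply/measurable_EFinP; apply: measurable_funX; apply: measurableT_comp => //.
    apply: (measurable_param (F := fun x s => w s * K s x)).
    by apply: measurable_funM => //; exact: measurable_snd_comp.
  - by apply: measurable_funeM; exact: (measurable_paramE (F := fun x s => (`|w s| * `|K s x| ^+ p)%:E)).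
rewrite ge0_integralZl //; last 3 first.
- exact: (measurable_paramE (F := fun x s => (`|w s| * `|K s x| ^+ p)%:E)).
- by move=> x _; apply: integral_ge0 => s _; rewrite lee_fin mulr_ge0 ?exprn_ge0.
- by rewrite lee_fin exprn_ge0.
apply: lee_wpmul2l; first by rewrite lee_fin exprn_ge0.
have /= -> // := @fubini_tonelli _ _ _ _ R leb leb (fun z => (`|w z.2| * `|K z.2 z.1| ^+ p)%:E) mG.
apply: ge0_le_integral => //.
- by move=> s _; apply: integral_ge0 => x _; rewrite lee_fin mulr_ge0 ?exprn_ge0.
- apply: (measurable_paramE (F := fun s x => (`|w s| * `|K s x| ^+ p)%:E)).
  exact: (measurable_uncurry_swap (F := fun x s => (`|w s| * `|K s x| ^+ p)%:E)).
- apply: emeasurable_funM; first exact/measurable_EFinP.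
  apply: (measurable_paramE (F := fun s x => (`|K s x| ^+ p)%:E)).
  by apply/measurable_EFinP; apply: measurable_funX; exact: measurableT_comp.
- move=> s _; rewrite /Jp -ge0_integralZl //.
  apply/measurable_EFinP; apply: measurable_funX; apply: measurableT_comp => //.
  exact: measurable_section1.
Qed.

End FubiniMinkowski.

(** * The functionals [Jp] for p = 1, 2 and bounds on convolutions *)

Section PowerIntegrals.
Variable R : realType.
Implicit Types (f g h k w phi : R -> R).
Local Notation leb := (@lebesgue_measure R).
Local Notation Int := (Rintegral leb setT).

Lemma measurable_normX p g : measurable_fun setT g ->
  measurable_fun setT (fun x => (`|g x| ^+ p)%:E).
Proof.
by move=> mg; apply/measurable_EFinP; apply: measurable_funX; exact: measurableT_comp.
Qed.

Lemma Jp_le p g h : measurable_fun setT g -> measurable_fun setT h ->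
  (forall x, `|g x| <= `|h x|) -> (Jp p g <= Jp p h)%E.
Proof.
move=> mg mh gh; apply: ge0_le_integral => //; try exact: measurable_normX.
by move=> x _; rewrite lee_fin lerXn2r ?nnegrE.
Qed.

Lemma eq_Jp p g h : g =1 h -> Jp p g = Jp p h.
Proof. by move=> gh; apply: eq_integral => x _; rewrite gh. Qed.

Lemma JpN p g : Jp p (fun x => - g x) = Jp p g.
Proof. by apply: eq_integral => x _; rewrite normrN. Qed.

Lemma JpZ p c g : measurable_fun setT g ->
  Jp p (fun x => c * g x) = ((`|c| ^+ p)%:E * Jp p g)%E.
Proof.
move=> mg; rewrite /Jp -ge0_integralZl //; last exact: measurable_normX.
by apply: eq_integral => x _; rewrite normrM exprMn.
Qed.

Lemma JpD p g h : (p == 1)%N || (p == 2)%N ->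
  measurable_fun setT g -> measurable_fun setT h ->
  (Jp p (fun x => g x + h x)%R <= 2%:E * (Jp p g + Jp p h))%E.
Proof.
move=> p12 mg mh; have mgh := measurable_funD mg mh.
rewrite /Jp -ge0_integralD //; try exact: measurable_normX.
rewrite -ge0_integralZl //; last first.
- by move=> x _; rewrite adde_ge0.
- by apply: emeasurable_funD; exact: measurable_normX.
apply: ge0_le_integral => //; first exact: measurable_normX.
  apply: measurable_funeM.
  by apply: emeasurable_funD; exact: measurable_normX.
move=> x _; rewrite -EFinD -EFinM lee_fin.
have := ler_normD (g x) (h x); have := normr_ge0 (g x); have := normr_ge0 (h x).
have := normr_ge0 (g x + h x).
case/orP: p12 => /eqP ->; first by rewrite !expr1; lra.
move=> a0 b0 c0 abc; apply: (@le_trans _ _ ((`|g x| + `|h x|) ^+ 2)).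
  by rewrite ler_sqr ?nnegrE ?addr_ge0.
by have := sqr_ge0 (`|g x| - `|h x|); nra.
Qed.

Lemma JpB p g h : (p == 1)%N || (p == 2)%N ->
  measurable_fun setT g -> measurable_fun setT h ->
  (Jp p (fun x => g x - h x)%R <= 2%:E * (Jp p g + Jp p h))%E.
Proof.
move=> p12 mg mh; rewrite -(JpN p h); apply: JpD => //.
exact: measurableT_comp.
Qed.

(** Each use of [JpD] costs a factor 2, so two errors of e / 4 make e; nested uses explain the
    repeated divisions by 4 below. *)
Lemma Jp_sub_lt p g1 g2 g3 (e : R) : (p == 1)%N || (p == 2)%N ->
  measurable_fun setT g1 -> measurable_fun setT g2 -> measurable_fun setT g3 ->
  (Jp p (fun x => g1 x - g2 x)%R < (e / 4)%:E)%E ->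
  (Jp p (fun x => g2 x - g3 x)%R < (e / 4)%:E)%E ->
  (Jp p (fun x => g1 x - g3 x)%R < e%:E)%E.
Proof.
move=> p12 m1 m2 m3 h12 h23.
rewrite (@eq_Jp p _ (fun x => (g1 x - g2 x) + (g2 x - g3 x))); last first.
  by move=> x; rewrite addrA subrK.
apply: (le_lt_trans (JpD p12 _ _)); try exact: measurable_funB.
apply: (@lt_le_trans _ _ (2%:E * ((e / 4)%:E + (e / 4)%:E))%E).
  by rewrite lte_pmul2l //; exact: lteD.
by rewrite -EFinD -EFinM lee_fin; lra.
Qed.

Lemma measurable_conv h k : measurable_fun setT h -> measurable_fun setT k ->
  measurable_fun setT (conv h k).
Proof.
move=> mh mk; have := @measurable_param R _ _ (fun x s : R => h s * k (x - s)); apply.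
apply: measurable_funM; first exact: measurable_snd_comp.
by apply: (measurableT_comp mk); apply: measurable_funB.
Qed.

Lemma bddm_L1_section h k x : L1 h -> bddm k -> L1 (fun s => h s * k (x - s)).
Proof.
move=> Lh [mk [M kM]]; apply: L1_bddm => //; split; first exact: measurable_reflect.
by exists M.
Qed.

Lemma L1_bddm_sw h k x : L1 h -> bddm k -> L1 (fun s => k s * h (x - s)).
Proof.
move=> Lh bk; under eq_fun do rewrite mulrC.
by apply: L1_bddm => //; exact: L1_reflect.
Qed.

Lemma bddm_conv h k : L1 h -> bddm k -> bddm (conv h k).
Proof.
move=> Lh kb; have [mk [M kM]] := kb; split.
  by apply: measurable_conv => //; exact: L1_measurable.
exists (Int (fun s => `|h s|) * M) => x; apply: le_trans (le_normr_Rintegral _ _) _ => //.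
  exact: bddm_L1_section.
rewrite -RintegralZr //; last exact: L1_norm.
apply: le_Rintegral => //.
- by apply: L1_norm; exact: bddm_L1_section.
- by under eq_fun do rewrite mulrC; apply: L1Z; exact: L1_norm.
- by move=> s _; rewrite normrM ler_wpM2l.
Qed.

(** Young's inequality: in [Jp_param] take K s to be the translate of k by s; all translates have
    the same [Jp]. *)
Lemma Jp_conv p h k : (p == 1)%N || (p == 2)%N -> L1 h -> measurable_fun setT k ->
  (Jp p (conv h k) <= (Int (fun s => `|h s|) ^+ p)%:E * Jp p k)%E.
Proof.
move=> p12 Lh mk; have mK : measurable_fun setT (fun z : R * R => k (z.2 - z.1)).
  by apply: (measurableT_comp mk); exact: measurable_funB.
have := Jp_param (K := fun s x => k (x - s)) p12 Lh mK.
rewrite -[Jp p (fun x => _)]/(Jp p (conv h k)) => H; apply: le_trans H _.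
under eq_integral do rewrite (Jp_shift _ _ mk).
rewrite ge0_integralZr //; last 2 first.
- by apply/measurable_EFinP; apply: measurableT_comp => //; exact: L1_measurable.
- exact: Jp_ge0.
rewrite -L1_Int; last exact: L1_norm.
rewrite muleA -EFinM -exprSr prednK //.
by case/orP: p12 => /eqP ->.
Qed.

(** Dominated convergence. The sets are left general because both truncations in the domain
    (intervals) and in height (sublevel sets of |g|) occur. *)
Lemma Jp_trunc p g (A : nat -> set R) (e : R) : (p == 1)%N || (p == 2)%N ->
  measurable_fun setT g -> (Jp p g < +oo)%E ->
  (forall n, measurable (A n)) -> (forall x, \forall n \near \oo, A n x) -> 0 < e ->
  exists n, (Jp p (fun x => g x - g x * \1_(A n) x)%R < e%:E)%E.
Proof.
move=> p12 mg goo mA Acov e0.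
have p0 : (0 < p)%N by case/orP: p12 => /eqP ->.
have mgA n : measurable_fun setT (fun x => g x - g x * \1_(A n) x).
  by apply: measurable_funB => //; exact: measurable_funM.
have ig : leb.-integrable setT (fun x => (`|g x| ^+ p)%:E).
  apply/integrableP; split; first exact: measurable_normX.
  under eq_integral do rewrite gee0_abs ?lee_fin ?exprn_ge0 //.
  exact: goo.
have : (Jp p (fun x => g x - g x * \1_(A n) x)%R @[n --> \oo] --> \int[leb]_x cst 0 x)%E.
  apply: (dominated_cvg measurableT _ _ _ ig) => //.
  - by move=> n; exact: measurable_normX.
  - move=> x _; apply: cvg_near_cst.
    apply: filterS (Acov x) => n Anx.
    by rewrite indicE mem_set // mulr1 subrr normr0 expr0n; case: p p0 {p12 goo ig}.
  - move=> n x _; rewrite abse_EFin lee_fin ger0_norm ?exprn_ge0 //.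
    rewrite lerXn2r ?nnegrE // indicE; case: (x \in A n); rewrite /= ?mulr1 ?mulr0 ?subr0 //.
    by rewrite subrr normr0.
rewrite integral0 => /fine_cvgP[fin] /cvgrPdist_lt /(_ e e0) cv.
near \oo => n; exists n.
have fn : Jp p (fun x => g x - g x * \1_(A n) x) \is a fin_num by near: n.
have : `|0 - fine (Jp p (fun x => g x - g x * \1_(A n) x))| < e by near: n.
rewrite sub0r normrN -lte_fin -fine_abse // gee0_abs ?Jp_ge0 // fineK //.
Unshelve. all: end_near.
Qed.

End PowerIntegrals.

(** * Translates and convolutions *)

Section Translation.
Variable R : realType.
Implicit Types (f g h k w phi : R -> R).
Local Notation leb := (@lebesgue_measure R).
Local Notation Int := (Rintegral leb setT).

Lemma L1_indic_itv (a b : R) : L1 (\1_(`[a, b]%classic : set R) : R -> R).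
Proof. exact: (@integrable_indic_itv R a b true false). Qed.

(** Arguing by contradiction yields a sequence of shifts tending to 0, to which dominated
    convergence applies. *)
Lemma translation_cvg_compact g (M : R) : continuous g -> (forall x, M < `|x| -> g x = 0) ->
  forall e : R, 0 < e -> exists2 d : R, 0 < d &
    forall a, `|a| < d -> (Jp 1 (fun x => g (x + a) - g x)%R < e%:E)%E.
Proof.
move=> cg g0 e e0; apply: contrapT => H.
have {}H n : exists a, `|a| < n.+1%:R^-1 /\ (e%:E <= Jp 1 (fun x => g (x + a) - g x)%R)%E.
  apply: contrapT => Hn; apply: H; exists n.+1%:R^-1; first by rewrite invr_gt0.
  by move=> a an; rewrite ltNge; apply/negP => ?; apply: Hn; exists a.
have [a_ /all_and2 [a_lt a_ge]] := choice H.
have mg : measurable_fun setT g by exact: continuous_measurable_fun.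
have [B Bg] : exists B, forall x, `|g x| <= B.
  have /compact_bounded [B [_ Bg]] :=
    continuous_compact (continuous_subspaceT cg) (@segment_compact R (- M) M).
  exists (`|B| + 1) => x; have [Mx|xM] := ltP M `|x|.
    by rewrite g0 // normr0 addr_ge0.
  apply: (Bg (`|B| + 1)); first by rewrite (le_lt_trans (ler_norm _)) // ltrDl.
  by exists x => //=; rewrite in_itv /= -ler_norml.
have a0 : a_ n @[n --> \oo] --> (0 : R).
  apply/cvgrPdist_lt => d d0; near=> n; rewrite sub0r normrN.
  apply: (lt_trans (a_lt n)); near: n; exact: near_infty_natSinv_lt (PosNum d0).
have : (Jp 1 (fun x => g (x + a_ n) - g x)%R @[n --> \oo] --> \int[leb]_x cst 0 x)%E.
  (* All shifts satisfy |a_ n| < 1, so the differences are bounded by 2 B and vanish outside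
     [-(M + 1), M + 1]. *)
  have D := L1Z (2 * B) (L1_indic_itv (- (M + 1)) (M + 1)).
  apply: (dominated_cvg measurableT _ _ _ D) => //.
  - move=> n; apply: measurable_normX; apply: measurable_funB => //; exact: measurable_shift.
  - move=> x _; apply: cvg_EFin; first by near=> n.
    rewrite -[X in _ --> X](normr0 R) /comp /=.
    under eq_fun do rewrite expr1.
    apply: cvg_norm; rewrite -(subrr (g x)); apply: cvgB; last exact: cvg_cst.
    apply: (@cvg_comp _ _ _ (fun n => x + a_ n) g _ (nbhs x)); last exact: cg.
    suff : x + a_ n @[n --> \oo] --> x + 0 by rewrite addr0.
    by apply: cvgD => //; exact: cvg_cst.
  - move=> n x _; rewrite abse_EFin lee_fin expr1 normr_id indicE.
    have a1 : `|a_ n| < 1.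
      by apply: lt_le_trans (a_lt n) _; rewrite invf_le1 // ler1n.
    have B0 : 0 <= B by exact: le_trans (Bg 0).
    case: (boolP (x \in _)) => xM /=.
      by rewrite mulr1 (le_trans (ler_normB _ _)) // mulr2n mulrDl !mul1r lerD.
    move: xM; rewrite notin_setE /= in_itv /= => /negP; rewrite -ler_norml -ltNge => xM.
    have tri : `|x| - `|- a_ n| <= `|x - (- a_ n)| by exact: lerB_dist.
    rewrite normrN opprK in tri.
    by rewrite mulr0 (g0 x) ?(g0 (x + a_ n)) ?subrr ?normr0 //; lra.
rewrite integral0 => /fine_cvgP[fin] /cvgrPdist_lt /(_ e e0) cv.
near \oo => n.
have fn : Jp 1 (fun x => g (x + a_ n) - g x) \is a fin_num by near: n.
have : `|0 - fine (Jp 1 (fun x => g (x + a_ n) - g x))| < e by near: n.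
rewrite sub0r normrN -lte_fin -fine_abse // gee0_abs ?Jp_ge0 // fineK //.
by rewrite ltNge a_ge.
Unshelve. all: end_near. Qed.

(** Continuous functions with compact support are dense in L1, and translation preserves the norm of
    the error. *)
Lemma translation_cvg1 phi : L1 phi -> forall e : R, 0 < e -> exists2 d : R, 0 < d &
    forall a, `|a| < d -> (Jp 1 (fun x => phi (x + a) - phi x)%R < e%:E)%E.
Proof.
move=> Lphi e e0; have mphi := L1_measurable Lphi.
have e64 : 0 < e / 4 / 4 / 4 by rewrite !divr_gt0.
have [n trn] : exists n : nat, (Jp 1 (fun x => phi x - phi x * \1_(`[- n%:R, n%:R]%classic) x)%R
    < (e / 4 / 4 / 4)%:E)%E.
  apply: Jp_trunc => //; first exact: L1_Jp1.
  move=> x; near=> n; rewrite /= in_itv /= -ler_norml.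
  by near: n; exact: nbhs_infty_ger.
set M : R := n%:R in trn.
pose E := `[- (M + 1), M + 1]%classic : set R.
have L1phi : L1 (fun x => phi x * \1_(`[- M, M]%classic : set R) x).
  apply: (L1_le _ _ Lphi); first by apply: measurable_funM.
  by move=> x; rewrite normrM indicE; case: (_ \in _); rewrite /= ?normr1 ?mulr1 // normr0 mulr0.
set phi1 := (X in L1 X) in L1phi.
have mphi1 := L1_measurable L1phi.
have mE : measurable E by exact: measurable_itv.
have Eoo : (leb E < +oo)%E by rewrite lebesgue_measure_itv /=; case: ifP => _; rewrite -?EFinB ltry.
have iphi1 : leb.-integrable E (EFin \o phi1) by apply: integrableS L1phi.
have [g_ [cg_ ig_ cvg_]] := @approximation_continuous_integrable R E phi1
  mE Eoo iphi1.
have [g cg gphi1] : exists2 g, continuous g &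
    (\int[leb]_(z in E) `|(phi1 z - g z)%:E| < (e / 4 / 4 / 4)%:E)%E.
  move: cvg_ => /fine_cvgP[fin] /cvgrPdist_lt /(_ _ e64) cv.
  near \oo => m; exists (g_ m); first exact: cg_.
  have fn : (\int[leb]_(z in E) `|(phi1 z - g_ m z)%:E|)%E \is a fin_num by near: m.
  have : `|0 - fine (\int[leb]_(z in E) `|(phi1 z - g_ m z)%:E|)%E| < e / 4 / 4 / 4 by near: m.
  by rewrite sub0r normrN -lte_fin -fine_abse // gee0_abs ?integral_ge0 // fineK.
(* The approximant g is controlled on E only. The cutoff c is 1 on [-M, M] and 0 outside E, so g c
   is continuous with compact support; where c < 1 the target phi1 is 0, hence the error does not
   grow. *)
pose c (x : R) := Num.max 0 (Num.min 1 (M + 1 - `|x|)).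
have cc : continuous c.
  move=> x; apply: (@continuous_max R R (cst 0) (fun y => Num.min 1 (M + 1 - `|y|))).
    exact: cvg_cst.
  apply: (@continuous_min R R (cst 1) (fun y => M + 1 - `|y|)); first exact: cvg_cst.
  by apply: cvgB; [exact: cvg_cst|apply: cvg_norm; exact: cvg_id].
pose G x := g x * c x.
have cG : continuous G by move=> x; apply: cvgM; [exact: cg|exact: cc].
have mG : measurable_fun setT G by exact: continuous_measurable_fun.
have c01 x : 0 <= c x <= 1.
  by rewrite /c le_max lexx /= ge_max ler01 ge_min lexx.
have G0 x : M + 1 < `|x| -> G x = 0.
  move=> Mx; rewrite /G /c max_l ?mulr0 // ge_min subr_le0 (ltW Mx) orbT //.
have phiG : (Jp 1 (fun x => phi1 x - G x)%R < (e / 4 / 4 / 4)%:E)%E.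
  apply: le_lt_trans gphi1; rewrite [leRHS]integral_mkcond.
  apply: ge0_le_integral => //.
  - by apply: measurable_normX; apply: measurable_funB.
  - apply/(measurable_restrictT _ (measurable_itv _)).
    apply: measurableT_comp => //; apply/measurable_EFinP; apply: measurable_funTS.
    by apply: measurable_funB => //; exact: continuous_measurable_fun.
  - move=> x _; rewrite patchE; case: ifPn => [_|].
      rewrite lee_fin expr1; have [xM|Mx] := leP `|x| M.
        rewrite /G /c (_ : Num.min _ _ = 1) ?(max_r ler01) ?mulr1 //.
        by apply/min_idPl; rewrite lerBrDr; lra.
      rewrite /phi1 indicE memNset ?mulr0 ?sub0r ?normrN; last first.
        by rewrite /= in_itv /= -ler_norml; apply/negP; rewrite -ltNge.
      by rewrite /G normrM ler_piMr // ger0_norm; case/andP: (c01 x).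
    rewrite notin_setE /E /= in_itv /= -ler_norml => /negP; rewrite -ltNge => xM.
    rewrite G0 // /phi1 indicE memNset ?mulr0 ?subr0 ?normr0 ?expr1 //.
    rewrite /= in_itv /= -ler_norml; apply/negP; rewrite -ltNge.
    by apply: lt_trans xM; rewrite ltrDl.
have phiG' : (Jp 1 (fun x => phi x - G x)%R < (e / 4 / 4)%:E)%E.
  exact: (@Jp_sub_lt _ _ _ phi1).
have e4 : 0 < e / 4 by rewrite divr_gt0.
have [d d0 dG] := translation_cvg_compact cG G0 (divr_gt0 e4 (ltr0n _ 4)).
exists d => // a ad.
apply: (@Jp_sub_lt _ _ _ (fun x => G (x + a))) => //; try exact: measurable_shift.
  rewrite (Jp_shift _ _ (measurable_funB mphi mG)).
  by apply: lt_trans phiG' _; rewrite lte_fin; lra.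
apply: (@Jp_sub_lt _ _ _ G) => //; try exact: measurable_shift.
  exact: dG.
rewrite -JpN; under eq_fun do rewrite opprB.
exact: phiG'.
Unshelve. all: end_near. Qed.

(** For p = 2, phi is truncated in height: if |psi| <= M, the square of psi (x + a) - psi x is at
    most 2 M times its absolute value, which reduces to p = 1. *)
Lemma translation_cvg p phi : (p == 1)%N || (p == 2)%N -> L1 phi -> (Jp p phi < +oo)%E ->
  forall e : R, 0 < e -> exists2 d : R, 0 < d &
    forall a, `|a| < d -> (Jp p (fun x => phi (x + a) - phi x)%R < e%:E)%E.
Proof.
move=> p12 Lphi phioo e e0; have mphi := L1_measurable Lphi.
have := p12 => /orP[/eqP->|/eqP p2]; first exact: translation_cvg1.
pose A (n : nat) := [set x | `|phi x| <= n%:R].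
have mA n : measurable (A n).
  rewrite (_ : A n = (fun x => `|phi x|) @^-1` `]-oo, n%:R]); last first.
    by apply/seteqP; split => x /=; rewrite in_itv.
  by rewrite -[X in measurable X]setTI; apply: measurableT_comp => //; exact: measurable_itv.
have e16 : 0 < e / 4 / 4 by rewrite !divr_gt0.
have [|n trn] := Jp_trunc p12 mphi phioo mA _ e16.
  by move=> x; near=> n; rewrite /A /=; near: n; exact: nbhs_infty_ger.
set M : R := n%:R in trn.
pose psi x := phi x * \1_(A n) x.
have mpsi : measurable_fun setT psi by exact: measurable_funM.
have psiM x : `|psi x| <= M.
  rewrite /psi normrM indicE; case: (boolP (x \in A n)); last by rewrite normr0 mulr0 ler0n.
  by rewrite inE normr1 mulr1.
have Lpsi : L1 psi.
  apply: (L1_le _ _ Lphi) => // x.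
  by rewrite normrM indicE; case: (_ \in _); rewrite /= ?normr1 ?mulr1 // normr0 mulr0.
have M0 : 0 <= M by rewrite ler0n.
have c0 : 0 < e / 4 / 4 / (2 * M + 1) by rewrite divr_gt0 //; lra.
have [d d0 dpsi] := translation_cvg1 Lpsi c0.
exists d => // a ad.
apply: (@Jp_sub_lt _ _ _ (fun x => psi (x + a))) => //; try exact: measurable_shift.
  rewrite (Jp_shift _ _ (measurable_funB mphi mpsi)).
  by apply: lt_trans trn _; rewrite lte_fin; lra.
have mpsia := measurable_shift a mpsi.
apply: (@Jp_sub_lt _ _ _ psi) => //.
  apply: (@le_lt_trans _ _ ((2 * M + 1)%:E * Jp 1 (fun x => psi (x + a) - psi x)%R)%E).
    rewrite /Jp -ge0_integralZl //; last first.
    - by rewrite lee_fin; lra.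
    - by apply: measurable_normX; exact: measurable_funB.
    apply: ge0_le_integral => //.
    + by apply: measurable_normX; exact: measurable_funB.
    + by apply: measurable_funeM; apply: measurable_normX; exact: measurable_funB.
    + move=> x _; rewrite -EFinM lee_fin p2 expr2 expr1 ler_wpM2r //.
      by have := ler_normB (psi (x + a)) (psi x); have := psiM x; have := psiM (x + a); lra.
  rewrite -lte_pdivlMl //; last by lra.
  apply: lt_le_trans (dpsi a ad) _.
  by rewrite -EFinM lee_fin mulrC.
rewrite -JpN; under eq_fun do rewrite opprB.
exact: trn.
Unshelve. all: end_near. Qed.

End Translation.

(** * Convolutions as limits of combinations of translates *)

Section TranslateClosure.
Variable R : realType.
Implicit Types (f g h w phi : R -> R).
Local Notation leb := (@lebesgue_measure R).
Local Notation Int := (Rintegral leb setT).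

Definition translates_approx p phi g :=
  forall e : R, 0 < e -> exists cs : seq (R * R),
    (Jp p (fun x => g x - transl_comb phi cs x)%R < e%:E)%E.

Lemma measurable_transl_comb phi cs : measurable_fun setT phi ->
  measurable_fun setT (transl_comb phi cs).
Proof.
move=> mphi; elim: cs => [|p cs IH].
  rewrite (_ : transl_comb _ _ = cst 0) //; apply/funext => x.
  by rewrite /transl_comb big_nil.
rewrite (_ : transl_comb _ _ = fun x => p.1 * phi (x + p.2) + transl_comb phi cs x).
  by apply: measurable_funD => //; apply: measurable_funM => //; exact: measurable_shift.
by apply/funext => x; rewrite /transl_comb big_cons.
Qed.

Lemma translates_approx_closed p phi g : (p == 1)%N || (p == 2)%N ->
  measurable_fun setT phi -> measurable_fun setT g ->
  (forall e : R, 0 < e -> exists h, [/\ measurable_fun setT h,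
     (Jp p (fun x => g x - h x)%R < e%:E)%E & translates_approx p phi h]) ->
  translates_approx p phi g.
Proof.
move=> p12 mphi mg H e e0; have e4 : 0 < e / 4 by rewrite divr_gt0.
have [h [mh gh Hh]] := H _ e4; have [cs hcs] := Hh _ e4.
exists cs; apply: (@Jp_sub_lt _ _ _ h) => //; exact: measurable_transl_comb.
Qed.

(** The combination is a Riemann sum of w * phi over a grid of mesh 1 / (q + 1), with the integrals
    of w over the cells as coefficients. Minkowski's inequality reduces the error to the continuity
    of translation. *)
Lemma conv_translates_compact p phi w (m : nat) : (p == 1)%N || (p == 2)%N ->
  L1 phi -> (Jp p phi < +oo)%E -> L1 w -> bddm w ->
  (forall x, m%:R < `|x| -> w x = 0) -> translates_approx p phi (conv w phi).
Proof.
move=> p12 Lphi phioo Lw bw w0 e e0.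
have mphi := L1_measurable Lphi; have mw := L1_measurable Lw.
set N := Int (fun s => `|w s|).
have N0 : 0 <= N by exact: Rintegral_ge0.
pose c := e / (N ^+ p.-1 * N + 1).
have NN : 0 < N ^+ p.-1 * N + 1 by rewrite ltr_wpDl // mulr_ge0 // exprn_ge0.
have c0 : 0 < c by rewrite divr_gt0.
have [d d0 dphi] := translation_cvg p12 Lphi phioo c0.
have [q qd] : exists q : nat, q.+1%:R^-1 < d.
  by near \oo => q; exists q; near: q; exact: near_infty_natSinv_lt (PosNum d0).
pose a (j : nat) : R := - m%:R + j%:R * q.+1%:R^-1.
pose I (j : nat) : set R := `[a j, a j.+1[%classic.
have mI j : measurable (I j) by exact: measurable_itv.
(* The cells are half-open; the additional one contains the end point s = m. *)
pose n := ((m + m) * q.+1).+1.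
have q0 : 0 < q.+1%:R^-1 :> R by rewrite invr_gt0.
have aS j : a j.+1 = a j + q.+1%:R^-1 by rewrite /a -addn1 natrD mulrDl mul1r addrA.
have I_uniq s j k : I j s -> I k s -> j = k.
  rewrite /I /= !in_itv /= => /andP[j1 j2] /andP[k1 k2].
  have := le_lt_trans j1 k2; have := le_lt_trans k1 j2.
  rewrite /a !ltrD2l !ltr_pM2r // !ltr_nat !ltnS => jk kj.
  by apply/eqP; rewrite eqn_leq jk kj.
have I_ex s : `|s| <= m%:R -> exists2 j, (j < n)%N & I j s.
  rewrite ler_norml => /andP[s1 s2].
  have sm : 0 <= (s + m%:R) * q.+1%:R by rewrite mulr_ge0 // -lerBlDr sub0r.
  have /andP[t1 t2] := truncn_itv sm; exists (Num.truncn ((s + m%:R) * q.+1%:R)).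
    rewrite ltnS -(ler_nat R); apply: le_trans t1 _.
    by rewrite natrM natrD ler_wpM2r // lerD2r.
  rewrite /I /= in_itv /= /a addrC lerBlDr ler_pdivrMr // t1 /=.
  by rewrite addrC -ltrBlDr opprK ltr_pdivlMr.
have sumI s (F : nat -> R) j : (j < n)%N -> I j s ->
    \sum_(k < n) \1_(I k) s * F k = F j.
  move=> jn Ijs; rewrite (bigD1 (Ordinal jn)) //= big1 ?addr0.
    by rewrite indicE mem_set ?mul1r.
  move=> k kj; rewrite indicE memNset ?mul0r // => Iks.
  by move/eqP: kj; apply; apply/val_inj; exact: I_uniq Iks Ijs.
(* Only the cell of s contributes: K s is the error made by moving s to the left end of its cell, a
   distance less than d. *)
pose K s x := \sum_(k < n) \1_(I k) s * (phi (x - s) - phi (x - a k)).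
pose cs := [seq (Int (fun s => w s * \1_(I k) s), - a k) | k <- index_iota 0 n].
have mK : measurable_fun setT (fun z : R * R => K z.1 z.2).
  apply: measurable_sum => k; apply: measurable_funM.
    exact: (measurable_fst_comp (f := \1_(I k))).
  apply: measurable_funB; apply: (measurableT_comp mphi); first exact: measurable_funB.
  exact: measurable_funB.
have L1wI k : L1 (fun s => w s * \1_(I k) s).
  apply: (L1_le _ _ Lw); first exact: measurable_funM.
  by move=> x; rewrite normrM indicE; case: (_ \in _); rewrite /= ?normr1 ?mulr1 // normr0 mulr0.
have E x : conv w phi x - transl_comb phi cs x = Int (fun s => w s * K s x).
  rewrite /transl_comb /cs big_map big_mkord.
  have LF k : L1 (fun s => w s * \1_(I k) s * phi (x - a k)).
    by under eq_fun do rewrite mulrC; exact: L1Z.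
  rewrite (_ : \sum_(_ < _) _ = Int (fun s => \sum_(k < n) w s * \1_(I k) s * phi (x - a k))).
    rewrite /conv -RintegralB //; last exact: L1_sum.
      apply: eq_Rintegral => s _; have [sm|/w0 ws] := leP `|s| m%:R; last first.
        by rewrite ws !mul0r big1 ?subr0 // => k _; rewrite !mul0r.
      have [j jn Ijs] := I_ex _ sm.
      rewrite /K (sumI _ (fun k => phi (x - s) - phi (x - a k)) _ jn Ijs) mulrBr; congr (_ - _).
      by under eq_bigr do rewrite -mulrA; rewrite -mulr_sumr (sumI _ (fun k => phi (x - a k)) _ jn Ijs).
    exact: L1_bddm_sw.
  rewrite Int_sum //; apply: eq_bigr => k _ /=.
  by rewrite RintegralZr //; exact: L1wI.
exists cs; rewrite (eq_Jp _ E).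
apply: le_lt_trans (Jp_param p12 Lw mK) _; rewrite -/N.
apply: (@le_lt_trans _ _ ((N ^+ p.-1)%:E * (N%:E * c%:E))%E); last first.
  rewrite -!EFinM lte_fin /c mulrA mulrA ltr_pdivrMr //.
  by rewrite mulrC ltr_pM2l // ltrDl.
apply: lee_wpmul2l; first by rewrite lee_fin exprn_ge0.
rewrite /N L1_Int; last exact: L1_norm.
rewrite -ge0_integralZr //; last 2 first.
- by apply/measurable_EFinP; exact: measurableT_comp.
- by rewrite lee_fin ltW.
apply: ge0_le_integral => //.
- by move=> s _; rewrite mule_ge0 // Jp_ge0.
- apply: emeasurable_funM; first by apply/measurable_EFinP; exact: measurableT_comp.
  apply: (measurable_paramE (F := fun s x => (`|K s x| ^+ p)%:E)).
  by apply/measurable_EFinP; apply: measurable_funX; exact: measurableT_comp.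
- apply: emeasurable_funM => //; apply/measurable_EFinP; exact: measurableT_comp.
move=> s _; have [sm|/w0 ->] := leP `|s| m%:R; last by rewrite normr0 !mul0e.
apply: lee_wpmul2l; first by rewrite lee_fin.
have [j jn Ijs] := I_ex _ sm.
rewrite (@eq_Jp _ _ _ (fun x : R => phi (x - a j + (a j - s)) - phi (x - a j))); last first.
  move=> x; rewrite /K (sumI _ (fun k => phi (x - s) - phi (x - a k)) _ jn Ijs).
  by rewrite addrA subrK.
have mT : measurable_fun setT (fun x : R => phi (x + (a j - s)) - phi x).
  by apply: measurable_funB => //; exact: measurable_shift.
rewrite (Jp_shift p (- a j) mT); apply/ltW/dphi.
move: Ijs; rewrite /I /= in_itv /= aS => /andP[s1 s2].
rewrite ltr_norml; move: (a j) (q.+1%:R^-1) qd s1 s2 d0 => b r rd s1 s2 d0.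
by apply/andP; split; lra.
Unshelve. all: end_near. Qed.

Lemma conv_translates p phi w : (p == 1)%N || (p == 2)%N ->
  L1 phi -> (Jp p phi < +oo)%E -> L1 w -> bddm w ->
  translates_approx p phi (conv w phi).
Proof.
move=> p12 Lphi phioo Lw bw.
have mphi := L1_measurable Lphi; have mw := L1_measurable Lw.
apply: translates_approx_closed => //; first exact: measurable_conv.
move=> e e0.
pose A (n : nat) : set R := `[- n%:R, n%:R]%classic.
have P0 : 0 <= fine (Jp p phi) by rewrite fine_ge0 // Jp_ge0.
(* The bound by 1 gives N ^ p <= N for p = 1 and p = 2, where N is the L1 norm of the part of w cut
   off. *)
pose d := Num.min 1 (e / (fine (Jp p phi) + 1)).
have d0 : 0 < d by rewrite lt_min ltr01 divr_gt0 // ltr_wpDl.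
have [| | n wn] := Jp_trunc (p := 1%N) (A := A) isT mw (L1_Jp1 Lw) _ _ d0.
- by move=> n; exact: measurable_itv.
- move=> x; near=> n; rewrite /A /= in_itv /= -ler_norml.
  by near: n; exact: nbhs_infty_ger.
pose w' x := w x * \1_(A n) x.
have mw' : measurable_fun setT w' by apply: measurable_funM => //; apply: measurable_indic; exact: measurable_itv.
have w'w x : `|w' x| <= `|w x|.
  by rewrite normrM indicE; case: (_ \in _); rewrite /= ?normr1 ?mulr1 // normr0 mulr0.
have Lw' : L1 w' by exact: L1_le Lw.
have bw' : bddm w'.
  by split => //; case: bw => _ [M wM]; exists M => x; exact: le_trans (wM x).
exists (conv w' phi); split; first exact: measurable_conv.
  have Lww' : L1 (fun x => w x - w' x) by exact: L1B.
  rewrite (@eq_Jp _ _ _ (conv (fun x => w x - w' x) phi)).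
    apply: le_lt_trans (Jp_conv p12 Lww' mphi) _.
    set N := Int _.
    have N0 : 0 <= N by exact: Rintegral_ge0.
    have Nd : N < d by rewrite -lte_fin /N L1_IntJ.
    have N1 : N < 1 by apply: lt_le_trans Nd _; rewrite ge_min lexx.
    have Ne : N < e / (fine (Jp p phi) + 1).
      by apply: lt_le_trans Nd _; rewrite ge_min lexx orbT.
    apply: (@le_lt_trans _ _ (N%:E * Jp p phi)%E).
      apply: lee_wpmul2r; first exact: Jp_ge0.
      rewrite lee_fin; case/orP: p12 => /eqP ->; first by rewrite expr1.
      by rewrite expr2 ler_piMr // ltW.
    rewrite -(fineK (x := Jp p phi)) ?ge0_fin_numE ?Jp_ge0 // -EFinM lte_fin.
    move: Ne; rewrite ltr_pdivlMr ?ltr_wpDl // => Ne; apply: le_lt_trans Ne.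
    by rewrite mulrDr mulr1 lerDl.
  move=> x; rewrite /conv -RintegralB //.
  - by apply: eq_Rintegral => s _; rewrite mulrBl.
  - exact: L1_bddm_sw.
  - exact: L1_bddm_sw.
apply: (@conv_translates_compact _ _ _ n) => // x nx.
rewrite /w' indicE memNset ?mulr0 // /A /= in_itv /= -ler_norml; apply/negP.
by rewrite -ltNge.
Unshelve. all: end_near. Qed.

End TranslateClosure.

(** * Fourier transforms and the Fejer kernel *)

Section TrigTransforms.
Variable R : realType.
Implicit Types (f g h k w phi psi A B : R -> R).
Local Notation leb := (@lebesgue_measure R).
Local Notation Int := (Rintegral leb setT).

(** With [st], the real data of the Fourier transform: F f = [ct f] - i [st f]. *)
Definition ct f (x : R) : R := Int (fun t => cos (x * t) * f t).
Definition st f (x : R) : R := Int (fun t => sin (x * t) * f t).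

Lemma measurable_cos : measurable_fun setT (@cos R).
Proof. by apply: continuous_measurable_fun => x; exact: continuous_cos. Qed.

Lemma measurable_sin : measurable_fun setT (@sin R).
Proof. by apply: continuous_measurable_fun => x; exact: continuous_sin. Qed.

Lemma bddm_cosM (x : R) : bddm (fun t => cos (x * t)).
Proof.
split; last by exists 1 => t; exact: cos_max.
by apply: (measurableT_comp measurable_cos); exact: measurable_funM.
Qed.

Lemma bddm_sinM (x : R) : bddm (fun t => sin (x * t)).
Proof.
split; last by exists 1 => t; exact: sin_max.
by apply: (measurableT_comp measurable_sin); exact: measurable_funM.
Qed.

Lemma L1_cosM f x : L1 f -> L1 (fun t => cos (x * t) * f t).
Proof.
by move=> Lf; under eq_fun do rewrite mulrC; apply: L1_bddm => //; exact: bddm_cosM.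
Qed.

Lemma L1_sinM f x : L1 f -> L1 (fun t => sin (x * t) * f t).
Proof.
by move=> Lf; under eq_fun do rewrite mulrC; apply: L1_bddm => //; exact: bddm_sinM.
Qed.

Lemma measurable_cos2 A : measurable_fun setT A ->
  measurable_fun setT (fun z : R * R => cos (z.1 * z.2) * A z.2).
Proof.
move=> mA; apply: measurable_funM; last exact: measurable_snd_comp.
by apply: (measurableT_comp measurable_cos); apply: measurable_funM.
Qed.

Lemma measurable_sin2 A : measurable_fun setT A ->
  measurable_fun setT (fun z : R * R => sin (z.1 * z.2) * A z.2).
Proof.
move=> mA; apply: measurable_funM; last exact: measurable_snd_comp.
by apply: (measurableT_comp measurable_sin); apply: measurable_funM.
Qed.

Lemma ct_norm_le f x : L1 f -> `|ct f x| <= Int (fun t => `|f t|).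
Proof.
move=> Lf; apply: le_trans (le_normr_Rintegral _ (L1_cosM x Lf)) _ => //.
apply: le_Rintegral => //; [by apply: L1_norm; exact: L1_cosM|exact: L1_norm|].
by move=> t _; rewrite normrM ler_piMl // cos_max.
Qed.

Lemma st_norm_le f x : L1 f -> `|st f x| <= Int (fun t => `|f t|).
Proof.
move=> Lf; apply: le_trans (le_normr_Rintegral _ (L1_sinM x Lf)) _ => //.
apply: le_Rintegral => //; [by apply: L1_norm; exact: L1_sinM|exact: L1_norm|].
by move=> t _; rewrite normrM ler_piMl // sin_max.
Qed.

Lemma bddm_ct f : L1 f -> bddm (ct f).
Proof.
move=> Lf; split; last by exists (Int (fun t => `|f t|)) => x; exact: ct_norm_le.
have := @measurable_param R _ _ (fun x t : R => cos (x * t) * f t); apply.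
by apply: measurable_cos2; exact: L1_measurable.
Qed.

Lemma bddm_st f : L1 f -> bddm (st f).
Proof.
move=> Lf; split; last by exists (Int (fun t => `|f t|)) => x; exact: st_norm_le.
have := @measurable_param R _ _ (fun x t : R => sin (x * t) * f t); apply.
by apply: measurable_sin2; exact: L1_measurable.
Qed.

Lemma ctD f g x : L1 f -> L1 g -> ct (fun t => f t + g t) x = ct f x + ct g x.
Proof.
move=> Lf Lg; rewrite /ct -RintegralD //; try exact: L1_cosM.
by apply: eq_Rintegral => t _; rewrite mulrDr.
Qed.

Lemma ctB f g x : L1 f -> L1 g -> ct (fun t => f t - g t) x = ct f x - ct g x.
Proof.
move=> Lf Lg; rewrite /ct -RintegralB //; try exact: L1_cosM.
by apply: eq_Rintegral => t _; rewrite mulrBr.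
Qed.

Lemma stB f g x : L1 f -> L1 g -> st (fun t => f t - g t) x = st f x - st g x.
Proof.
move=> Lf Lg; rewrite /st -RintegralB //; try exact: L1_sinM.
by apply: eq_Rintegral => t _; rewrite mulrBr.
Qed.

Lemma ct_opp f x : measurable_fun setT f -> ct (fun t => f (- t)) x = ct f x.
Proof.
move=> mf; rewrite /ct -[RHS](Int_reflect 0).
  by apply: eq_Rintegral => t _; rewrite sub0r mulrN cosN.
by apply: measurable_funM => //; exact: (bddm_cosM x).1.
Qed.

Lemma IntN f : L1 f -> Int (fun t => - f t) = - Int f.
Proof.
move=> Lf; rewrite -mulN1r -RintegralZl //.
by apply: eq_Rintegral => t _; rewrite mulN1r.
Qed.

Lemma st_opp f x : L1 f -> st (fun t => f (- t)) x = - st f x.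
Proof.
move=> Lf; rewrite /st -IntN; last exact: L1_sinM.
rewrite -[RHS](Int_reflect 0); last first.
  by apply: measurableT_comp => //; apply: L1_measurable; exact: L1_sinM.
by apply: eq_Rintegral => t _; rewrite sub0r mulrN sinN mulNr opprK.
Qed.

Lemma L1_opp f : L1 f -> L1 (fun t => f (- t)).
Proof. by move=> Lf; have := L1_reflect 0 Lf; under eq_fun do rewrite sub0r. Qed.

Lemma ct_evenx f x : ct f (- x) = ct f x.
Proof. by apply: eq_Rintegral => t _; rewrite mulNr cosN. Qed.

Lemma convD h k1 k2 x : L1 h -> bddm k1 -> bddm k2 ->
  conv h (fun y => k1 y + k2 y) x = conv h k1 x + conv h k2 x.
Proof.
move=> Lh b1 b2; rewrite /conv -RintegralD //; try exact: bddm_L1_section.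
by apply: eq_Rintegral => s _; rewrite mulrDr.
Qed.

Lemma convB h k1 k2 x : L1 h -> bddm k1 -> bddm k2 ->
  conv h (fun y => k1 y - k2 y) x = conv h k1 x - conv h k2 x.
Proof.
move=> Lh b1 b2; rewrite /conv -RintegralB //; try exact: bddm_L1_section.
by apply: eq_Rintegral => s _; rewrite mulrBr.
Qed.

Lemma convBl h1 h2 k x : L1 h1 -> L1 h2 -> bddm k ->
  conv (fun y => h1 y - h2 y) k x = conv h1 k x - conv h2 k x.
Proof.
move=> L1' L2' b; rewrite /conv -RintegralB //; try exact: bddm_L1_section.
by apply: eq_Rintegral => s _; rewrite mulrBl.
Qed.

(** Stated for two convolutions acting on a bounded k, because the convolution of h1 with h2 may
    diverge at some points. *)
Lemma conv_comm h1 h2 k : L1 h1 -> L1 h2 -> bddm k ->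
  conv h1 (conv h2 k) = conv h2 (conv h1 k).
Proof.
move=> L1h L2h bk; have [mk [M kM]] := bk; apply/funext => x; rewrite /conv.
have m1 := L1_measurable L1h; have m2 := L1_measurable L2h.
have M0 : 0 <= M by exact: le_trans (kM 0).
transitivity (Int (fun s => Int (fun r => h1 s * (h2 r * k (x - s - r))))).
  apply: eq_Rintegral => s _; rewrite -RintegralZl //.
  exact: bddm_L1_section.
rewrite (@Int_Fubini _ _ h1 (fun r => M * h2 r)) //; last 3 first.
- apply: measurable_funM; first exact: measurable_fst_comp.
  apply: measurable_funM; first exact: measurable_snd_comp.
  by apply: (measurableT_comp mk); apply: measurable_funB => //; apply: measurable_funB.
- exact: L1Z.
- move=> s r; rewrite !normrM ler_wpM2l // mulrC (ger0_norm M0).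
  by rewrite ler_wpM2r.
apply: eq_Rintegral => r _; rewrite -RintegralZl //; last exact: bddm_L1_section.
by apply: eq_Rintegral => s _; rewrite mulrCA addrAC.
Qed.

(** By Fubini and the addition formula for cos ((x - s) y), convolving with psi multiplies the
    density A by the transform of psi; the sine part is there because psi need not be even. *)
Lemma conv_ct psi A x : L1 psi -> L1 A ->
  conv psi (ct A) x = ct (fun y => A y * ct psi y) x + st (fun y => A y * st psi y) x.
Proof.
move=> Lpsi LA; have mpsi := L1_measurable Lpsi; have mA := L1_measurable LA.
rewrite /conv.
transitivity (Int (fun s => Int (fun y => psi s * (cos ((x - s) * y) * A y)))).
  by apply: eq_Rintegral => s _; rewrite -RintegralZl //; exact: L1_cosM.
rewrite (@Int_Fubini _ _ psi A) //; last 2 first.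
- apply: measurable_funM; first exact: measurable_fst_comp.
  apply: measurable_funM; last exact: measurable_snd_comp.
  apply: (measurableT_comp measurable_cos); apply: measurable_funM => //.
  exact: measurable_funB.
- move=> s y; rewrite !normrM ler_wpM2l // ler_piMl //; exact: cos_max.
rewrite /ct /st -RintegralD //; last 2 first.
- by apply: L1_cosM; apply: L1_bddm => //; exact: bddm_ct.
- by apply: L1_sinM; apply: L1_bddm => //; exact: bddm_st.
apply: eq_Rintegral => y _; rewrite /ct /st.
rewrite !mulrA -RintegralZl //; last exact: L1_cosM.
rewrite -RintegralZl //; last exact: L1_sinM.
rewrite -RintegralD //; last 2 first.
- by apply: L1Z; exact: L1_cosM.
- by apply: L1Z; exact: L1_sinM.
by apply: eq_Rintegral => s _; rewrite mulrBl cosB (mulrC s y); ring.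
Qed.

Lemma conv_st psi A x : L1 psi -> L1 A ->
  conv psi (st A) x = st (fun y => A y * ct psi y) x - ct (fun y => A y * st psi y) x.
Proof.
move=> Lpsi LA; have mpsi := L1_measurable Lpsi; have mA := L1_measurable LA.
rewrite /conv.
transitivity (Int (fun s => Int (fun y => psi s * (sin ((x - s) * y) * A y)))).
  by apply: eq_Rintegral => s _; rewrite -RintegralZl //; exact: L1_sinM.
rewrite (@Int_Fubini _ _ psi A) //; last 2 first.
- apply: measurable_funM; first exact: measurable_fst_comp.
  apply: measurable_funM; last exact: measurable_snd_comp.
  apply: (measurableT_comp measurable_sin); apply: measurable_funM => //.
  exact: measurable_funB.
- move=> s y; rewrite !normrM ler_wpM2l // ler_piMl //; exact: sin_max.
rewrite /ct /st -RintegralB //; last 2 first.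
- by apply: L1_sinM; apply: L1_bddm => //; exact: bddm_ct.
- by apply: L1_cosM; apply: L1_bddm => //; exact: bddm_st.
apply: eq_Rintegral => y _; rewrite /ct /st.
rewrite !mulrA -RintegralZl //; last exact: L1_cosM.
rewrite -RintegralZl //; last exact: L1_sinM.
rewrite -RintegralB //; last 2 first.
- by apply: L1Z; exact: L1_cosM.
- by apply: L1Z; exact: L1_sinM.
by apply: eq_Rintegral => s _; rewrite mulrBl sinB (mulrC s y); ring.
Qed.

(** Reflecting psi conjugates its transform. In the product the mixed sine terms cancel, leaving the
    real multiplier |F psi|^2. *)
Lemma conv_sym_ct psi A : L1 psi -> L1 A ->
  conv psi (conv (fun t => psi (- t)) (ct A)) =
  ct (fun y => A y * (ct psi y ^+ 2 + st psi y ^+ 2)).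
Proof.
move=> Lpsi LA; have mpsi := L1_measurable Lpsi; apply/funext => x.
have LAC : L1 (fun y => A y * ct psi y) by apply: L1_bddm => //; exact: bddm_ct.
have LAS : L1 (fun y => A y * st psi y) by apply: L1_bddm => //; exact: bddm_st.
have -> : conv (fun t => psi (- t)) (ct A) =
    (fun x => ct (fun y => A y * ct psi y) x - st (fun y => A y * st psi y) x).
  apply/funext => z; rewrite conv_ct //; last exact: L1_opp.
  congr (_ + _); first by apply: eq_Rintegral => y _; rewrite ct_opp.
  rewrite {1 3}/st -IntN; last exact: L1_sinM.
  by apply: eq_Rintegral => y _; rewrite st_opp // mulrN mulrN.
rewrite convB //; [|exact: bddm_ct|exact: bddm_st].
rewrite conv_ct // conv_st //.
have -> : st (fun y => A y * ct psi y * st psi y) x = st (fun y => A y * st psi y * ct psi y) x.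
  by apply: eq_Rintegral => y _; rewrite [in RHS]mulrAC.
rewrite opprB addrACA subrr addr0 -ctD.
- by apply: eq_Rintegral => y _; congr (_ * _); rewrite mulrDr !expr2 !mulrA.
- by apply: L1_bddm => //; exact: bddm_ct.
- by apply: L1_bddm => //; exact: bddm_st.
Qed.

End TrigTransforms.

(** * Derivatives of products, powers and trigonometric transforms *)

Section RealDerivatives.
Variable R : realType.
Implicit Types (f g h psi : R -> R) (x a b c : R).
Local Notation leb := (@lebesgue_measure R).
Local Notation Int := (Rintegral leb setT).

Lemma derive_mul f g x a b : is_derive x 1 f a -> is_derive x 1 g b ->
  is_derive x 1 (fun y => f y * g y) (a * g x + f x * b).
Proof.
move=> Df Dg; apply: is_derive_eq (is_deriveM Df Dg) _.
by rewrite /GRing.scale /= addrC (mulrC a).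
Qed.

Lemma derive_add f g x a b : is_derive x 1 f a -> is_derive x 1 g b ->
  is_derive x 1 (fun y => f y + g y) (a + b).
Proof. by move=> Df Dg; exact: is_deriveD. Qed.

Lemma derive_scale c f x a : is_derive x 1 f a -> is_derive x 1 (fun y => c * f y) (c * a).
Proof. by move=> Df; exact: is_deriveZ. Qed.

Lemma derive_cosM c x : is_derive x 1 (fun y => cos (c * y)) (- c * sin (c * x)).
Proof.
have Dm : is_derive x 1 (fun y : R => c * y) (c * 1) by apply: derive_scale.
by apply: is_derive_eq (is_derive1_comp (is_derive_cos _) Dm) _; rewrite mulr1 mulrC mulNr mulrN.
Qed.

Lemma derive_sinM c x : is_derive x 1 (fun y => sin (c * y)) (c * cos (c * x)).
Proof.
have Dm : is_derive x 1 (fun y : R => c * y) (c * 1) by apply: derive_scale.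
by apply: is_derive_eq (is_derive1_comp (is_derive_sin _) Dm) _; rewrite mulr1 mulrC.
Qed.

Lemma derive_invX f n x a : f x != 0 -> is_derive x 1 f a ->
  is_derive x 1 (fun y => (f y ^+ n)^-1) (- (n%:R * a) / f x ^+ n.+1).
Proof.
move=> fx0 Df; have fX : is_derive x 1 (fun y => f y ^+ n) (n%:R * f x ^+ n.-1 * a).
  rewrite (_ : (fun y => f y ^+ n) = f ^+ n); last by apply/funext => y; rewrite exprfctE.
  exact: is_deriveX.
have fn0 : f x ^+ n != 0 by rewrite expf_neq0.
have H := @is_deriveV R (fun y => f y ^+ n) x _ 1 fn0 fX.
apply: is_derive_eq H _.
case: n {fX fn0} => [|n]; first by rewrite !mul0r oppr0 mul0r /GRing.scale /= mulr0.
rewrite /GRing.scale /=; set m := (_.+1)%:R.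
by rewrite !exprS; field; rewrite fx0 expf_neq0.
Qed.

Lemma derive_continuous f x a : is_derive x 1 f a -> {for x, continuous f}.
Proof.
by move=> [Df _]; apply/differentiable_continuous/derivable1_diffP.
Qed.

Lemma continuous_at_mul f g x : {for x, continuous f} -> {for x, continuous g} ->
  {for x, continuous (fun y => f y * g y)}.
Proof. by move=> cf cg; exact: cvgM. Qed.

Lemma continuous_at_add f g x : {for x, continuous f} -> {for x, continuous g} ->
  {for x, continuous (fun y => f y + g y)}.
Proof. by move=> cf cg; exact: cvgD. Qed.

Lemma continuous_at_opp f x : {for x, continuous f} -> {for x, continuous (fun y => - f y)}.
Proof. by move=> cf; exact: cvgN. Qed.

Lemma derive_ct h x : L1 h -> L1 (fun t => t * h t) ->
  is_derive x 1 (ct h) (- st (fun t => t * h t) x).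
Proof.
move=> Lh Lth.
have Ix : `]x - 1, x + 1[%classic x by rewrite /= in_itv /= ltrBlDr ltrDl ltr01.
have D1 (y t : R) : is_derive y 1 (fun z => cos (z * t) * h t) (- (sin (y * t) * (t * h t))).
  have := derive_scale (h t) (derive_cosM t y).
  rewrite (_ : (fun z => h t * cos (t * z)) = (fun z => cos (z * t) * h t)); last first.
    by apply/funext => z; rewrite mulrC (mulrC t).
  by move=> H; apply: is_derive_eq H _; rewrite (mulrC t y); ring.
have E y t : partial1of2 (fun z t => cos (z * t) * h t) y t = - (sin (y * t) * (t * h t)).
  by rewrite partial1of2E; have [_ ->] := D1 y t.
have bnd y t : `]x - 1, x + 1[%classic y -> setT t ->
    `|partial1of2 (fun z t => cos (z * t) * h t) y t| <= `|t * h t|.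
  by move=> _ _; rewrite E normrN normrM ler_piMl // sin_max.
have intf y : `]x - 1, x + 1[%classic y ->
    leb.-integrable setT (EFin \o (fun t => cos (y * t) * h t)).
  by move=> _; exact: L1_cosM.
have Lnth := L1_norm Lth.
have der (y t : R) : `]x - 1, x + 1[%classic y -> [set: R] t ->
    derivable (fun z : R => cos (z * t) * h t) y 1 by move=> _ _; case: (D1 y t).
apply: DeriveDef.
  exact: (@derivable_under_integral R _ _ leb _ setT measurableT _ _ _ Ix intf der
    (fun t => `|t * h t|) (fun t => normr_ge0 _) Lnth bnd).
rewrite -derive1E.
have -> := (@differentiation_under_integral R _ _ leb _ setT measurableT _ _ _ Ix intf der
    (fun t => `|t * h t|) (fun t => normr_ge0 _) Lnth bnd).
rewrite /st -IntN; last exact: L1_sinM.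
by apply: eq_Rintegral => t _; rewrite E.
Qed.

Lemma derive_st h x : L1 h -> L1 (fun t => t * h t) ->
  is_derive x 1 (st h) (ct (fun t => t * h t) x).
Proof.
move=> Lh Lth.
have Ix : `]x - 1, x + 1[%classic x by rewrite /= in_itv /= ltrBlDr ltrDl ltr01.
have D1 (y t : R) : is_derive y 1 (fun z => sin (z * t) * h t) (cos (y * t) * (t * h t)).
  have := derive_scale (h t) (derive_sinM t y).
  rewrite (_ : (fun z => h t * sin (t * z)) = (fun z => sin (z * t) * h t)); last first.
    by apply/funext => z; rewrite mulrC (mulrC t).
  by move=> H; apply: is_derive_eq H _; rewrite (mulrC t y); ring.
have E y t : partial1of2 (fun z t => sin (z * t) * h t) y t = cos (y * t) * (t * h t).
  by rewrite partial1of2E; have [_ ->] := D1 y t.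
have bnd y t : `]x - 1, x + 1[%classic y -> setT t ->
    `|partial1of2 (fun z t => sin (z * t) * h t) y t| <= `|t * h t|.
  by move=> _ _; rewrite E normrM ler_piMl // cos_max.
have intf y : `]x - 1, x + 1[%classic y ->
    leb.-integrable setT (EFin \o (fun t => sin (y * t) * h t)).
  by move=> _; exact: L1_sinM.
have Lnth := L1_norm Lth.
have der (y t : R) : `]x - 1, x + 1[%classic y -> [set: R] t ->
    derivable (fun z : R => sin (z * t) * h t) y 1 by move=> _ _; case: (D1 y t).
apply: DeriveDef.
  exact: (@derivable_under_integral R _ _ leb _ setT measurableT _ _ _ Ix intf der
    (fun t => `|t * h t|) (fun t => normr_ge0 _) Lnth bnd).
rewrite -derive1E.
have -> := (@differentiation_under_integral R _ _ leb _ setT measurableT _ _ _ Ix intf der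
    (fun t => `|t * h t|) (fun t => normr_ge0 _) Lnth bnd).
by apply: eq_Rintegral => t _; rewrite E.
Qed.

End RealDerivatives.

(** * Decay of cosine transforms and the Fejer kernel *)

Section FejerKernel.
Variable R : realType.
Implicit Types (f g h H : R -> R) (x t l : R).
Local Notation leb := (@lebesgue_measure R).
Local Notation Int := (Rintegral leb setT).

Definition cut l H x : R := H x * \1_(`[0, l]%classic : set R) x.

Lemma cut_in l H x : 0 <= x <= l -> cut l H x = H x.
Proof. by move=> xl; rewrite /cut indicE mem_set ?mulr1 //= in_itv /=. Qed.

Lemma cut_out l H x : ~~ (0 <= x <= l) -> cut l H x = 0.
Proof.
move=> xl; rewrite /cut indicE memNset ?mulr0 //= in_itv /=; exact/negP.
Qed.

Lemma cut_patch l H : cut l H = H \_ (`[0, l]%classic : set R).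
Proof.
apply/funext => x; rewrite patchE; case: ifPn => xl.
  by rewrite cut_in //; move: xl; rewrite inE /= in_itv.
by rewrite cut_out //; move: xl; rewrite notin_setE /= in_itv /= => /negP.
Qed.

Lemma L1_cut l H : (forall x, 0 <= x <= l -> {for x, continuous H}) -> L1 (cut l H).
Proof.
move=> cH.
have : leb.-integrable (`[0, l]%classic : set R) (EFin \o H).
  apply: continuous_compact_integrable; first exact: segment_compact.
  apply: continuous_in_subspaceT => x; rewrite inE /= in_itv /= => xl; exact: cH.
move=> /integrable_mkcond => /(_ (measurable_itv _)).
by rewrite /L1 cut_patch restrict_EFin.
Qed.

Lemma Int_indic_itv (a b : R) : a <= b -> Int (\1_(`[a, b]%classic : set R)) = b - a.
Proof.
move=> ab; rewrite /Rintegral integral_indic // setIT.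
transitivity (fine (lebesgue_measure (`[a, b]%classic : set R))) => //.
rewrite lebesgue_measure_itv /= lte_fin.
by case: ltgtP ab => // <- _; rewrite subrr.
Qed.

Lemma Int_cut_le l H (B : R) : 0 <= l -> L1 (cut l H) ->
  (forall x, 0 <= x <= l -> `|H x| <= B) -> Int (fun x => `|cut l H x|) <= l * B.
Proof.
move=> l0 LH HB.
apply: (@le_trans _ _ (Int (fun x => B * \1_(`[0, l]%classic : set R) x))).
  apply: le_Rintegral => //; first exact: L1_norm.
    by apply: L1Z; exact: L1_indic_itv.
  move=> x _; rewrite /cut normrM [`|\1__ x|]ger0_norm //.
  rewrite indicE; case: (boolP (x \in _)); last by rewrite !mulr0.
  by rewrite inE /= in_itv /= !mulr1 => /HB.
rewrite RintegralZl //; last exact: L1_indic_itv.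
by rewrite Int_indic_itv // subr0 mulrC.
Qed.

(** Two integrations by parts at once: F below is an antiderivative of cos (t x) (H + H2 / t^2). Its
    term in H drops out at both ends, since H l = 0 and sin 0 = 0, so decay like t^-2 requires
    nothing of H at 0. *)
Lemma ct_cut_ibp l t H H1 H2 : 0 < l -> t != 0 ->
  (forall x, 0 <= x <= l -> is_derive x 1 H (H1 x)) ->
  (forall x, 0 <= x <= l -> is_derive x 1 H1 (H2 x)) ->
  (forall x, 0 <= x <= l -> {for x, continuous H2}) -> H l = 0 ->
  ct (cut l H) t = (cos (t * l) * H1 l - H1 0) / t ^+ 2 - ct (cut l H2) t / t ^+ 2.
Proof.
move=> l0 t0 DH DH1 cH2 Hl.
have LH : L1 (cut l H) by apply: L1_cut => x xl; exact: derive_continuous (DH x xl).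
have LH2 : L1 (cut l H2) by exact: L1_cut.
have t20 : t ^+ 2 != 0 by rewrite expf_neq0.
pose F x := t^-1 * (sin (t * x) * H x) + (t ^+ 2)^-1 * (cos (t * x) * H1 x).
pose f x := cos (t * x) * (H x + (t ^+ 2)^-1 * H2 x).
have DF x : 0 <= x <= l -> is_derive x 1 F (f x).
  move=> xl.
  have D1 := derive_scale t^-1 (derive_mul (derive_sinM t x) (DH x xl)).
  have D2 := derive_scale (t ^+ 2)^-1 (derive_mul (derive_cosM t x) (DH1 x xl)).
  by apply: is_derive_eq (derive_add D1 D2) _; rewrite /f; field.
have cf x : 0 <= x <= l -> {for x, continuous f}.
  move=> xl; apply: cvgM.
    exact: derive_continuous (derive_cosM t x).
  apply: cvgD; first exact: derive_continuous (DH x xl).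
  by apply: cvgM; [exact: cvg_cst|exact: cH2].
have FTC : (\int[leb]_(x in `[0%R, l]) (f x)%:E = (F l)%:E - (F 0)%:E)%E.
  apply: continuous_FTC2 => //.
  - by apply: continuous_in_subspaceT => x; rewrite inE /= in_itv /=; exact: cf.
  - have cF x : 0 <= x <= l -> F y @[y --> x] --> F x.
      by move=> xl; exact: derive_continuous (DF x xl).
    split.
    + move=> x; rewrite in_itv /= => /andP[x0 xl].
      by have [] := DF x; rewrite ?ltW.
    + by apply: cvg_at_right_filter; apply: cF; rewrite lexx ltW.
    + by apply: cvg_at_left_filter; apply: cF; rewrite lexx ltW.
  - move=> x; rewrite in_itv /= => /andP[x0 xl]; rewrite derive1E.
    by have [|_ ->] := DF x; rewrite ?ltW.
have : Int (fun x => cos (t * x) * (cut l H x + (t ^+ 2)^-1 * cut l H2 x)) = F l - F 0.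
  rewrite /Rintegral -[RHS]/(fine ((F l)%:E - (F 0)%:E)%E) -FTC [in RHS]integral_mkcond.
  congr fine; apply: eq_integral => x _; rewrite restrict_EFin /=; congr EFin.
  by rewrite !cut_patch !patchE /f; case: ifP => _; rewrite // mulr0 addr0 mulr0.
have -> : Int (fun x => cos (t * x) * (cut l H x + (t ^+ 2)^-1 * cut l H2 x)) =
    ct (cut l H) t + ct (cut l H2) t / t ^+ 2.
  rewrite -[LHS]/(ct (fun x => cut l H x + (t ^+ 2)^-1 * cut l H2 x) t) ctD //; last exact: L1Z.
  congr (_ + _); rewrite /ct -RintegralZr //; last exact: L1_cosM.
  by apply: eq_Rintegral => x _; ring.
rewrite /F Hl !mulr0 sin0 cos0 mul0r mul1r => E.
by rewrite -[LHS](addrK (ct (cut l H2) t / t ^+ 2)) E; field.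
Qed.

(** The inverse of 1 + t^2 is the common integrable majorant of the kernels below. *)
Lemma L1_oneDsqrV : L1 (fun t => (oneDsqr t)^-1).
Proof.
have mW : measurable_fun setT (fun t : R => (oneDsqr t)^-1).
  by apply: continuous_measurable_fun; exact: continuous_oneDsqrV.
have W0 t : 0 <= (oneDsqr t)^-1 by rewrite invr_ge0 (le_trans ler01) // oneDsqr_ge1.
apply: L1P => //; rewrite Jp1.
have -> : (\int[leb]_x `|((oneDsqr x)^-1)%:E| = \int[leb]_x ((oneDsqr x)^-1)%:E)%E.
  by apply: eq_integral => x _; rewrite abse_EFin ger0_norm.
have mW' D : measurable_fun D (fun t : R => ((oneDsqr t)^-1)%:E).
  by apply: measurable_funTS; exact/measurable_EFinP.
have mC : measurable (~` (`[0%R, +oo[%classic : set R)) by apply: measurableC; exact: measurable_itv.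
rewrite -(setUv (`[0%R, +oo[%classic : set R)) ge0_integral_setU //; [|exact: mW'|by apply/disj_setPS; rewrite setICr].
have I0 : (\int[leb]_(x in `[0%R, +oo[) ((oneDsqr x)^-1)%:E < +oo)%E.
  by rewrite integral0y_oneDsqr ltry.
apply: lte_add_pinfty; first exact: I0.
apply: (@le_lt_trans _ _ (\int[leb]_(x in `]-oo, 0%R]) ((oneDsqr x)^-1)%:E)%E).
  apply: ge0_subset_integral => //; first exact: mW'.
  by move=> x /= ; rewrite !in_itv /= andbT => /negP; rewrite -ltNge; exact: ltW.
rewrite (_ : (\int[leb]_(x in _) _)%E = \int[leb]_(x in `]-oo, 0%R]) ((oneDsqr (- x))^-1)%:E)%E; last first.
  by apply: eq_integral => x _; rewrite /oneDsqr sqrrN.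
rewrite -(@ge0_integration_by_substitution0 _ (fun x => ((oneDsqr x)^-1)%:E)) //.
Qed.

(** The factor bounds (1 + t^2) times the transform: l B0 is the trivial bound for the summand 1,
    and 2 B1 + l B2 comes from [ct_cut_ibp] for the summand t^2. *)
Lemma Jp1_ct_cut_le l H H1 H2 (B0 B1 B2 : R) : 0 < l ->
  (forall x, 0 <= x <= l -> is_derive x 1 H (H1 x)) ->
  (forall x, 0 <= x <= l -> is_derive x 1 H1 (H2 x)) ->
  (forall x, 0 <= x <= l -> {for x, continuous H2}) -> H l = 0 ->
  (forall x, 0 <= x <= l -> `|H x| <= B0) ->
  (forall x, 0 <= x <= l -> `|H1 x| <= B1) ->
  (forall x, 0 <= x <= l -> `|H2 x| <= B2) ->
  (Jp 1 (ct (cut l H)) <=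
    ((l * B0 + 2 * B1 + l * B2) * Int (fun t => (oneDsqr t)^-1)%R)%:E)%E.
Proof.
move=> l0 DH DH1 cH2 Hl HB0 HB1 HB2.
have LH : L1 (cut l H) by apply: L1_cut => x xl; exact: derive_continuous (DH x xl).
have LH2 : L1 (cut l H2) by exact: L1_cut.
have l00 : 0 <= (0 : R) <= l by apply/andP; split => //; exact: ltW.
have l0l : 0 <= l <= l by apply/andP; split => //; exact: ltW.
set C := _ + _ + _.
have b0 : 0 <= B0 by exact: le_trans (HB0 0 l00).
have b1 : 0 <= B1 by exact: le_trans (HB1 0 l00).
have b2 : 0 <= B2 by exact: le_trans (HB2 0 l00).
have k0 t : `|ct (cut l H) t| <= l * B0.
  by apply: le_trans (ct_norm_le t LH) _; apply: Int_cut_le => //; exact: ltW.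
have k2 t : `|ct (cut l H2) t| <= l * B2.
  by apply: le_trans (ct_norm_le t LH2) _; apply: Int_cut_le => //; exact: ltW.
have pt t : `|ct (cut l H) t| <= C * (oneDsqr t)^-1.
  have o0 : 0 < oneDsqr t by rewrite (lt_le_trans ltr01) // oneDsqr_ge1.
  rewrite -[_ * _^-1]/(_ / _) ler_pdivlMr //.
  have [->|t0] := eqVneq t 0.
    rewrite /oneDsqr expr0n /= addr0 mulr1 /C -addrA; apply: le_trans (k0 0) _.
    by rewrite lerDl addr_ge0 // mulr_ge0 // ltW.
  rewrite /oneDsqr mulrDr mulr1 /C -addrA lerD //.
  rewrite -[X in _ * X]ger0_norm ?sqr_ge0 // -normrM (ct_cut_ibp l0 t0 DH DH1 cH2 Hl).
  rewrite mulrBl !mulfVK ?expf_neq0 //.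
  apply: le_trans (ler_normB _ _) _; rewrite lerD //.
  apply: le_trans (ler_normB _ _) _; rewrite mulr2n mulrDl mul1r lerD //; last exact: HB1.
  rewrite normrM -[leRHS]mul1r; apply: ler_pM => //; first exact: cos_max.
  exact: HB1.
have C0 : 0 <= C by rewrite /C !addr_ge0 // mulr_ge0 // ltW.
rewrite -RintegralZl //; last exact: L1_oneDsqrV.
rewrite L1_Int; last by apply: L1Z; exact: L1_oneDsqrV.
apply: ge0_le_integral => //.
- by apply: measurable_normX; exact: (bddm_ct LH).1.
- by apply/measurable_EFinP; apply: L1_measurable; apply: L1Z; exact: L1_oneDsqrV.
- by move=> t _; rewrite lee_fin expr1.
Qed.

Definition fejer l : R -> R := ct (cut l (fun x => l - x)).

Lemma derive_subl l x : is_derive x 1 (fun y => l - y) (-1).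
Proof.
apply: is_derive_eq (is_deriveB (is_derive_cst l x 1) (is_derive_id x 1)) _.
by rewrite sub0r.
Qed.

Lemma L1_cut_fejer l : L1 (cut l (fun x => l - x)).
Proof. by apply: L1_cut => x _; exact: derive_continuous (derive_subl l x). Qed.

Lemma fejerE l t : 0 < l -> t != 0 -> fejer l t = (1 - cos (t * l)) / t ^+ 2.
Proof.
move=> l0 t0.
have D0 x : 0 <= x <= l -> is_derive x 1 (fun y => l - y) (-1) by move=> _; exact: derive_subl.
have D1 x : 0 <= x <= l -> is_derive x 1 (fun=> -1 : R) 0 by move=> _; exact: is_derive_cst.
have c0 x : 0 <= x <= l -> {for x, continuous (fun=> 0 : R)} by move=> _; exact: cvg_cst.
rewrite /fejer (ct_cut_ibp l0 t0 D0 D1 c0 (subrr l)).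
rewrite [X in _ - X / _](_ : _ = 0); last first.
  rewrite /ct /cut /Rintegral -[RHS]/(fine 0%E); congr fine; rewrite integral0_eq // => x _.
  by rewrite mul0r mulr0.
by rewrite mul0r subr0 mulrN1 opprK addrC.
Qed.

Lemma fejer_ge0 l t : 0 < l -> 0 <= fejer l t.
Proof.
move=> l0; have [->|t0] := eqVneq t 0; last first.
  by rewrite fejerE // divr_ge0 ?sqr_ge0 // subr_ge0 cos_le1.
apply: Rintegral_ge0 => x _; rewrite mul0r cos0 mul1r.
by case: (boolP (0 <= x <= l)) => xl; [rewrite cut_in //; lra|rewrite cut_out].
Qed.

(** The bound is independent of l, whereas the mass of [fejer l] grows at least linearly in l
    ([Int_fejer_ge]): after normalization, the mass away from 0 disappears. *)
Lemma fejer_tail l t d : 0 < l -> 0 < d -> d <= `|t| ->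
  fejer l t <= 2 * (1 + (d ^+ 2)^-1) * (oneDsqr t)^-1.
Proof.
move=> l0 d0 dt; have t0 : t != 0 by rewrite -normr_gt0 (lt_le_trans d0).
have o0 : 0 < oneDsqr t by rewrite (lt_le_trans ltr01) // oneDsqr_ge1.
have d20 : 0 < d ^+ 2 by rewrite exprn_gt0.
have t20 : 0 < t ^+ 2 by rewrite exprn_even_gt0.
have dt2 : d ^+ 2 <= t ^+ 2 by rewrite -[X in _ <= X]real_normK ?num_real // lerXn2r ?nnegrE // ltW.
rewrite fejerE // ler_pdivrMr //.
have -> : 2 * (1 + (d ^+ 2)^-1) * (oneDsqr t)^-1 * t ^+ 2 =
  2 * (((1 + (d ^+ 2)^-1) * t ^+ 2) / oneDsqr t) by ring.
have h1 : 1 <= ((1 + (d ^+ 2)^-1) * t ^+ 2) / oneDsqr t.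
  rewrite ler_pdivlMr // mul1r /oneDsqr mulrDl mul1r addrC lerD2l.
  by rewrite mulrC ler_pdivlMr // mul1r.
by have := cos_geN1 (t * l); lra.
Qed.

Lemma L1_fejer l : 0 < l -> L1 (fejer l).
Proof.
move=> l0; have := bddm_ct (L1_cut_fejer l); rewrite -/(fejer l) => -[mf _].
apply: L1P => //; apply: le_lt_trans (ltry _).
have D0 x : 0 <= x <= l -> is_derive x 1 (fun y => l - y) (-1) by move=> _; exact: derive_subl.
have D1 x : 0 <= x <= l -> is_derive x 1 (fun=> -1 : R) 0 by move=> _; exact: is_derive_cst.
have c0 x : 0 <= x <= l -> {for x, continuous (fun=> 0 : R)} by move=> _; exact: cvg_cst.
apply: (Jp1_ct_cut_le (B0 := l) (B1 := 1) (B2 := 0) l0 D0 D1 c0 (subrr l)).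
- by move=> x xl; rewrite ger0_norm; lra.
- by move=> x _; rewrite normrN1.
- by move=> x _; rewrite normr0.
Qed.

Lemma cos_ge_cos1 t : `|t| <= 1 -> cos 1 <= cos t.
Proof.
move=> t1; rewrite -(cos_norm t).
have pi1 : 1 <= pi :> R by apply: le_trans (pi_ge2 R); rewrite ler1n.
rewrite leNgt ltr_cos -?leNgt // in_itv /= ?ler01 // normr_ge0 /=.
exact: le_trans pi1.
Qed.

Lemma Int_fejer_ge l : 0 < l -> cos 1 / 4 * l <= Int (fejer l).
Proof.
move=> l0; have c0 : 0 < cos 1 :> R by exact: cos1_gt0.
(* For x in [0, l / 2] one has t x <= 1 and l - x >= l / 2, so the integrand is at least cos 1 * l /
   2 on an interval of length l / 2; on the rest of [0, l] it is nonnegative. *)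
have pt t : 0 <= t <= l^-1 -> cos 1 / 4 * l ^+ 2 <= fejer l t.
  move=> /andP[t0 tl].
  have -> : cos 1 / 4 * l ^+ 2 = Int (fun x => (cos 1 * l / 2) * \1_(`[0, l / 2]%classic : set R) x).
    rewrite RintegralZl //; last exact: L1_indic_itv.
    by rewrite Int_indic_itv ?divr_ge0 ?ltW // subr0; field.
  apply: le_Rintegral => //.
  - by apply: L1Z; exact: L1_indic_itv.
  - by apply: L1_cosM; exact: L1_cut_fejer.
  - move=> x _; case: (boolP (0 <= x <= l)) => xl; last first.
      rewrite cut_out // mulr0 indicE memNset ?mulr0 //= in_itv /= => /andP[x0 xl2].
      by move/negP: xl; apply; rewrite x0 /=; lra.
    have cx : cos 1 <= cos (t * x).
      apply: cos_ge_cos1; rewrite ger0_norm; last by rewrite mulr_ge0 //; case/andP: xl.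
      case/andP: xl => x0 xl; rewrite -(mulVf (lt0r_neq0 l0)).
      by apply: ler_pM.
    rewrite cut_in // indicE; case: (boolP (x \in _)) => /=.
      rewrite inE /= in_itv /= mulr1 => /andP[x0 xl2].
      by rewrite -mulrA; apply: ler_pM; lra.
    by move=> _; rewrite mulr0 mulr_ge0 //; lra.
have -> : cos 1 / 4 * l = Int (fun t => (cos 1 / 4 * l ^+ 2) * \1_(`[0, l^-1]%classic : set R) t).
  rewrite RintegralZl //; last exact: L1_indic_itv.
  by rewrite Int_indic_itv ?invr_ge0 ?ltW // subr0; field; rewrite gt_eqF.
apply: le_Rintegral => //; [by apply: L1Z; exact: L1_indic_itv|exact: L1_fejer|].
move=> t _; rewrite indicE; case: (boolP (t \in _)) => /=.
  by rewrite inE /= in_itv /= mulr1; exact: pt.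
by move=> _; rewrite mulr0; exact: fejer_ge0.
Qed.

End FejerKernel.

(** * The Fejer approximate identity and reduction of density to the Fejer kernels *)

Section ApproximateIdentity.
Variable R : realType.
Implicit Types (f g h k u v w phi psi : R -> R) (l e : R).
Local Notation leb := (@lebesgue_measure R).
Local Notation Int := (Rintegral leb setT).

Lemma normr_indicM_le f (A : set R) x : `|f x * \1_A x| <= `|f x|.
Proof.
by rewrite normrM indicE; case: (_ \in _); rewrite /= ?normr1 ?mulr1 // normr0 mulr0.
Qed.

Lemma Jp_trunc_itv p g e : (p == 1)%N || (p == 2)%N -> measurable_fun setT g ->
  (Jp p g < +oo)%E -> 0 < e -> exists n : nat,
  (Jp p (fun x => g x - g x * \1_(`[- n%:R, n%:R]%classic : set R) x)%R < e%:E)%E.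
Proof.
move=> p12 mg goo e0.
apply: (Jp_trunc (A := fun n => `[- n%:R, n%:R]%classic)) => // x.
near=> n; rewrite /= in_itv /= -ler_norml.
by near: n; exact: nbhs_infty_ger.
Unshelve. all: end_near. Qed.

Lemma L1_trunc_itv p g (n : nat) : (p == 1)%N || (p == 2)%N -> measurable_fun setT g ->
  (Jp p g < +oo)%E -> L1 (fun x => g x * \1_(`[- n%:R, n%:R]%classic : set R) x).
Proof.
move=> p12 mg goo.
have mI : measurable_fun setT (\1_(`[- n%:R, n%:R]%classic : set R) : R -> R).
  by apply: measurable_indic; exact: measurable_itv.
have mgI : measurable_fun setT (fun x => g x * \1_(`[- n%:R, n%:R]%classic : set R) x).
  exact: measurable_funM.
have Lp : L1 (fun x => `|g x| ^+ p).
  apply: L1P; first by apply: measurable_funX; exact: measurableT_comp.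
  rewrite (_ : Jp _ _ = Jp p g) //; apply: eq_integral => x _.
  by rewrite expr1 ger0_norm ?exprn_ge0.
apply: (L1_le (g := fun x => \1_(`[- n%:R, n%:R]%classic : set R) x + `|g x| ^+ p)) => //.
  move=> x; rewrite [leRHS]ger0_norm ?addr_ge0 ?exprn_ge0 // normrM.
  rewrite indicE; case: (_ \in _); rewrite ?normr0 ?mulr0 ?addr_ge0 ?exprn_ge0 //=.
  rewrite normr1 mulr1; case/orP: p12 => /eqP ->; first by rewrite expr1 lerDr.
  by have := sqr_ge0 (`|g x| - 1); have := normr_ge0 (g x); nra.
by apply: L1D => //; exact: L1_indic_itv.
Qed.

Lemma bddm_indicM f (A : set R) : measurable A -> bddm f -> bddm (fun x => f x * \1_A x).
Proof.
move=> mA [mf [M fM]]; split; first exact: measurable_funM.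
by exists M => x; exact: le_trans (normr_indicM_le f A x) _.
Qed.

(** Here v need not be integrable when p = 2. Its truncations are, and for them commutativity lets
    [conv_translates] apply with psi as the translated function. *)
Lemma conv_Lp_translates p psi v : (p == 1)%N || (p == 2)%N ->
  L1 psi -> (Jp p psi < +oo)%E -> bddm v -> (Jp p v < +oo)%E ->
  translates_approx p psi (conv psi v).
Proof.
move=> p12 Lpsi psioo bv voo; have [mv _] := bv; have mpsi := L1_measurable Lpsi.
apply: translates_approx_closed => //; first exact: measurable_conv.
move=> e e0; set N := Int (fun s => `|psi s|) ^+ p.
have N0 : 0 <= N by rewrite exprn_ge0 // Rintegral_ge0.
have [|n vn] := Jp_trunc_itv (e := e / (N + 1)) p12 mv voo.
  by rewrite divr_gt0 // ltr_wpDl.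
pose v' x := v x * \1_(`[- n%:R, n%:R]%classic : set R) x.
have bv' : bddm v' by apply: bddm_indicM => //; exact: measurable_itv.
have [mv' _] := bv'.
exists (conv psi v'); split; first exact: measurable_conv.
  rewrite (@eq_Jp _ _ _ (conv psi (fun x => v x - v' x))); last first.
    by move=> x; rewrite convB.
  apply: le_lt_trans (Jp_conv p12 Lpsi (measurable_funB mv mv')) _.
  rewrite -/N; apply: (@le_lt_trans _ _ (N%:E * (e / (N + 1))%:E)%E).
    by apply: lee_wpmul2l; [rewrite lee_fin|exact: ltW].
  rewrite -EFinM lte_fin mulrA ltr_pdivrMr ?ltr_wpDl // mulrC ltr_pM2l //.
  by rewrite ltrDl.
have -> : conv psi v' = conv v' psi by apply/funext => x; exact: convC.
apply: conv_translates => //; exact: (L1_trunc_itv _ p12).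
Qed.

Lemma convZ h k (c : R) x : L1 h -> bddm k -> conv h (fun y => c * k y) x = c * conv h k x.
Proof.
move=> Lh bk; rewrite /conv -RintegralZl //; last exact: bddm_L1_section.
by apply: eq_Rintegral => s _; rewrite mulrCA.
Qed.

(** With w the kernel normalized to mass 1, the error is the w-average of g (x) - g (x - s).
    Continuity of translation handles |s| < d, and [fejer_tail] handles the remaining s. *)
Lemma fejer_approx p g e : (p == 1)%N || (p == 2)%N -> L1 g -> (Jp p g < +oo)%E -> 0 < e ->
  exists l, 0 < l /\ exists c : R, (Jp p (fun x => g x - c * conv g (fejer l) x)%R < e%:E)%E.
Proof.
move=> p12 Lg goo e0; have mg := L1_measurable Lg.
have e2 : 0 < e / 2 by rewrite divr_gt0.
have [d d0 dg] := translation_cvg p12 Lg goo e2.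
pose K0 := Int (fun t => (oneDsqr t)^-1).
have K00 : 0 <= K0.
  by apply: Rintegral_ge0 => x _; rewrite invr_ge0 (le_trans ler01) // oneDsqr_ge1.
set G := fine (Jp p g); have G0 : 0 <= G by rewrite fine_ge0 // Jp_ge0.
have GE : Jp p g = G%:E by rewrite fineK // ge0_fin_numE // Jp_ge0.
set D := 2 * (1 + (d ^+ 2)^-1).
have D0 : 0 <= D by rewrite mulr_ge0 // addr_ge0 // invr_ge0 exprn_ge0 // ltW.
have c1 : 0 < cos 1 / 4 :> R by rewrite divr_gt0 // cos1_gt0.
(* T divided by the mass of [fejer l] bounds the far part; 4 G bounds the [Jp] of a difference of
   two translates. The choice of l makes that mass at least (T + 1) / (e / 2), so the far part is
   below e / 2. *)
pose T := 4 * G * (D * K0).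
have T0 : 0 <= T := mulr_ge0 (mulr_ge0 (ler0n _ 4) G0) (mulr_ge0 D0 K00).
pose l := (T + 1) / (e / 2) / (cos 1 / 4).
have l0 : 0 < l by rewrite /l divr_gt0 // divr_gt0 // ltr_wpDl.
have Lfl := L1_fejer l0; have mfl := L1_measurable Lfl.
have Il : (T + 1) / (e / 2) <= Int (fejer l).
  have -> : (T + 1) / (e / 2) = cos 1 / 4 * l by rewrite /l [RHS]mulrC divfK // gt_eqF.
  exact: Int_fejer_ge.
have I0 : 0 < Int (fejer l) by apply: lt_le_trans Il; rewrite divr_gt0 // ltr_wpDl.
exists l; split => //; exists (Int (fejer l))^-1; set c := _^-1.
have c0 : 0 < c by rewrite invr_gt0.
pose w s := c * fejer l s.
have w0 s : 0 <= w s by rewrite mulr_ge0 ?fejer_ge0 // ltW.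
have Lw : L1 w by exact: L1Z.
have mw := L1_measurable Lw.
have Iw : Int w = 1 by rewrite RintegralZl // /c mulVf // gt_eqF.
have Inw : Int (fun s => `|w s|) = 1.
  by rewrite -Iw; apply: eq_Rintegral => s _; rewrite ger0_norm.
have bf : bddm (fejer l) by exact: bddm_ct (L1_cut_fejer l).
have bw : bddm w.
  split => //; case: bf => _ [M fM]; exists (c * M) => x.
  by rewrite normrM gtr0_norm // ler_pM2l.
pose K (s x : R) := g x - g (x - s).
have mK : measurable_fun setT (fun z : R * R => K z.1 z.2).
  apply: measurable_funB; first exact: measurable_snd_comp.
  by apply: (measurableT_comp mg); apply: measurable_funB.
rewrite (@eq_Jp _ _ _ (fun x => Int (fun s => w s * K s x))); last first.
  move=> x; rewrite -[in LHS]convZ // -/w convC // /conv.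
  rewrite -{1}[g x]mul1r -Iw -RintegralZr // -RintegralB //; last 2 first.
  - by under eq_fun do rewrite mulrC; exact: L1Z.
  - exact: L1_bddm_sw.
  by apply: eq_Rintegral => s _; rewrite /K mulrBr.
apply: le_lt_trans (Jp_param p12 Lw mK) _.
rewrite Inw expr1n mul1e.
have LB : L1 (fun s => e / 2 * w s + 4 * G * c * (D * (oneDsqr s)^-1)).
  by apply: L1D; apply: L1Z => //; apply: L1Z; exact: L1_oneDsqrV.
apply: (@le_lt_trans _ _ (\int[leb]_s (e / 2 * w s + 4 * G * c * (D * (oneDsqr s)^-1))%:E)%E).
  have o0 s : 0 <= (oneDsqr s)^-1 :> R by rewrite invr_ge0 (le_trans ler01) // oneDsqr_ge1.
  have Do s : 0 <= D * (oneDsqr s)^-1 by rewrite mulr_ge0.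
  have Gc : 0 <= 4 * G * c := mulr_ge0 (mulr_ge0 (ler0n _ 4) G0) (ltW c0).
  apply: ge0_le_integral => //.
  - by move=> s _; rewrite mule_ge0 // Jp_ge0.
  - apply: emeasurable_funM; first by apply/measurable_EFinP; exact: measurableT_comp.
    apply: (measurable_paramE (F := fun s x => (`|K s x| ^+ p)%:E)).
    by apply/measurable_EFinP; apply: measurable_funX; exact: measurableT_comp.
  - by apply/measurable_EFinP; exact: L1_measurable.
  move=> s _; rewrite ger0_norm //.
  have [sd|ds] := ltP `|s| d.
    apply: (@le_trans _ _ ((w s)%:E * (e / 2)%:E)%E).
      apply: lee_wpmul2l; first by rewrite lee_fin.
      rewrite -JpN (@eq_Jp _ _ _ (fun x => g (x + - s) - g x)); last by move=> x; rewrite opprB.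
      by apply/ltW/dg; rewrite normrN.
    by rewrite -EFinM lee_fin mulrC lerDl mulr_ge0.
  apply: (@le_trans _ _ ((w s)%:E * (4 * G)%:E)%E).
    apply: lee_wpmul2l; first by rewrite lee_fin.
    apply: le_trans (JpB p12 mg (measurable_shift (- s) mg)) _.
    by rewrite Jp_shift // GE -EFinD -EFinM lee_fin; lra.
  rewrite -EFinM lee_fin; apply: (@le_trans _ _ (4 * G * c * (D * (oneDsqr s)^-1))); last first.
    by rewrite lerDr mulr_ge0 // ltW.
  rewrite /w (mulrC (c * _)) [leLHS]mulrA; apply: ler_wpM2l => //; exact: fejer_tail.
rewrite -L1_Int // lte_fin RintegralD //; last 2 first.
- exact: L1Z.
- by apply: L1Z; apply: L1Z; exact: L1_oneDsqrV.
rewrite RintegralZl // Iw mulr1 RintegralZl //; last by apply: L1Z; exact: L1_oneDsqrV.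
rewrite RintegralZl //; last exact: L1_oneDsqrV.
rewrite -/K0.
suff : 4 * G * c * (D * K0) < e / 2 by lra.
have -> : 4 * G * c * (D * K0) = T * c by rewrite /T; ring.
rewrite /c -[_ * _]/(T / _) ltr_pdivrMr //.
apply: (@lt_le_trans _ _ (e / 2 * ((T + 1) / (e / 2)))); last by rewrite ler_pM2l.
by rewrite mulrC divfK ?gt_eqF // ltrDl.
Qed.

(** [conv_comm] moves psi outwards: c g' * [fejer l] is close to c g' * (psi * u) = psi * (c g' *
    u), which [conv_Lp_translates] approximates by translates. *)
Lemma translates_dense_of_fejer p psi : (p == 1)%N || (p == 2)%N ->
  L1 psi -> (Jp p psi < +oo)%E ->
  (forall l, 0 < l -> forall e, 0 < e -> exists u, [/\ bddm u, (Jp p u < +oo)%E &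
    (Jp p (fun x => fejer l x - conv psi u x)%R < e%:E)%E]) ->
  forall g, measurable_fun setT g -> (Jp p g < +oo)%E -> translates_approx p psi g.
Proof.
move=> p12 Lpsi psioo Hf g mg goo; have mpsi := L1_measurable Lpsi.
apply: translates_approx_closed => // e e0.
have e4 : 0 < e / 4 by rewrite divr_gt0.
have e16 : 0 < e / 4 / 4 by rewrite divr_gt0.
have [n gn] := Jp_trunc_itv p12 mg goo e4.
pose g' x := g x * \1_(`[- n%:R, n%:R]%classic : set R) x.
have Lg' : L1 g' by exact: (L1_trunc_itv _ p12).
have mg' := L1_measurable Lg'.
have g'oo : (Jp p g' < +oo)%E.
  by apply: le_lt_trans goo; apply: Jp_le => // x; exact: normr_indicM_le.
have [l [l0 [c cg]]] := fejer_approx p12 Lg' g'oo e16.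
set N := (`|c| ^+ p) * Int (fun s => `|g' s|) ^+ p.
have N0 : 0 <= N by rewrite mulr_ge0 // exprn_ge0 // Rintegral_ge0.
(* Convolving with c g' multiplies the error in the kernel by at most N. *)
have eN : 0 < e / 4 / 4 / (N + 1) by rewrite divr_gt0 // ltr_wpDl.
have [u [bu uoo fu]] := Hf l l0 _ eN.
have bf : bddm (fejer l) by exact: bddm_ct (L1_cut_fejer l).
have [mf _] := bf; have [mu _] := bu.
have bpu : bddm (conv psi u) by exact: bddm_conv.
have bgu : bddm (conv g' u) by exact: bddm_conv.
have bv : bddm (fun x => c * conv g' u x).
  case: bgu => m [M uM]; split; first exact: measurable_funM.
  by exists (`|c| * M) => x; rewrite normrM ler_wpM2l.
have [mv _] := bv.
have mguoo : (Jp p (fun x => c * conv g' u x)%R < +oo)%E.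
  rewrite JpZ; last by case: bgu.
  apply: lte_mul_pinfty; rewrite ?lee_fin ?exprn_ge0 //.
  apply: le_lt_trans (Jp_conv p12 Lg' mu) _.
  by apply: lte_mul_pinfty; rewrite ?lee_fin ?exprn_ge0 // Rintegral_ge0.
exists (conv psi (fun x => c * conv g' u x)); split.
- exact: measurable_conv.
- apply: (@Jp_sub_lt _ _ _ g') => //; first exact: measurable_conv.
  apply: (@Jp_sub_lt _ _ _ (fun x => c * conv g' (fejer l) x)) => //.
  + by apply: measurable_funM => //; exact: measurable_conv.
  + exact: measurable_conv.
  rewrite (@eq_Jp _ _ _ (fun x => c * conv g' (fun y => fejer l y - conv psi u y) x)); last first.
    by move=> x; rewrite convZ // (conv_comm Lpsi Lg' bu) -mulrBr -convB.
  have mfu : measurable_fun setT (fun y => fejer l y - conv psi u y).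
    by apply: measurable_funB => //; case: bpu.
  rewrite JpZ; last exact: measurable_conv.
  apply: (@le_lt_trans _ _ (N%:E * (e / 4 / 4 / (N + 1))%:E)%E).
    rewrite /N EFinM -muleA; apply: lee_wpmul2l; first by rewrite lee_fin exprn_ge0.
    apply: le_trans (Jp_conv p12 Lg' mfu) _.
    apply: lee_wpmul2l; last exact: ltW.
    by rewrite lee_fin exprn_ge0 // Rintegral_ge0.
  rewrite -EFinM lte_fin mulrA ltr_pdivrMr ?ltr_wpDl // mulrC ltr_pM2l //.
  by rewrite ltrDl.
- exact: conv_Lp_translates.
Qed.

End ApproximateIdentity.

(** * Wiener's theorem in L1 *)

Section WienerL1.
Variable R : realType.
Implicit Types (f g h k u v w phi psi : R -> R) (l e b q x : R).
Local Notation leb := (@lebesgue_measure R).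
Local Notation Int := (Rintegral leb setT).

Lemma ct_continuous f : L1 f -> continuous (ct f).
Proof.
move=> Lf x.
have Ix : x \in `]x - 1, x + 1[%classic.
  by rewrite inE /= in_itv /= ltrBlDr ltrDl ltr01.
have Lnf := L1_norm Lf.
apply: (@continuity_under_integral R _ _ leb (fun z t => cos (z * t) * f t) setT measurableT
  (x - 1) (x + 1) _ _ (fun t => `|f t|) Lnf _ x Ix).
- by move=> y _; exact: L1_cosM.
- apply: aeW => t _ y _; apply: cvgM; last exact: cvg_cst.
  rewrite (_ : (fun z => cos (z * t)) = (fun z => cos (t * z))).
    by rewrite mulrC; exact: (derive_continuous (derive_cosM t y)).
  by apply/funext => z; rewrite mulrC.
- by move=> y _; apply: aeW => t _; rewrite normrM ler_piMl // cos_max.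
Qed.

Lemma st_continuous f : L1 f -> continuous (st f).
Proof.
move=> Lf x.
have Ix : x \in `]x - 1, x + 1[%classic.
  by rewrite inE /= in_itv /= ltrBlDr ltrDl ltr01.
have Lnf := L1_norm Lf.
apply: (@continuity_under_integral R _ _ leb (fun z t => sin (z * t) * f t) setT measurableT
  (x - 1) (x + 1) _ _ (fun t => `|f t|) Lnf _ x Ix).
- by move=> y _; exact: L1_sinM.
- apply: aeW => t _ y _; apply: cvgM; last exact: cvg_cst.
  rewrite (_ : (fun z => sin (z * t)) = (fun z => sin (t * z))).
    by rewrite mulrC; exact: (derive_continuous (derive_sinM t y)).
  by apply/funext => z; rewrite mulrC.
- by move=> y _; apply: aeW => t _; rewrite normrM ler_piMl // sin_max.
Qed.

(** Each derivative of P^-m brings down a factor of order m and one more P^-1 <= b^-1, and two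
    derivatives are taken. What matters is that C does not depend on m. *)
Lemma Jp1_ct_powerV_le l (P P1 P2 : R -> R) (p1 p2 b : R) : 0 < l -> 0 < b ->
  (forall x : R, is_derive x 1 P (P1 x)) -> (forall x : R, is_derive x 1 P1 (P2 x)) ->
  continuous P2 -> (forall x, `|P1 x| <= p1) -> (forall x, `|P2 x| <= p2) ->
  (forall x, 0 <= x <= l -> b <= P x) ->
  exists C : R, 0 <= C /\ forall m : nat,
    (Jp 1 (ct (cut l (fun x => (l - x) * (P x ^+ m)^-1)%R)) <=
     (C * m.+1%:R ^+ 2 * (b ^+ m)^-1)%:E)%E.
Proof.
move=> l0 b0 DP DP1 cP2 bP1 bP2 bP.
have p10 : 0 <= p1 by exact: le_trans (bP1 0).
have p20 : 0 <= p2 by exact: le_trans (bP2 0).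
have bv0 : 0 < b^-1 by rewrite invr_gt0.
set K := Int (fun t => (oneDsqr t)^-1).
have K0 : 0 <= K.
  by apply: Rintegral_ge0 => x _; rewrite invr_ge0 (le_trans ler01) // oneDsqr_ge1.
(* a0, a1 and a2 bound the density and its first two derivatives on [0, l] after division by (m +
   1)^2 b^-m. *)
pose a0 := l; pose a1 := 1 + l * p1 / b.
pose a2 := 2 * p1 / b + l * (p2 / b + p1 ^+ 2 / b ^+ 2).
have l00 := ltW l0; have bv00 := ltW bv0.
have a10 : 0 <= a1 by rewrite /a1 addr_ge0 // mulr_ge0 // mulr_ge0.
have a20 : 0 <= a2.
  rewrite /a2 addr_ge0 //; first by rewrite mulr_ge0 // mulr_ge0.
  rewrite mulr_ge0 // addr_ge0 //; first by rewrite mulr_ge0.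
  by rewrite mulr_ge0 ?exprn_ge0 // invr_ge0 exprn_ge0 // ltW.
exists ((l * a0 + 2 * a1 + l * a2) * K); split.
  by rewrite mulr_ge0 // addr_ge0 ?mulr_ge0 // addr_ge0 // mulr_ge0.
move=> m; set M := m.+1%:R : R.
have M1 : 1 <= M by rewrite ler1n.
have mM : m%:R <= M :> R by rewrite ler_nat.
have M2 : M <= M ^+ 2 by rewrite expr2 ler_peMr // (le_trans ler01).
have P0 x : 0 <= x <= l -> 0 < P x by move=> /bP; exact: lt_le_trans.
pose G j x := (P x ^+ j)^-1.
have bG j x : 0 <= x <= l -> 0 <= G j x <= (b ^+ j)^-1.
  move=> xl; rewrite invr_ge0 exprn_ge0 ?(ltW (P0 x xl)) //=.
  rewrite lef_pV2 ?posrE ?exprn_gt0 ?P0 // lerXn2r ?nnegrE ?(ltW b0) ?(ltW (P0 x xl)) //.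
  exact: bP.
have DG j x : 0 <= x <= l -> is_derive x 1 (G j) (- (j%:R * P1 x) * G j.+1 x).
  by move=> xl; apply: derive_invX => //; rewrite gt_eqF // P0.
pose H x := (l - x) * G m x.
pose H1 x := -1 * G m x + (l - x) * (- (m%:R * P1 x) * G m.+1 x).
pose H2 x := -1 * (- (m%:R * P1 x) * G m.+1 x) +
  (-1 * (- (m%:R * P1 x) * G m.+1 x) +
   (l - x) * (- (m%:R * P2 x) * G m.+1 x +
              - (m%:R * P1 x) * (- (m.+1%:R * P1 x) * G m.+2 x))).
have DH x : 0 <= x <= l -> is_derive x 1 H (H1 x).
  by move=> xl; exact: derive_mul (derive_subl l x) (DG m x xl).
have DmP1 (x : R) : is_derive x 1 (fun y => - (m%:R * P1 y)) (- (m%:R * P2 x)).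
  have := derive_scale (- m%:R) (DP1 x).
  by rewrite mulNr; under eq_fun do rewrite mulNr.
have DH1 x : 0 <= x <= l -> is_derive x 1 H1 (H2 x).
  move=> xl; apply: derive_add; first exact: derive_scale (DG m x xl).
  apply: derive_mul (derive_subl l x) _.
  exact: derive_mul (DmP1 x) (DG m.+1 x xl).
have cG j x : 0 <= x <= l -> {for x, continuous (G j)}.
  by move=> xl; exact: derive_continuous (DG j x xl).
have cP1 (x : R) : {for x, continuous P1} by exact: derive_continuous (DP1 x).
have cst_ (c x : R) : {for x, continuous (fun=> c)} by exact: cvg_cst.
have cs (x : R) : {for x, continuous (fun y => l - y)} by exact: derive_continuous (derive_subl l x).
have cH2 x : 0 <= x <= l -> {for x, continuous H2}.
  move=> xl; have c1 := cG m.+1 x xl; have c2 := cG m.+2 x xl.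
  have e1 j : {for x, continuous (fun y => - (j%:R * P1 y))}.
    exact: continuous_at_opp (continuous_at_mul (cst_ j%:R x) (cP1 x)).
  have e1' : {for x, continuous (fun y => - (m%:R * P2 y))}.
    exact: continuous_at_opp (continuous_at_mul (cst_ m%:R x) (cP2 x)).
  have e2 := continuous_at_mul (cst_ (-1) x) (continuous_at_mul (e1 m) c1).
  have e3 := continuous_at_add (continuous_at_mul e1' c1) (continuous_at_mul (e1 m) (continuous_at_mul (e1 m.+1) c2)).
  exact: continuous_at_add e2 (continuous_at_add e2 (continuous_at_mul (cs x) e3)).
have Hl : H l = 0 by rewrite /H subrr mul0r.
set B := (b ^+ m)^-1.
have B0 : 0 < B by rewrite invr_gt0 exprn_gt0.
have BS : (b ^+ m.+1)^-1 = B / b by rewrite exprSr invfM.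
have BSS : (b ^+ m.+2)^-1 = B / b ^+ 2 by rewrite -addn2 exprD invfM.
have nG j x : 0 <= x <= l -> `|G j x| <= (b ^+ j)^-1.
  by move=> xl; have /andP[g0 g1] := bG j x xl; rewrite ger0_norm.
have nl x : 0 <= x <= l -> `|l - x| <= l by move=> xl; rewrite ger0_norm; lra.
have nP1G x : 0 <= x <= l -> `|- (m%:R * P1 x) * G m.+1 x| <= M * p1 * (B / b).
  move=> xl; rewrite -BS normrM normrN normrM; apply: ler_pM => //; last exact: nG.
  by apply: ler_pM => //; rewrite ger0_norm.
have nP2G x : 0 <= x <= l -> `|- (m%:R * P2 x) * G m.+1 x| <= M * p2 * (B / b).
  move=> xl; rewrite -BS normrM normrN normrM; apply: ler_pM => //; last exact: nG.
  by apply: ler_pM => //; rewrite ger0_norm.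
have nP11G x : 0 <= x <= l ->
    `|- (m%:R * P1 x) * (- (m.+1%:R * P1 x) * G m.+2 x)| <= (M * p1) * (M * p1 * (B / b ^+ 2)).
  move=> xl; rewrite -BSS normrM normrN normrM; apply: ler_pM => //.
    by apply: ler_pM => //; rewrite ger0_norm.
  rewrite normrM normrN normrM; apply: ler_pM => //; last exact: nG.
  by apply: ler_pM => //; rewrite ger0_norm // (le_trans ler01).
have M20 : 0 <= M ^+ 2 by rewrite exprn_ge0 // (le_trans ler01).
have M21 : 1 <= M ^+ 2 by exact: le_trans M2.
have nH x : 0 <= x <= l -> `|H x| <= a0 * M ^+ 2 * B.
  move=> xl; rewrite normrM; apply: ler_pM => //; last exact: nG.
  by apply: le_trans (nl x xl) _; rewrite /a0 ler_peMr // ltW.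
have bB0 : 0 <= B / b by rewrite mulr_ge0 // ltW.
have bB20 : 0 <= B / b ^+ 2 by rewrite mulr_ge0 ?ltW // invr_gt0 exprn_gt0.
have nH1 x : 0 <= x <= l -> `|H1 x| <= a1 * M ^+ 2 * B.
  move=> xl; apply: le_trans (ler_normD _ _) _; have -> : a1 * M ^+ 2 * B = M ^+ 2 * B + l * p1 / b * M ^+ 2 * B by rewrite /a1; ring.
  rewrite lerD //.
    by rewrite normrM normrN1 mul1r; apply: le_trans (nG m x xl) _; rewrite ler_peMl // ltW.
  rewrite normrM; apply: (@le_trans _ _ (l * (M * p1 * (B / b)))).
    by apply: ler_pM => //; [exact: nl|exact: nP1G].
  have -> : l * p1 / b * M ^+ 2 * B = l * (M ^+ 2 * (p1 * (B / b))) by ring.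
  rewrite -mulrA ler_pM2l // ler_wpM2r // mulr_ge0 //.
have nH2 x : 0 <= x <= l -> `|H2 x| <= a2 * M ^+ 2 * B.
  move=> xl; have h1 : `|-1 * (- (m%:R * P1 x) * G m.+1 x)| <= M ^+ 2 * (p1 * (B / b)).
    rewrite normrM normrN1 mul1r; apply: le_trans (nP1G x xl) _.
    by rewrite -mulrA ler_wpM2r // mulr_ge0.
  have h2 : `|(l - x) * (- (m%:R * P2 x) * G m.+1 x +
              - (m%:R * P1 x) * (- (m.+1%:R * P1 x) * G m.+2 x))| <=
      l * (M ^+ 2 * (p2 * (B / b)) + M ^+ 2 * (p1 ^+ 2 * (B / b ^+ 2))).
    rewrite normrM; apply: ler_pM => //; first exact: nl.
    apply: le_trans (ler_normD _ _) _; apply: lerD.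
      apply: le_trans (nP2G x xl) _; rewrite -mulrA ler_wpM2r // mulr_ge0 //.
    apply: le_trans (nP11G x xl) _; rewrite le_eqVlt; apply/orP; left; apply/eqP.
    by ring.
  have -> : a2 * M ^+ 2 * B = M ^+ 2 * (p1 * (B / b)) + (M ^+ 2 * (p1 * (B / b)) +
     l * (M ^+ 2 * (p2 * (B / b)) + M ^+ 2 * (p1 ^+ 2 * (B / b ^+ 2)))).
    by rewrite /a2; ring.
  apply: le_trans (ler_normD _ _) _; rewrite lerD //.
  by apply: le_trans (ler_normD _ _) _; rewrite lerD.
apply: le_trans (Jp1_ct_cut_le l0 DH DH1 cH2 Hl nH nH1 nH2) _.
by rewrite lee_fin -/K le_eqVlt; apply/orP; left; apply/eqP; ring.
Qed.

End WienerL1.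

(** * The perturbation operator and the Neumann series *)

Section WienerTheoremL1.
Variable R : realType.
Implicit Types (f g h k u v w phi psi : R -> R) (l e b q x : R).
Local Notation leb := (@lebesgue_measure R).
Local Notation Int := (Rintegral leb setT).

Definition conv_sym psi k := conv psi (conv (fun t => psi (- t)) k).

Definition norm_ft2 psi x : R := ct psi x ^+ 2 + st psi x ^+ 2.

Lemma norm_ft2_continuous psi : L1 psi -> continuous (norm_ft2 psi).
Proof.
move=> Lp x; apply: cvgD; first by apply: cvgM; exact: ct_continuous.
by apply: cvgM; exact: st_continuous.
Qed.

Lemma bddm_conv_sym psi k : L1 psi -> bddm k -> bddm (conv_sym psi k).
Proof. by move=> Lp bk; apply: bddm_conv => //; apply: bddm_conv => //; exact: L1_opp. Qed.

Lemma bddmD f g : bddm f -> bddm g -> bddm (fun x => f x + g x).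
Proof.
move=> [mf [M fM]] [mg [N gN]]; split; first exact: measurable_funD.
by exists (M + N) => x; apply: le_trans (ler_normD _ _) _; exact: lerD.
Qed.

Lemma bddmB f g : bddm f -> bddm g -> bddm (fun x => f x - g x).
Proof.
move=> [mf [M fM]] [mg [N gN]]; split; first exact: measurable_funB.
by exists (M + N) => x; apply: le_trans (ler_normB _ _) _; exact: lerD.
Qed.

Lemma conv_symD psi f g : L1 psi -> bddm f -> bddm g ->
  conv_sym psi (fun x => f x + g x) = (fun x => conv_sym psi f x + conv_sym psi g x).
Proof.
move=> Lp bf bg; have Lo := L1_opp Lp; apply/funext => x; rewrite /conv_sym -convD //.
- by congr (conv psi _ x); apply/funext => y; rewrite convD.
- exact: bddm_conv.
- exact: bddm_conv.
Qed.

Lemma conv_symB psi f g : L1 psi -> bddm f -> bddm g ->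
  conv_sym psi (fun x => f x - g x) = (fun x => conv_sym psi f x - conv_sym psi g x).
Proof.
move=> Lp bf bg; have Lo := L1_opp Lp; apply/funext => x; rewrite /conv_sym -convB //.
- by congr (conv psi _ x); apply/funext => y; rewrite convB.
- exact: bddm_conv.
- exact: bddm_conv.
Qed.

Lemma conv_sym_comm psi psi' k : L1 psi -> L1 psi' -> bddm k ->
  conv_sym psi (conv_sym psi' k) = conv_sym psi' (conv_sym psi k).
Proof.
move=> Lp Lp' bk; have Lo := L1_opp Lp; have Lo' := L1_opp Lp'; rewrite /conv_sym.
have b1 := bddm_conv Lo' bk; have b2 := bddm_conv Lo b1; have b3 := bddm_conv Lo bk.
by rewrite (conv_comm Lo Lp' b1) (conv_comm Lp Lp' b2) (conv_comm Lo Lo' bk) (conv_comm Lp Lo' b3).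
Qed.

(** The operator Q, kept as a difference of iterated convolutions since psi * psi~ may diverge at
    some points. *)
Definition conv_sym_diff psi psi' k x := conv_sym psi' k x - conv_sym psi k x.

Section ConvSymDiff.
Variables (psi psi' : R -> R).
Hypotheses (Lp : L1 psi) (Lp' : L1 psi').
Local Notation Q := (conv_sym_diff psi psi').

Lemma bddm_conv_sym_diff k : bddm k -> bddm (Q k).
Proof. by move=> bk; exact: bddmB (bddm_conv_sym Lp' bk) (bddm_conv_sym Lp bk). Qed.

Lemma bddm_iter_conv_sym_diff j k : bddm k -> bddm (iter j Q k).
Proof. by move=> bk; elim: j => //= j; exact: bddm_conv_sym_diff. Qed.

Lemma conv_sym_diffD f k : bddm f -> bddm k ->
  Q (fun x => f x + k x) = (fun x => Q f x + Q k x).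
Proof.
move=> bf bk; apply/funext => y; rewrite /conv_sym_diff.
by rewrite (conv_symD Lp bf bk) (conv_symD Lp' bf bk) opprD addrACA.
Qed.

Lemma iter_conv_sym_diffD j f k : bddm f -> bddm k ->
  iter j Q (fun x => f x + k x) = (fun x => iter j Q f x + iter j Q k x).
Proof.
move=> bf bk; elim: j => [|j IH]; first by [].
rewrite iterS IH; exact: conv_sym_diffD (bddm_iter_conv_sym_diff j bf) (bddm_iter_conv_sym_diff j bk).
Qed.

Lemma conv_sym_diff_comm k : bddm k -> Q (conv_sym psi k) = conv_sym psi (Q k).
Proof.
move=> bk.
transitivity (fun x => conv_sym psi (conv_sym psi' k) x - conv_sym psi (conv_sym psi k) x).
  by apply/funext => x; rewrite /conv_sym_diff (conv_sym_comm Lp' Lp bk).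
exact/esym/(conv_symB Lp (bddm_conv_sym Lp' bk) (bddm_conv_sym Lp bk)).
Qed.

Lemma iter_conv_sym_diff_comm j k : bddm k ->
  iter j Q (conv_sym psi k) = conv_sym psi (iter j Q k).
Proof.
move=> bk; elim: j => [|j IH]; first by [].
rewrite !iterS IH; exact: conv_sym_diff_comm (bddm_iter_conv_sym_diff j bk).
Qed.

End ConvSymDiff.

(** psi' * psi'~ - psi * psi~ = (psi' - psi) * psi'~ + psi * (psi'~ - psi~), and each summand has
    norm at most D N. The 4 is two summands times the factor 2 of [JpD]. *)
Lemma Jp1_conv_sym_diff psi psi' k : L1 psi -> L1 psi' ->
  (forall x, `|psi' x| <= `|psi x|) -> bddm k ->
  (Jp 1 (fun x => conv_sym psi' k x - conv_sym psi k x)%R <=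
   (4 * Int (fun s => `|psi s|) * Int (fun s => `|psi s - psi' s|))%:E * Jp 1 k)%E.
Proof.
move=> Lp Lp' pp bk; have Lo := L1_opp Lp; have Lo' := L1_opp Lp'.
have LB : L1 (fun x => psi' x - psi x) by exact: L1B.
have LBo : L1 (fun x => psi' (- x) - psi (- x)) by exact: L1B.
have [mk _] := bk.
have mo := (bddm_conv Lo bk).1; have mo' := (bddm_conv Lo' bk).1.
rewrite (@eq_Jp _ _ _ (fun x => conv (fun x => psi' x - psi x) (conv (fun t => psi' (- t)) k) x +
   conv psi (conv (fun x => psi' (- x) - psi (- x)) k) x)); last first.
  move=> x; rewrite convBl //; last exact: bddm_conv.
  rewrite (_ : conv (fun x => psi' (- x) - psi (- x)) k =
    (fun y => conv (fun t => psi' (- t)) k y - conv (fun t => psi (- t)) k y)); last first.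
    by apply/funext => y; rewrite convBl.
  by rewrite convB ?addrA ?subrK //; apply: bddm_conv.
apply: le_trans (JpD (p := 1%N) isT _ _) _.
- by apply: measurable_conv => //; exact: L1_measurable.
- apply: measurable_conv; first exact: L1_measurable.
  by apply: measurable_conv => //; exact: L1_measurable.
set N := Int (fun s => `|psi s|); set D := Int (fun s => `|psi s - psi' s|).
have N0 : 0 <= N by exact: Rintegral_ge0.
have D0 : 0 <= D by exact: Rintegral_ge0.
have DE : Int (fun s => `|psi' s - psi s|) = D by apply: eq_Rintegral => s _; rewrite distrC.
have DoE : Int (fun s => `|psi' (- s) - psi (- s)|) = D.
  rewrite -DE -[RHS](Int_reflect 0); last first.
    by apply: measurableT_comp => //; exact: L1_measurable.
  by apply: eq_Rintegral => s _; rewrite sub0r.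
have N'N : Int (fun s => `|psi' (- s)|) <= N.
  rewrite /N -[leRHS](Int_reflect 0); last by apply: measurableT_comp => //; exact: L1_measurable.
  apply: le_Rintegral => //; first exact: L1_norm Lo'.
    exact: L1_norm (L1_reflect 0 Lp).
  by move=> s _; rewrite sub0r.
have J0 := Jp_ge0 1 k.
have h1 : (Jp 1 (conv (fun x => psi' x - psi x) (conv (fun t => psi' (- t)) k))%R <=
    (D * N)%:E * Jp 1 k)%E.
  apply: le_trans (Jp_conv (p := 1%N) isT LB mo') _; rewrite expr1 DE EFinM -muleA.
  apply: lee_wpmul2l; first by rewrite lee_fin.
  apply: le_trans (Jp_conv (p := 1%N) isT Lo' mk) _; rewrite expr1.
  by apply: lee_wpmul2r => //; rewrite lee_fin.
have h2 : (Jp 1 (conv psi (conv (fun x => psi' (- x) - psi (- x)) k))%R <=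
    (D * N)%:E * Jp 1 k)%E.
  apply: le_trans (Jp_conv (p := 1%N) isT Lp _) _.
    by apply: measurable_conv => //; exact: L1_measurable.
  rewrite expr1 -/N mulrC EFinM -muleA; apply: lee_wpmul2l; first by rewrite lee_fin.
  by apply: le_trans (Jp_conv (p := 1%N) isT LBo mk) _; rewrite expr1 DoE.
apply: (@le_trans _ _ (2%:E * ((D * N)%:E * Jp 1 k + (D * N)%:E * Jp 1 k))%E).
  by apply: lee_wpmul2l; [rewrite lee_fin|exact: leeD h1 h2].
rewrite -ge0_muleDl ?lee_fin ?mulr_ge0 // muleA -EFinD -EFinM.
by apply: lee_wpmul2r => //; rewrite lee_fin le_eqVlt; apply/orP; left; apply/eqP; ring.
Qed.

(** The bound equals the one on Q in [Jp1_conv_sym_diff], so a single truncation makes both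
    small. *)
Lemma norm_ft2_diff psi psi' x : L1 psi -> L1 psi' -> (forall x, `|psi' x| <= `|psi x|) ->
  `|norm_ft2 psi' x - norm_ft2 psi x| <=
  4 * Int (fun s => `|psi s|) * Int (fun s => `|psi s - psi' s|).
Proof.
move=> Lp Lp' pp.
set N := Int (fun s => `|psi s|); set D := Int (fun s => `|psi s - psi' s|).
have LB : L1 (fun x => psi x - psi' x) by exact: L1B.
have N'N : Int (fun s => `|psi' s|) <= N.
  by apply: le_Rintegral => //; exact: L1_norm.
have cN : `|ct psi x| <= N := ct_norm_le x Lp.
have sN : `|st psi x| <= N := st_norm_le x Lp.
have cN' : `|ct psi' x| <= N := le_trans (ct_norm_le x Lp') N'N.
have sN' : `|st psi' x| <= N := le_trans (st_norm_le x Lp') N'N.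
have cD : `|ct psi x - ct psi' x| <= D by rewrite -ctB //; exact: ct_norm_le.
have sD : `|st psi x - st psi' x| <= D by rewrite -stB //; exact: st_norm_le.
rewrite distrC /norm_ft2.
have -> : ct psi x ^+ 2 + st psi x ^+ 2 - (ct psi' x ^+ 2 + st psi' x ^+ 2) =
  (ct psi x - ct psi' x) * (ct psi x + ct psi' x) + (st psi x - st psi' x) * (st psi x + st psi' x).
  by ring.
apply: le_trans (ler_normD _ _) _; rewrite !normrM.
have -> : 4 * N * D = D * (N + N) + D * (N + N) by ring.
by apply: lerD; apply: ler_pM => //; apply: le_trans (ler_normD _ _) _; exact: lerD.
Qed.

Lemma sqr_le_expn2 (m : nat) : (m.+1 ^ 2 <= 4 * 2 ^ m)%N.
Proof.
have H (k : nat) : ((k.+2).+1 ^ 2 <= 4 * 2 ^ k.+2)%N.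
  elim: k => // k IH; rewrite (expnS 2 k.+2) mulnCA.
  apply: leq_trans (leq_mul (leqnn 2) IH); lia.
by case: m => [|[|m]].
Qed.

(** In [wiener_L1] the 3 is the quotient of 3 c / 4 by c / 4. Since (m + 1)^2 <= 4 * 2^m, a multiple
    of (2 / 3)^m remains. *)
Lemma sqr_geometric_small (C e : R) : 0 <= C -> 0 < e ->
  exists m : nat, C * m.+1%:R ^+ 2 / 3 ^+ m < e.
Proof.
move=> C0 e0.
have q1 : `|2 / 3 : R| < 1 by rewrite ger0_norm; lra.
have /cvgrPdist_lt := cvg_geometric (4 * C + 1) q1.
move=> /(_ e e0) cv; near \oo => m; exists m.
have : `|0 - geometric (4 * C + 1) (2 / 3) m| < e by near: m.
rewrite sub0r normrN /geometric /= ger0_norm; last first.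
  by rewrite mulr_ge0 ?exprn_ge0 ?addr_ge0 ?mulr_ge0.
apply: le_lt_trans; rewrite expr_div_n [leRHS]mulrA ler_pM2r ?invr_gt0 ?exprn_gt0 //.
have h : m.+1%:R ^+ 2 <= 4 * 2 ^+ m :> R.
  by rewrite -!natrX -natrM ler_nat sqr_le_expn2.
have := ler_wpM2l C0 h; have : 0 <= 2 ^+ m :> R by rewrite exprn_ge0.
by rewrite mulrDl mul1r; nra.
Unshelve. all: end_near. Qed.

Lemma L1_monomial_trunc psi (n j : nat) : L1 psi ->
  L1 (fun t => t ^+ j * (psi t * \1_(`[- n%:R, n%:R]%classic : set R) t)).
Proof.
move=> Lp; have mI : measurable (`[- n%:R, n%:R]%classic : set R) by exact: measurable_itv.
apply: (L1_le (g := fun t => n%:R ^+ j * psi t)); last exact: L1Z.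
  apply: measurable_funM; first exact: measurable_funX.
  by apply: measurable_funM; [exact: L1_measurable|exact: measurable_indic].
move=> t; rewrite !normrM indicE; case: (boolP (t \in _)) => /=; last first.
  by rewrite normr0 !mulr0 // mulr_ge0.
rewrite inE /= in_itv /= -ler_norml normr1 mulr1 => tn; apply: ler_pM => //.
by rewrite normrX [leRHS]ger0_norm ?exprn_ge0 // lerXn2r ?nnegrE.
Qed.

Theorem wiener_L1 psi : L1 psi -> (forall x, norm_ft2 psi x != 0) ->
  forall g, L1 g -> translates_approx 1 psi g.
Proof.
move=> Lp P0 g Lg; have mp := L1_measurable Lp.
apply: translates_dense_of_fejer => //; [exact: L1_Jp1| |exact: L1_measurable|exact: L1_Jp1].
move=> l l0 e e0.
have cP := norm_ft2_continuous Lp.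
(* The densities of all kernels live on [0, l], so a positive minimum on this compact interval is
   enough. *)
have [x0 _ Pmin] := EVT_min (ltW l0) (continuous_subspaceT cP).
set c := norm_ft2 psi x0 in Pmin.
have c0 : 0 < c by rewrite lt_neqAle eq_sym P0 addr_ge0 ?sqr_ge0.
set N := Int (fun s => `|psi s|).
have N0 : 0 <= N by exact: Rintegral_ge0.
have [|n pn] := Jp_trunc_itv (p := 1%N) (e := c / 4 / (4 * N + 1)) isT mp (L1_Jp1 Lp).
  by rewrite divr_gt0 ?divr_gt0 // ltr_wpDl // mulr_ge0.
pose psi' t := psi t * \1_(`[- n%:R, n%:R]%classic : set R) t.
have Lp' : L1 psi' by exact: (L1_trunc_itv n (p := 1%N) isT mp (L1_Jp1 Lp)).
have pp x : `|psi' x| <= `|psi x| by exact: normr_indicM_le.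
have Lmon (j : nat) : L1 (fun t => t ^+ j * psi' t) by exact: L1_monomial_trunc.
have small : 4 * N * Int (fun s => `|psi s - psi' s|) <= c / 4.
  have LB : L1 (fun x => psi x - psi' x) by exact: L1B.
  have D0 : 0 <= Int (fun s => `|psi s - psi' s|) by exact: Rintegral_ge0.
  move: pn; rewrite -/psi' -(L1_IntJ LB) lte_fin ltr_pdivlMr ?ltr_wpDl ?mulr_ge0 //.
  by move=> h; apply: ltW; apply: le_lt_trans h; rewrite mulrDr mulr1 mulrC lerDl.
pose P := norm_ft2 psi'.
(* Truncation lowers the minimum c by at most c / 4 ([small]), and the same estimate bounds Q by c /
   4. *)
pose b := 3 * (c / 4).
have b0 : 0 < b by rewrite mulr_gt0 // divr_gt0.
have bP x : 0 <= x <= l -> b <= P x.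
  move=> xl; have := le_trans (norm_ft2_diff x Lp Lp' pp) small; rewrite ler_norml => /andP[+ _].
  have := Pmin x; rewrite in_itv /= => /(_ xl); rewrite /b /P; lra.
(* P is smooth because psi' has compact support. *)
pose p1 t := t * psi' t; pose p2 t := t * p1 t; pose p3 t := t * p2 t.
have L1p1 : L1 p1 by have := Lmon 1%N; under eq_fun do rewrite expr1.
have L1p2 : L1 p2 by have := Lmon 2%N; under eq_fun do rewrite expr2 -mulrA.
have L1p3 : L1 p3 by have := Lmon 3%N; under eq_fun do rewrite exprS expr2 -!mulrA.
(* P1 and P2 are left in the shape that [derive_mul] and [derive_add] produce. *)
pose P1 x := - st p1 x * ct psi' x + ct psi' x * (- st p1 x) +
             (ct p1 x * st psi' x + st psi' x * ct p1 x).
pose P2 x := - ct p2 x * ct psi' x + - st p1 x * (- st p1 x) +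
             (- st p1 x * (- st p1 x) + ct psi' x * (- ct p2 x)) +
             ((- st p2 x * st psi' x + ct p1 x * ct p1 x) +
              (ct p1 x * ct p1 x + st psi' x * (- st p2 x))).
have Dc x : is_derive x 1 (ct psi') (- st p1 x) by exact: derive_ct.
have Ds x : is_derive x 1 (st psi') (ct p1 x) by exact: derive_st.
have Dc1 x : is_derive x 1 (ct p1) (- st p2 x) by exact: derive_ct.
have Ds1 x : is_derive x 1 (st p1) (ct p2 x) by exact: derive_st.
have DNs1 x : is_derive x 1 (fun y => - st p1 y) (- ct p2 x) by exact: is_deriveN (Ds1 x).
have DP x : is_derive x 1 P (P1 x).
  by apply: derive_add; [exact: derive_mul (Dc x) (Dc x)|exact: derive_mul (Ds x) (Ds x)].
have DP1 x : is_derive x 1 P1 (P2 x).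
  apply: derive_add; apply: derive_add.
  - exact: derive_mul (DNs1 x) (Dc x).
  - exact: derive_mul (Dc x) (DNs1 x).
  - exact: derive_mul (Dc1 x) (Ds x).
  - exact: derive_mul (Ds x) (Dc1 x).
have cP2 : continuous P2.
  move=> x; have c0' := ct_continuous Lp' (x := x); have c1' := ct_continuous L1p1 (x := x).
  have c2' := continuous_at_opp (ct_continuous L1p2 (x := x)).
  have s0' := st_continuous Lp' (x := x).
  have s1' := continuous_at_opp (st_continuous L1p1 (x := x)).
  have s2' := continuous_at_opp (st_continuous L1p2 (x := x)).
  exact: continuous_at_add
    (continuous_at_add (continuous_at_add (continuous_at_mul c2' c0') (continuous_at_mul s1' s1'))
      (continuous_at_add (continuous_at_mul s1' s1') (continuous_at_mul c0' c2')))
    (continuous_at_add (continuous_at_add (continuous_at_mul s2' s0') (continuous_at_mul c1' c1'))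
      (continuous_at_add (continuous_at_mul c1' c1') (continuous_at_mul s0' s2'))).
pose n0 := Int (fun t => `|psi' t|); pose n1 := Int (fun t => `|p1 t|).
pose n2 := Int (fun t => `|p2 t|).
have [a0 a1 a2] : [/\ forall x, `|ct psi' x| <= n0, forall x, `|ct p1 x| <= n1 & forall x, `|ct p2 x| <= n2].
  by split=> x; exact: ct_norm_le.
have [d0 d1 d2] : [/\ forall x, `|st psi' x| <= n0, forall x, `|st p1 x| <= n1 & forall x, `|st p2 x| <= n2].
  by split=> x; exact: st_norm_le.
have bP1 x : `|P1 x| <= 4 * (n0 * n1).
  have -> : 4 * (n0 * n1) = n1 * n0 + n0 * n1 + (n1 * n0 + n0 * n1) by ring.
  do 2!(apply: le_trans (ler_normD _ _) _; apply: lerD);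
    try (apply: le_trans (ler_normD _ _) _; apply: lerD);
    by rewrite normrM ?normrN; apply: ler_pM.
have bP2 x : `|P2 x| <= n2 * n0 + n1 * n1 + (n1 * n1 + n0 * n2) + (n2 * n0 + n1 * n1 + (n1 * n1 + n0 * n2)).
  by do 3!(try (apply: le_trans (ler_normD _ _) _; apply: lerD));
    rewrite normrM ?normrN; apply: ler_pM.
have [C [C0 HC]] := Jp1_ct_powerV_le l0 b0 DP DP1 cP2 bP1 bP2 bP.
pose A (m : nat) := cut l (fun x => (l - x) * (P x ^+ m)^-1).
have LA m : L1 (A m).
  apply: L1_cut => x xl; apply: cvgM; first exact: derive_continuous (derive_subl l x).
  have Px0 : P x != 0 by rewrite gt_eqF // (lt_le_trans b0) // bP.
  exact: derive_continuous (derive_invX m Px0 (DP x)).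
have bA m : bddm (ct (A m)) by exact: bddm_ct.
have A0 : ct (A 0) = fejer l.
  congr ct; apply/funext => x; rewrite /A /cut; congr (_ * _); by rewrite expr0 invr1 mulr1.
(* The multiplier P cancels one of the m + 1 factors in the denominator. *)
have AS m : conv_sym psi' (ct (A m.+1)) = ct (A m).
  rewrite /conv_sym conv_sym_ct //; congr ct; apply/funext => x; rewrite -/(norm_ft2 psi' x) -/(P x) /A.
  case: (boolP (0 <= x <= l)) => xl; last by rewrite !cut_out // mul0r.
  have Px0 : P x != 0 by rewrite gt_eqF // (lt_le_trans b0) // bP.
  by rewrite !cut_in // exprS; field; rewrite Px0 expf_neq0.
pose Q := conv_sym_diff psi psi'.
have bQi (j : nat) k : bddm k -> bddm (iter j Q k) by exact: bddm_iter_conv_sym_diff.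
have JQ k : bddm k -> (Jp 1 (Q k) <= (c / 4)%:E * Jp 1 k)%E.
  move=> bk; apply: le_trans (Jp1_conv_sym_diff Lp Lp' pp bk) _.
  by apply: lee_wpmul2r; [exact: Jp_ge0|rewrite lee_fin].
have JQi j k : bddm k -> (Jp 1 (iter j Q k) <= ((c / 4) ^+ j)%:E * Jp 1 k)%E.
  move=> bk; elim: j => [|j IH] /=; first by rewrite expr0 mul1e.
  apply: le_trans (JQ _ (bQi j k bk)) _; rewrite exprS [in leRHS]EFinM -[in leRHS]muleA.
  by apply: lee_wpmul2l => //; rewrite lee_fin ltW // divr_gt0.
have Joo (i : nat) : (Jp 1 (ct (A i)) < +oo)%E by apply: le_lt_trans (HC i) _; rewrite ltry.
(* k_m = ct (A m) satisfies k_m = psi' * psi'~ * k_(m+1), hence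
   Q^m k_m = Q^(m+1) k_(m+1) + psi * psi~ * (Q^m k_(m+1)), and the k_0 = fejer l telescopes. *)
have step (m : nat) : exists w, [/\ bddm w, (Jp 1 w < +oo)%E &
    forall x, fejer l x - conv_sym psi w x = iter m Q (ct (A m)) x].
  elim: m => [|m [w [bw woo Ew]]].
    have b00 : bddm (fun=> 0 : R) by split => //; exists 0 => x; rewrite normr0.
    exists (fun=> 0); split => //.
      by rewrite (_ : Jp _ _ = 0%E) ?ltry //; apply: integral0_eq => x _; rewrite normr0 expr1.
    move=> x; rewrite /= A0 (_ : conv_sym _ _ x = 0) ?subr0 //.
    have := conv_symB Lp b00 b00; rewrite subrr => /(congr1 (@^~ x)) /= ->; by rewrite subrr.
  exists (fun x => w x + iter m Q (ct (A m.+1)) x); split.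
  - by apply: bddmD => //; exact: bQi.
  - apply: le_lt_trans (JpD (p := 1%N) isT _ _) _; [by case: bw|by case: (bQi m _ (bA m.+1))|].
    apply: lte_mul_pinfty => //; apply: lte_add_pinfty => //.
    apply: le_lt_trans (JQi m _ (bA m.+1)) _.
    by apply: lte_mul_pinfty => //; rewrite lee_fin exprn_ge0 // ltW // divr_gt0.
  - move=> x; have bk := bA m.+1; have bU := bddm_conv_sym Lp bk.
    have bQk := bddm_conv_sym_diff Lp Lp' bk.
    have E1 : ct (A m) = (fun x => Q (ct (A m.+1)) x + conv_sym psi (ct (A m.+1)) x).
      by apply/funext => y; rewrite -AS /Q /conv_sym_diff subrK.
    have E2 : iter m Q (ct (A m)) x =
        iter m.+1 Q (ct (A m.+1)) x + conv_sym psi (iter m Q (ct (A m.+1))) x.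
      by rewrite E1 (iter_conv_sym_diffD Lp Lp' m bQk bU) (iter_conv_sym_diff_comm Lp Lp' m bk) iterSr.
    rewrite (conv_symD Lp bw (bQi m _ bk)) opprD addrA Ew E2.
    by rewrite -[RHS](addrK (conv_sym psi (iter m Q (ct (A m.+1))) x)).
have [m Hm] := sqr_geometric_small C0 e0.
have [w [bw woo Ew]] := step m.
have Lo := L1_opp Lp.
exists (conv (fun t => psi (- t)) w); split.
- exact: bddm_conv.
- apply: le_lt_trans (Jp_conv (p := 1%N) isT Lo _) _; first by case: bw.
  by apply: lte_mul_pinfty => //; rewrite lee_fin exprn_ge0 // Rintegral_ge0.
rewrite (@eq_Jp _ _ _ (iter m Q (ct (A m)))) //.
apply: le_lt_trans (JQi m _ (bA m)) _.
apply: (@le_lt_trans _ _ (((c / 4) ^+ m)%:E * (C * m.+1%:R ^+ 2 * (b ^+ m)^-1)%:E)%E).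
  by apply: lee_wpmul2l; [rewrite lee_fin exprn_ge0 // ltW // divr_gt0|exact: HC].
rewrite -EFinM lte_fin; apply: le_lt_trans Hm.
rewrite le_eqVlt; apply/orP; left; apply/eqP; rewrite /b [(3 * _) ^+ m]exprMn.
have c40 : (c / 4) ^+ m != 0 by rewrite expf_neq0 // gt_eqF // divr_gt0.
have t0 : (3 : R) ^+ m != 0 by rewrite expf_neq0.
by rewrite invfM; field; rewrite t0 c40.
Qed.

End WienerTheoremL1.

(** * Wiener's theorem in L2 *)

Section Bessel.
Variable R : realType.
Implicit Types (f g h k u v w phi psi B : R -> R) (l e L x y t : R).
Local Notation leb := (@lebesgue_measure R).
Local Notation Int := (Rintegral leb setT).

Lemma Int_oneDsqrV_scale L : 0 < L ->
  Int (fun x => (oneDsqr (L * x))^-1) = Int (fun x => (oneDsqr x)^-1) / L.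
Proof.
move=> L0.
have D x : is_derive x 1 (fun y => L * y) L.
  by apply: is_derive_eq (derive_scale L (is_derive_id x 1)) _; rewrite mulr1.
have DE : derive1 (fun y => L * y) = cst L.
  by apply/funext => x; rewrite derive1E; case: (D x).
have cW : continuous (fun x : R => (oneDsqr (L * x))^-1).
  move=> x; apply: (@continuous_comp _ _ _ (fun y => L * y) (fun y => (oneDsqr y)^-1)).
    exact: derive_continuous (D x).
  exact: continuous_oneDsqrV.
have W0 x : 0 <= (oneDsqr x)^-1 :> R by rewrite invr_ge0 (le_trans ler01) // oneDsqr_ge1.
have := @increasing_ge0_integration_by_substitutionT R (fun y => L * y) (fun x => (oneDsqr x)^-1).
rewrite DE => H.
have E : (\int[leb]_x ((oneDsqr x)^-1)%:E = \int[leb]_x (L%:E * ((oneDsqr (L * x))^-1)%:E))%E.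
  rewrite H //.
  - by apply: eq_integral => x _; rewrite -EFinM mulrC.
  - by move=> x y xy; rewrite ltr_pM2l.
  - move=> x; exact: cvg_cst.
  - by apply/cvg_ex; exists L; exact: cvg_cst.
  - by apply/cvg_ex; exists L; exact: cvg_cst.
  - apply/cvgrNyPle => A; near=> x.
    by rewrite mulrC -ler_pdivlMr //; near: x; exact: nbhs_ninfty_le.
  - apply/cvgryPge => A; near=> x.
    by rewrite mulrC -ler_pdivrMr //; near: x; exact: nbhs_pinfty_ge.
  - exact: continuous_oneDsqrV.
rewrite /Rintegral E ge0_integralZl //.
- set I := (integral _ _ _).
  have : (0 <= I)%E by exact: integral_ge0.
  case: I => [r| |] //= _; first by rewrite mulrC mulKf // gt_eqF.
  by rewrite gt0_muley ?lte_fin // mul0r.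
- by apply/measurable_EFinP; exact: continuous_measurable_fun.
- by rewrite lee_fin ltW.
Unshelve. all: end_near. Qed.

(** From [fejer L] <= L^2 and x^2 [fejer L x] <= 2 follows (1 + L^2 x^2) [fejer L x] <= 3 L^2; the
    substitution L x then leaves one power of L. *)
Lemma Int_fejer_le L : 0 < L ->
  Int (fejer L) <= 3 * L * Int (fun x => (oneDsqr x)^-1).
Proof.
move=> L0.
have Lf := L1_fejer L0.
have LW : L1 (fun x : R => (oneDsqr (L * x))^-1).
  apply: (L1_le (g := fun x => (1 + (L ^+ 2)^-1) * (oneDsqr x)^-1)); last first.
  - by apply: L1Z; exact: L1_oneDsqrV.
  - move=> x; have o1 y : 0 < oneDsqr y by rewrite (lt_le_trans ltr01) // oneDsqr_ge1.
    have L20 : 0 < (L ^+ 2)^-1 by rewrite invr_gt0 exprn_gt0.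
    have c0 : 0 < 1 + (L ^+ 2)^-1 by rewrite addr_gt0.
    rewrite !ger0_norm ?mulr_ge0 ?invr_ge0 ?(ltW (o1 _)) ?(ltW c0) //.
    rewrite ler_pdivlMr // mulrC ler_pdivrMr // /oneDsqr exprMn.
    have e1 : (L ^+ 2)^-1 * L ^+ 2 = 1 by rewrite mulVf // expf_neq0 // gt_eqF.
    have L2 : 0 <= L ^+ 2 by rewrite exprn_ge0 // ltW.
    have := sqr_ge0 x; move: (L ^+ 2) (x ^+ 2) (L ^+ 2)^-1 e1 L2 L20 => a b c; nra.
  - have mL : measurable_fun setT (fun x : R => L * x) by exact: measurable_funM.
    have mW := L1_measurable (L1_oneDsqrV R).
    exact: (measurableT_comp mW mL).
apply: (@le_trans _ _ (Int (fun x => 3 * L ^+ 2 * (oneDsqr (L * x))^-1))); last first.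
  rewrite RintegralZl // Int_oneDsqrV_scale // le_eqVlt; apply/orP; left; apply/eqP.
  by field; rewrite gt_eqF.
apply: le_Rintegral => //; first exact: L1Z.
move=> x _; have o0 : 0 < oneDsqr (L * x) by rewrite (lt_le_trans ltr01) // oneDsqr_ge1.
rewrite ler_pdivlMr // /oneDsqr mulrDr mulr1 exprMn.
have f0 := fejer_ge0 x L0.
have fL : fejer L x <= L ^+ 2.
  apply: le_trans (ler_norm _) _; apply: le_trans (ct_norm_le x (L1_cut_fejer L)) _.
  by rewrite expr2; apply: Int_cut_le; [exact: ltW|exact: L1_cut_fejer|move=> y yL; rewrite ger0_norm; lra].
have fx : fejer L x * x ^+ 2 <= 2.
  have [->|x0] := eqVneq x 0; first by rewrite expr0n /= mulr0.
  rewrite fejerE // divfK ?expf_neq0 //.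
  by have := cos_geN1 (x * L); lra.
have L2 : 0 <= L ^+ 2 by rewrite exprn_ge0 // ltW.
have : fejer L x * (L ^+ 2 * x ^+ 2) <= 2 * L ^+ 2.
  by rewrite mulrCA [leRHS]mulrC ler_wpM2l.
rewrite -/(ct (cut L (fun y => L - y)) x) -/(fejer L x).
move: (fejer L x) fL f0 => F fL f0; lra.
Qed.

Lemma L1_sqr B : measurable_fun setT B -> (Jp 2 B < +oo)%E -> L1 (fun x => B x ^+ 2).
Proof.
move=> mB Boo; apply: L1P; first exact: measurable_funX.
rewrite (_ : Jp _ _ = Jp 2 B) //; apply: eq_integral => x _.
by rewrite expr1 normrX.
Qed.

Lemma Int_sqr B : measurable_fun setT B -> (Jp 2 B < +oo)%E ->
  (Int (fun x => B x ^+ 2))%:E = Jp 2 B.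
Proof.
move=> mB Boo; rewrite L1_Int; last exact: L1_sqr.
by apply: eq_integral => x _; rewrite -normrX ger0_norm ?sqr_ge0.
Qed.

(* The triangle weight plays the role of a cutoff: it makes Fubini available and turns the
   left-hand side into the pairing of B with its average against the Fejer kernel. *)
Lemma Int_fejer_ct_sqr L B : 0 < L -> L1 B -> (Jp 2 B < +oo)%E ->
  Int (fun t => cut L (fun t => L - t) t * ct B t ^+ 2) <=
  Int (fejer L) * Int (fun x => B x ^+ 2).
Proof.
move=> L0 LB Boo; have mB := L1_measurable LB.
set om := cut L (fun t => L - t).
have Lom : L1 om by exact: L1_cut_fejer.
have mom := L1_measurable Lom.
have bcB := bddm_ct LB; have [mcB [M cBM]] := bcB.
have Lf := L1_fejer L0; have mf := L1_measurable Lf.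
have bf : bddm (fejer L) by exact: bddm_ct.
have LBo := L1_opp LB; have mBo := L1_measurable LBo.
(* cos (t x) cos (t y) is the mean of cos (t (x - y)) and cos (t (x + y)), which yields the mean of
   the convolutions with B and with its reflection. *)
pose D x := 2^-1 * (conv (fejer L) B x + conv (fejer L) (fun y => B (- y)) x).
have ED x : Int (fun t => om t * (cos (t * x) * ct B t)) = D x.
  transitivity (Int (fun t => Int (fun y => om t * (cos (t * x) * (cos (t * y) * B y))))).
    apply: eq_Rintegral => t _; rewrite /ct -RintegralZl //; last exact: L1_cosM.
    by rewrite -RintegralZl //; apply: L1Z; exact: L1_cosM.
  rewrite (@Int_Fubini R (fun t y => om t * (cos (t * x) * (cos (t * y) * B y))) om B) //; last 2 first.
  - apply: measurable_funM; first exact: measurable_fst_comp.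
    apply: measurable_funM; last exact: measurable_cos2.
    have mc : measurable_fun setT (fun t : R => cos (t * x)).
      by have := (bddm_cosM x).1; under eq_fun do rewrite mulrC.
    exact: (measurable_fst_comp mc).
  - move=> t y; rewrite !normrM ler_wpM2l // -[leRHS]mul1r; apply: ler_pM; rewrite ?mulr_ge0 ?cos_max //.
    by rewrite ler_piMl // cos_max.
  rewrite /D -(convC x mB mf) -(convC x mBo mf).
  have -> : conv (fun y => B (- y)) (fejer L) x = Int (fun y => B y * fejer L (x + y)).
    rewrite /conv -[RHS](Int_reflect 0); last first.
      by apply: measurable_funM => //; have := measurable_shift x mf; under eq_fun do rewrite addrC.
    by apply: eq_Rintegral => y _; rewrite sub0r.
  rewrite /conv -RintegralD //; last 2 first.
  - exact: bddm_L1_section.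
  - have bfx : bddm (fun y => fejer L (x + y)).
      split; first by have := measurable_shift x mf; under eq_fun do rewrite addrC.
      by case: bf => _ [N fN]; exists N.
    exact: L1_bddm.
  rewrite -RintegralZl //; last first.
    apply: L1D; first exact: bddm_L1_section.
    apply: L1_bddm => //; split; first by have := measurable_shift x mf; under eq_fun do rewrite addrC.
    by case: bf => _ [N fN]; exists N.
  apply: eq_Rintegral => y _; rewrite -mulrDr mulrCA /fejer -/om /ct.
  rewrite -RintegralD //; try exact: L1_cosM.
  rewrite -RintegralZl //; last by apply: L1D; exact: L1_cosM.
  rewrite -RintegralZl //; last by apply: L1Z; apply: L1D; exact: L1_cosM.
  by apply: eq_Rintegral => t _; rewrite mulrBl mulrDl cosB cosD (mulrC t x) (mulrC t y); field.
have -> : Int (fun t => om t * ct B t ^+ 2) = Int (fun x => B x * D x).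
  transitivity (Int (fun t => Int (fun x => om t * (ct B t * (cos (t * x) * B x))))).
    apply: eq_Rintegral => t _; rewrite expr2 {2}/ct -RintegralZl //; last exact: L1_cosM.
    by rewrite -RintegralZl //; apply: L1Z; exact: L1_cosM.
  rewrite (@Int_Fubini R (fun t x => om t * (ct B t * (cos (t * x) * B x))) om (fun x => M * B x)) //; last 3 first.
  - apply: measurable_funM; first exact: measurable_fst_comp.
    apply: measurable_funM; first exact: measurable_fst_comp.
    exact: measurable_cos2.
  - exact: L1Z.
  - move=> t x; rewrite !normrM ler_wpM2l //; apply: ler_pM; rewrite ?mulr_ge0 //.
      exact: le_trans (cBM t) (ler_norm _).
    by rewrite ler_piMl // cos_max.
  apply: eq_Rintegral => x _; rewrite -ED -RintegralZl //; last first.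
    have := L1_bddm (L1_cosM x Lom) bcB; rewrite (_ : (fun t => _ * ct B t) =
      (fun t => om t * (cos (t * x) * ct B t))) //.
    by apply/funext => t; rewrite (mulrC x); ring.
  by apply: eq_Rintegral => t _; ring.
set I := Int (fejer L); set J := Int (fun x => B x ^+ 2).
have I0 : 0 < I by apply: lt_le_trans (Int_fejer_ge L0); rewrite mulr_gt0 // divr_gt0 // cos1_gt0.
have InE : Int (fun s => `|fejer L s|) = I.
  by apply: eq_Rintegral => s _; rewrite ger0_norm // fejer_ge0.
have JE : J%:E = Jp 2 B by exact: Int_sqr.
have JoE : Jp 2 (fun y => B (- y)) = J%:E.
  by rewrite JE -(Jp_reflect 2 0 mB); apply: eq_Jp => y; rewrite sub0r.
have J0 : 0 <= J by apply: Rintegral_ge0 => x _; exact: sqr_ge0.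
have mD : measurable_fun setT D.
  by apply: measurable_funM => //; apply: measurable_funD; exact: measurable_conv.
have h1 : (Jp 2 (conv (fejer L) B) <= (I ^+ 2 * J)%:E)%E.
  by apply: le_trans (Jp_conv (p := 2%N) isT Lf mB) _; rewrite InE -JE -EFinM.
have h2 : (Jp 2 (conv (fejer L) (fun y => B (- y))%R) <= (I ^+ 2 * J)%:E)%E.
  by apply: le_trans (Jp_conv (p := 2%N) isT Lf mBo) _; rewrite InE JoE -EFinM.
have JD : (Jp 2 D <= (I ^+ 2 * J)%:E)%E.
  have m1 := measurable_conv mf mB; have m2 := measurable_conv mf mBo.
  rewrite /D JpZ; last exact: measurable_funD.
  apply: (@le_trans _ _ ((4^-1)%:E * (2%:E * ((I ^+ 2 * J)%:E + (I ^+ 2 * J)%:E)))%E).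
    apply: lee_pmul.
    - by rewrite lee_fin exprn_ge0.
    - exact: Jp_ge0.
    - by rewrite lee_fin ger0_norm ?invr_ge0 // expr2; lra.
    - apply: le_trans (JpD (p := 2%N) isT m1 m2) _.
      by apply: lee_wpmul2l; [rewrite lee_fin|exact: leeD h1 h2].
  by rewrite -EFinD -!EFinM lee_fin; lra.
have Doo : (Jp 2 D < +oo)%E by apply: le_lt_trans JD _; rewrite ltry.
have LD2 := L1_sqr mD Doo; have LB2 := L1_sqr mB Boo.
have ID : Int (fun x => D x ^+ 2) <= I ^+ 2 * J by rewrite -lee_fin Int_sqr.
have LS : L1 (fun x => I / 2 * B x ^+ 2 + (2 * I)^-1 * D x ^+ 2) by apply: L1D; exact: L1Z.
(* The weight I balances the two terms: as the integral of D^2 is at most I^2 J, each contributes at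
   most I J / 2. *)
have pw x : `|B x * D x| <= I / 2 * B x ^+ 2 + (2 * I)^-1 * D x ^+ 2.
  have -> : I / 2 * B x ^+ 2 + (2 * I)^-1 * D x ^+ 2 = (2 * I)^-1 * ((I * B x) ^+ 2 + D x ^+ 2).
    by field; rewrite gt_eqF.
  rewrite -ler_pdivrMl ?invr_gt0 ?mulr_gt0 // invrK normrM.
  rewrite -[X in _ <= X + _]real_normK ?num_real // -[X in _ <= _ + X]real_normK ?num_real //.
  rewrite normrM (gtr0_norm I0).
  have := sqr_ge0 (I * `|B x| - `|D x|); nra.
apply: (@le_trans _ _ (Int (fun x => I / 2 * B x ^+ 2 + (2 * I)^-1 * D x ^+ 2))).
  apply: le_Rintegral => //.
    apply: (L1_le _ _ LS) => [|x]; first exact: measurable_funM.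
    exact: le_trans (pw x) (ler_norm _).
  by move=> x _; exact: le_trans (ler_norm _) (pw x).
rewrite RintegralD //; try exact: L1Z.
rewrite !RintegralZl // -/J.
apply: (@le_trans _ _ (I / 2 * J + (2 * I)^-1 * (I ^+ 2 * J))).
  by rewrite lerD2l ler_wpM2l // invr_ge0 mulr_ge0 // ltW.
by rewrite le_eqVlt; apply/orP; left; apply/eqP; field; rewrite gt_eqF.
Qed.

Lemma Jp_le_trunc (p : nat) g (K : \bar R) : measurable_fun setT g ->
  (forall n : nat, (\int[leb]_(x in (`[- n%:R, n%:R]%classic : set R)%R) (`|g x| ^+ p)%:E <= K)%E) ->
  (Jp p g <= K)%E.
Proof.
move=> mg H; pose F (n : nat) : set R := `[- n%:R, n%:R]%classic.
have FT : \bigcup_n F n = setT.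
  apply/seteqP; split=> // x _; exists (Num.truncn `|x|).+1 => //.
  rewrite /F /= in_itv /= -ler_norml; apply: ltW.
  by have /andP[] := truncn_itv (normr_ge0 x).
have ndF : nondecreasing_seq F.
  move=> m n mn; rewrite subsetEset => x; rewrite /F /= !in_itv /= -!ler_norml => /le_trans; apply.
  by rewrite ler_nat.
have mF n : measurable (F n) by exact: measurable_itv.
have : (\int[leb]_(x in F n) (`|g x| ^+ p)%:E @[n --> \oo] --> Jp p g)%E.
  rewrite /Jp -FT; apply: ge0_nondecreasing_set_cvg_integral => //.
  by move=> i; apply: measurable_funTS; exact: measurable_normX.
move=> cv; rewrite -(cvg_lim _ cv) //; apply: lime_le; first by apply/cvg_ex; exists (Jp p g).
by apply: nearW => n; exact: H.
Qed.

(** The triangle weight with L = 2 (n + 1) is at least n + 1 on [0, n + 1]. Dividing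
    [Int_fejer_ct_sqr] by n + 1 and using [Int_fejer_le] gives 3 L / (n + 1) = 6 on that interval;
    evenness of [ct B] doubles it to 12, uniformly in n. *)
Lemma bessel B : L1 B -> (Jp 2 B < +oo)%E ->
  (Jp 2 (ct B) <= (12 * Int (fun x => (oneDsqr x)^-1)%R)%:E * Jp 2 B)%E.
Proof.
move=> LB Boo; have mB := L1_measurable LB.
have bcB := bddm_ct LB; have [mcB [M cBM]] := bcB.
set K0 := Int _; have JE := Int_sqr mB Boo; set J := Int _ in JE.
have J0 : 0 <= J by apply: Rintegral_ge0 => x _; exact: sqr_ge0.
have K00 : 0 <= K0.
  by apply: Rintegral_ge0 => x _; rewrite invr_ge0 (le_trans ler01) // oneDsqr_ge1.
rewrite -JE -EFinM; apply: Jp_le_trunc => //.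
move=> n; pose L : R := 2 * n.+1%:R.
have n0 : 0 < n.+1%:R :> R by rewrite ltr0n.
have L0 : 0 < L by rewrite mulr_gt0.
pose S t := ct B t ^+ 2.
have bS : bddm S.
  split; first exact: measurable_funX.
  exists (M ^+ 2) => x; rewrite normrX lerXn2r ?nnegrE //.
  exact: le_trans (cBM x).
have mI (a b : R) : measurable_fun setT (\1_(`[a, b]%classic : set R) : R -> R).
  by apply: measurable_indic; exact: measurable_itv.
have LSI (a b : R) : L1 (fun t => S t * \1_(`[a, b]%classic : set R) t).
  under eq_fun do rewrite mulrC; apply: L1_bddm => //; exact: L1_indic_itv.
have half : Int (fun t => S t * \1_(`[0, n.+1%:R]%classic : set R) t) <= 6 * K0 * J.
  have L1om : L1 (fun t => cut L (fun t => L - t) t * S t).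
    by apply: L1_bddm => //; exact: L1_cut_fejer.
  apply: (@le_trans _ _ (Int (fun t => n.+1%:R^-1 * (cut L (fun t => L - t) t * S t)))).
    apply: le_Rintegral => //; [exact: LSI|exact: L1Z|].
    move=> t _; have S0 : 0 <= S t by exact: sqr_ge0.
    case: (boolP (0 <= t <= L)) => tL.
      rewrite cut_in // mulrA mulrC indicE; case: (boolP (t \in _)) => /=; last first.
        by move=> _; rewrite mul0r mulr_ge0 // mulr_ge0 ?invr_ge0 //; lra.
      rewrite inE /= in_itv /= => /andP[t0 tn]; rewrite ler_wpM2r //.
      by rewrite mulrC ler_pdivlMr // mul1r /L; lra.
    rewrite cut_out // mul0r mulr0 indicE memNset ?mulr0 //= in_itv /= => /andP[t0 tn].
    by move/negP: tL; apply; rewrite t0 /L /=; lra.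
  rewrite RintegralZl //.
  have h := le_trans (Int_fejer_ct_sqr L0 LB Boo) (ler_wpM2r J0 (Int_fejer_le L0)).
  apply: le_trans (ler_wpM2l _ h) _; first by rewrite invr_ge0 ltW.
  by rewrite -/K0 /L le_eqVlt; apply/orP; left; apply/eqP; field; rewrite gt_eqF.
have half' : Int (fun t => S t * \1_(`[- n.+1%:R, 0]%classic : set R) t) <= 6 * K0 * J.
  apply: le_trans half; rewrite -[leLHS](Int_reflect 0); last by apply: measurable_funM => //; case: bS.
  rewrite le_eqVlt; apply/orP; left; apply/eqP; apply: eq_Rintegral => t _.
  rewrite sub0r /S ct_evenx; congr (_ * _); rewrite !indicE; congr (_%:R); congr nat_of_bool.
  by apply/idP/idP; rewrite !inE /= !in_itv /= => /andP[? ?]; apply/andP; split; lra.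
rewrite integral_mkcond.
apply: (@le_trans _ _ (\int[leb]_t ((S t * \1_(`[- n.+1%:R, 0]%classic : set R) t +
    S t * \1_(`[0, n.+1%:R]%classic : set R) t))%:E)%E).
  have S0 t : 0 <= S t by exact: sqr_ge0.
  apply: ge0_le_integral => //.
  - by move=> t _; rewrite patchE; case: ifP.
  - apply/(measurable_restrictT _ (measurable_itv _)); apply: measurable_funTS.
    exact: measurable_normX.
  - by apply/measurable_EFinP; apply: L1_measurable; exact: L1D.
  - move=> t _; rewrite patchE; case: ifPn; last first.
      by move=> _; rewrite lee_fin addr_ge0 // mulr_ge0.
    rewrite inE /= in_itv /= => /andP[tn nt]; rewrite lee_fin real_normK ?num_real // -/(S t) !indicE.
    have nn : n%:R <= n.+1%:R :> R by rewrite ler_nat.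
    have [t0|t0] := leP 0 t.
      have -> : t \in (`[0, n.+1%:R]%classic : set R).
        by rewrite inE /= in_itv /= t0 (le_trans nt).
      by rewrite mulr1 lerDr mulr_ge0.
    have -> : t \in (`[- n.+1%:R, 0]%classic : set R).
      by rewrite inE /= in_itv /= (ltW t0) andbT; lra.
    by rewrite mulr1 lerDl mulr_ge0.
rewrite -L1_Int; last exact: L1D (LSI _ _) (LSI _ _).
rewrite lee_fin RintegralD; [|by []|exact: LSI|exact: LSI].
have -> : 12 * K0 * J = 6 * K0 * J + 6 * K0 * J by ring.
exact: lerD.
Qed.

End Bessel.

(** * Density in L2, and the converses in L1 and L2 *)

Section WienerTheoremL2.
Variable R : realType.
Implicit Types (f g h u v w phi psi B : R -> R) (l e a x y t : R).
Local Notation leb := (@lebesgue_measure R).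
Local Notation Int := (Rintegral leb setT).

Lemma norm_ft2_ge0 psi x : 0 <= norm_ft2 psi x.
Proof. by rewrite addr_ge0 ?sqr_ge0. Qed.

Lemma norm_ft2_eq0 psi x : norm_ft2 psi x = 0 -> ct psi x = 0 /\ st psi x = 0.
Proof.
move=> /eqP; rewrite /norm_ft2 paddr_eq0 ?sqr_ge0 // !sqrf_eq0.
by move=> /andP[/eqP -> /eqP ->].
Qed.

Lemma measurable_norm_ft2 psi : L1 psi -> measurable_fun setT (norm_ft2 psi).
Proof. by move=> Lp; apply: continuous_measurable_fun; exact: norm_ft2_continuous. Qed.

Lemma measurable_norm_ft2_zeros psi : L1 psi -> measurable [set x | norm_ft2 psi x = 0].
Proof.
move=> Lp; have mP := measurable_norm_ft2 Lp.
rewrite (_ : [set x | _] = norm_ft2 psi @^-1` [set 0]); last by [].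
by rewrite -[X in measurable X]setTI; apply: mP => //; exact: measurable_set1.
Qed.

Lemma bddm_norm_ft2 psi : L1 psi -> bddm (norm_ft2 psi).
Proof.
move=> Lp; split; first exact: measurable_norm_ft2.
case: (bddm_ct Lp) => _ [M cM]; case: (bddm_st Lp) => _ [N sN].
exists (M ^+ 2 + N ^+ 2) => x; apply: le_trans (ler_normD _ _) _.
have M0 := le_trans (normr_ge0 _) (cM 0); have N0 := le_trans (normr_ge0 _) (sN 0).
by rewrite !normrX; apply: lerD; rewrite lerXn2r ?nnegrE.
Qed.

Lemma Jp2_lty_of_bounded f (M : R) : L1 f -> (forall x, `|f x| <= M) -> (Jp 2 f < +oo)%E.
Proof.
move=> Lf fM; have M0 : 0 <= M by exact: le_trans (fM 0).
have mf := L1_measurable Lf.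
apply: (@le_lt_trans _ _ (M%:E * Jp 1 f)%E); last first.
  by apply: lte_mul_pinfty; rewrite ?lee_fin //; exact: L1_Jp1.
rewrite /Jp -ge0_integralZl //; last exact: measurable_normX.
apply: ge0_le_integral => //; first exact: measurable_normX.
  by apply: measurable_funeM; exact: measurable_normX.
by move=> x _; rewrite -EFinM lee_fin expr2 expr1 ler_wpM2r.
Qed.

Theorem wiener_L2 psi : L1 psi -> (Jp 2 psi < +oo)%E ->
  leb [set x | norm_ft2 psi x = 0] = 0%E ->
  forall g, measurable_fun setT g -> (Jp 2 g < +oo)%E -> translates_approx 2 psi g.
Proof.
move=> Lp psioo Z0; apply: translates_dense_of_fejer => // l l0 e e0.
pose c := cut l (fun x => l - x).
have Lc : L1 c by exact: L1_cut_fejer.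
have mc := L1_measurable Lc.
have cl x : `|c x| <= l.
  rewrite /c; case: (boolP (0 <= x <= l)) => xl; last by rewrite cut_out // normr0 ltW.
  by rewrite cut_in // ger0_norm; lra.
have coo : (Jp 2 c < +oo)%E by exact: Jp2_lty_of_bounded cl.
have mP := measurable_norm_ft2 Lp.
pose P := norm_ft2 psi.
have P0 x : 0 <= P x by exact: norm_ft2_ge0.
pose d (n : nat) : R := n.+1%:R^-1.
have d0 n : 0 < d n by rewrite invr_gt0.
have Pd0 n x : 0 < P x + d n by rewrite ltr_wpDl.
pose D n x := (P x + d n)^-1.
have mD n : measurable_fun setT (D n).
  apply: continuous_measurable_fun => x; apply: cvgV; first by rewrite gt_eqF.
  by apply: cvgD; [exact: norm_ft2_continuous|exact: cvg_cst].
have bD n : bddm (D n).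
  split=> //; exists (d n)^-1 => x; rewrite ger0_norm ?invr_ge0 ?(ltW (Pd0 n x)) //.
  by rewrite lef_pV2 ?posrE // lerDr.
pose A n x := c x * D n x.
have LA n : L1 (A n) by exact: L1_bddm.
have LAP n : L1 (fun x => A n x * P x) by apply: L1_bddm => //; exact: bddm_norm_ft2.
(* B n = c * d n / (P + d n) tends to 0 almost everywhere since P does not vanish there. *)
pose B n x := c x - A n x * P x.
have LB n : L1 (B n) by exact: L1B.
have BE n x : B n x = c x * (d n * D n x).
  by rewrite /B /A /D; field; rewrite gt_eqF.
have dD n x : 0 <= d n * D n x <= 1.
  rewrite /D mulr_ge0 ?invr_ge0 ?(ltW (d0 n)) ?(ltW (Pd0 n x)) //=.
  by rewrite ler_pdivrMr // mul1r lerDr.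
have Bc n x : `|B n x| <= `|c x|.
  by rewrite BE normrM; have /andP[h1 h2] := dD n x; rewrite (ger0_norm h1) ler_piMr.
have Boo n : (Jp 2 (B n) < +oo)%E.
  by apply: le_lt_trans coo; apply: Jp_le => //; exact: L1_measurable.
set K := 12 * Int (fun x => (oneDsqr x)^-1).
have K0 : 0 <= K.
  rewrite mulr_ge0 //; apply: Rintegral_ge0 => x _.
  by rewrite invr_ge0 (le_trans ler01) // oneDsqr_ge1.
have eK : 0 < e / (K + 1) by rewrite divr_gt0 // ltr_wpDl.
have [n Bn] : exists n, (Jp 2 (B n) < (e / (K + 1))%:E)%E.
  have ic : leb.-integrable setT (fun x => (`|c x| ^+ 2)%:E).
    apply/integrableP; split; first exact: measurable_normX.
    by under eq_integral do rewrite gee0_abs ?lee_fin ?exprn_ge0 //.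
  have dn0 : d n @[n --> \oo] --> (0 : R).
    apply/cvgrPdist_lt => z z0; near=> n; rewrite sub0r normrN gtr0_norm //.
    near: n; exact: near_infty_natSinv_lt (PosNum z0).
  have : (Jp 2 (B n) @[n --> \oo] --> \int[leb]_x cst 0 x)%E.
    have mB n : measurable_fun setT (fun x => (`|B n x| ^+ 2)%:E).
      by apply: measurable_normX; exact: L1_measurable.
    have [||_ _] := @dominated_convergence _ _ R leb setT measurableT
      (fun n x => (`|B n x| ^+ 2)%:E) (cst 0%E) _ mB (measurable_cst _) _ ic; last by [].
    - exists [set x | P x = 0]; split => //; first exact: measurable_norm_ft2_zeros.
      move=> x /= Hx; apply: contrapT => Px0; apply: Hx => _.
      apply: cvg_EFin; first by near=> n.
      rewrite /comp /=.
      have Px : P x != 0 by apply/eqP.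
      have lim : c x * (d n * D n x) @[n --> \oo] --> c x * (0 * (P x + 0)^-1).
        apply: cvgM; first exact: cvg_cst.
        apply: cvgM => //; apply: cvgV; first by rewrite addr0.
        by apply: cvgD => //; exact: cvg_cst.
      have lim2 : `|c x * (d n * D n x)| ^+ 2 @[n --> \oo] --> `|c x * (0 * (P x + 0)^-1)| ^+ 2.
        by rewrite expr2; under eq_fun do rewrite expr2; apply: cvgM; exact: cvg_norm lim.
      by move: lim2; rewrite mul0r mulr0 normr0 expr0n /=; under eq_fun do rewrite -BE.
    - apply: aeW => x n _; rewrite abse_EFin lee_fin ger0_norm ?exprn_ge0 //.
      by rewrite lerXn2r ?nnegrE.
  rewrite integral0 => /fine_cvgP[fin] /cvgrPdist_lt /(_ _ eK) cv.
  near \oo => n; exists n.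
  have fn : Jp 2 (B n) \is a fin_num by near: n.
  have : `|0 - fine (Jp 2 (B n))| < e / (K + 1) by near: n.
  by rewrite sub0r normrN -lte_fin -fine_abse // gee0_abs ?Jp_ge0 // fineK.
have Aoo : (Jp 2 (A n) < +oo)%E.
  have bA x : `|A n x| <= l * (d n)^-1.
    rewrite normrM; apply: ler_pM => //.
    rewrite ger0_norm ?invr_ge0 ?(ltW (Pd0 n x)) //.
    by rewrite lef_pV2 ?posrE // lerDr.
  exact: Jp2_lty_of_bounded bA.
have Lo := L1_opp Lp; have bA := bddm_ct (LA n).
(* [ct (A n)] is not claimed to be integrable; [bessel] places it in L2, and convolving with the
   reflection of psi stays there. *)
exists (conv (fun t => psi (- t)) (ct (A n))); split.
- exact: bddm_conv.
- apply: le_lt_trans (Jp_conv (p := 2%N) isT Lo _) _; first by case: bA.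
  apply: lte_mul_pinfty; rewrite ?lee_fin ?exprn_ge0 ?Rintegral_ge0 //.
  apply: le_lt_trans (bessel (LA n) Aoo) _.
  by apply: lte_mul_pinfty; rewrite ?lee_fin.
rewrite (conv_sym_ct Lp (LA n)).
rewrite (@eq_Jp _ _ _ (ct (B n))); last by move=> x; rewrite /fejer -ctB.
apply: le_lt_trans (bessel (LB n) (Boo n)) _; rewrite -/K.
apply: (@le_lt_trans _ _ (K%:E * (e / (K + 1))%:E)%E).
  by apply: lee_wpmul2l; [rewrite lee_fin|exact: ltW].
rewrite -EFinM lte_fin mulrA ltr_pdivrMr ?ltr_wpDl // mulrC ltr_pM2l //.
by rewrite ltrDl.
Unshelve. all: end_near. Qed.

Lemma ct_shift psi a x : L1 psi ->
  ct (fun t => psi (t + a)) x = cos (x * a) * ct psi x + sin (x * a) * st psi x.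
Proof.
move=> Lp; have mp := L1_measurable Lp.
transitivity (Int (fun t => cos (x * (t - a)) * psi t)).
  rewrite -[RHS](Int_shift a).
    by apply: eq_Rintegral => t _; rewrite addrK.
  apply: measurable_funM => //; apply: (measurable_shift (f := fun t => cos (x * t)) (- a)).
  exact: (bddm_cosM x).1.
rewrite /ct /st -RintegralZl //; last exact: L1_cosM.
rewrite -RintegralZl //; last exact: L1_sinM.
rewrite -RintegralD //; last 2 first.
- by apply: L1Z; exact: L1_cosM.
- by apply: L1Z; exact: L1_sinM.
by apply: eq_Rintegral => t _; rewrite mulrBr cosB; ring.
Qed.

Lemma L1_transl_comb psi cs : L1 psi -> L1 (transl_comb psi cs).
Proof.
move=> Lp; rewrite /transl_comb; apply: L1_sum => p.
by apply: L1Z; exact: L1_shift.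
Qed.

Lemma ct_transl_comb psi cs x : L1 psi -> norm_ft2 psi x = 0 ->
  ct (transl_comb psi cs) x = 0.
Proof.
move=> Lp /norm_ft2_eq0[c0 s0]; elim: cs => [|p cs IH].
  rewrite /ct (_ : (fun t => _) = cst 0); first by rewrite /Rintegral integral0.
  by apply/funext => t; rewrite /transl_comb big_nil mulr0.
have -> : transl_comb psi (p :: cs) = (fun t => p.1 * psi (t + p.2) + transl_comb psi cs t).
  by apply/funext => t; rewrite /transl_comb big_cons.
have Ls : L1 (fun t => psi (t + p.2)) by exact: L1_shift.
rewrite ctD; [|exact: L1Z|exact: L1_transl_comb].
rewrite IH addr0 /ct.
under eq_Rintegral do rewrite mulrCA.
rewrite RintegralZl //; last exact: L1_cosM.
by rewrite -[Int _]/(ct _ x) ct_shift // c0 s0 !mulr0 addr0 mulr0.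
Qed.

(** The test function of both converses: on [-d, d] the phase x t has modulus at most 1, so the
    cosine is at least cos 1 > 0. *)
Lemma ct_indic_ge (d x : R) : 0 < d -> `|x| * d <= 1 ->
  2 * d * cos 1 <= ct (\1_(`[- d, d]%classic : set R)) x.
Proof.
move=> d0 xd; have LI := L1_indic_itv (- d) d.
have -> : 2 * d * cos 1 = Int (fun t => cos 1 * \1_(`[- d, d]%classic : set R) t).
  rewrite RintegralZl // Int_indic_itv; last by lra.
  by ring.
apply: le_Rintegral => //; [exact: L1Z|exact: L1_cosM|].
move=> t _; rewrite indicE; case: (boolP (t \in _)); last by rewrite !mulr0.
rewrite inE /= in_itv /= -ler_norml !mulr1 => td; apply: cos_ge_cos1.
by rewrite normrM (le_trans _ xd) // ler_wpM2l.
Qed.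

(** The value of [ct] at x is bounded by the L1 norm and vanishes on all combinations of translates,
    so an indicator whose transform at x is at least 2 d cos 1 keeps that distance from them. *)
Theorem wiener_L1_converse psi : L1 psi ->
  (forall g, L1 g -> translates_approx 1 psi g) -> forall x, norm_ft2 psi x != 0.
Proof.
move=> Lp H x; apply/eqP => Px0.
pose d := (`|x| + 1)^-1.
have d0 : 0 < d by rewrite invr_gt0 ltr_wpDl.
have xd : `|x| * d <= 1 by rewrite ler_pdivrMr ?ltr_wpDl // mul1r lerDl.
have Lu := L1_indic_itv (- d) d.
have k0 : 0 < 2 * d * cos 1 by rewrite !mulr_gt0 // cos1_gt0.
have [cs] := H _ Lu _ k0; apply/negP; rewrite -leNgt.
have Lc := L1_transl_comb cs Lp.
have Luc : L1 (fun t => \1_(`[- d, d]%classic : set R) t - transl_comb psi cs t) by exact: L1B.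
rewrite -(L1_IntJ Luc) lee_fin.
apply: le_trans (ct_norm_le x Luc); apply: le_trans (ler_norm _).
by rewrite ctB // ct_transl_comb // subr0; exact: ct_indic_ge.
Qed.

(** Z is the countable union of its bounded parts F n. Boundedness makes the indicator of F n
    integrable and lets one test function u have positive transform on the whole of F n. *)
Theorem wiener_L2_converse psi : L1 psi -> (Jp 2 psi < +oo)%E ->
  (forall g, measurable_fun setT g -> (Jp 2 g < +oo)%E -> translates_approx 2 psi g) ->
  leb [set x | norm_ft2 psi x = 0] = 0%E.
Proof.
move=> Lp psioo H; have mp := L1_measurable Lp.
set Z := [set x | _].
have mZ : measurable Z by exact: measurable_norm_ft2_zeros.
pose F (n : nat) : set R := Z `&` `[- n%:R, n%:R]%classic.
have mF n : measurable (F n) by apply: measurableI => //; exact: measurable_itv.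
suff F0 n : leb (F n) = 0%E.
  have -> : Z = \bigcup_n F n.
    apply/seteqP; split => [x Zx|x [n _ []]//]; exists (Num.truncn `|x|).+1 => //.
    split => //=; rewrite in_itv /= -ler_norml; apply: ltW.
    by have /andP[] := truncn_itv (normr_ge0 x).
  apply/negligibleP; first by apply: bigcup_measurable => i _; exact: mF.
  by apply: negligible_bigcup => n; apply/negligibleP; [exact: mF|exact: F0].
apply/eqP/negPn/negP => Fn0.
have Foo : (leb (F n) < +oo)%E.
  apply: (@le_lt_trans _ _ (leb (`[- n%:R, n%:R]%classic : set R))).
    apply: le_measure; [by rewrite inE; exact: mF|by rewrite inE; exact: measurable_itv|].
    exact: subIsetr.
  by rewrite lebesgue_measure_itv /=; case: ifP => _; rewrite -?EFinB ltry.
pose B : R -> R := \1_(F n).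
have IBE : (\int[leb]_x (B x)%:E = leb (F n))%E.
  transitivity (leb (F n `&` setT)); last by rewrite setIT.
  exact: (integral_indic leb measurableT (mF n)).
have LB : L1 B.
  apply/integrableP; split; first by apply/measurable_EFinP; apply: measurable_indic; exact: mF.
  under eq_integral do rewrite abse_EFin ger0_norm //.
  by rewrite IBE.
have IB : 0 < Int B.
  rewrite /Rintegral IBE fine_gt0 // Foo andbT.
  by rewrite lt_neqAle eq_sym Fn0 measure_ge0.
have BM x : `|B x| <= 1 by rewrite /B indicE; case: (_ \in _); rewrite ?normr0 ?normr1.
have Boo : (Jp 2 B < +oo)%E by exact: Jp2_lty_of_bounded BM.
(* Since the transform of psi vanishes on F n, g is orthogonal to the translates of psi. *)
pose g := ct B.
have bg : bddm g by exact: bddm_ct.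
have [mg [M gM]] := bg.
have goo : (Jp 2 g < +oo)%E.
  apply: le_lt_trans (bessel LB Boo) _; apply: lte_mul_pinfty => //.
  rewrite lee_fin mulr_ge0 //; apply: Rintegral_ge0 => x _.
  by rewrite invr_ge0 (le_trans ler01) // oneDsqr_ge1.
have pair v : L1 v -> Int (fun t => v t * g t) = Int (fun x => B x * ct v x).
  move=> Lv; have mv := L1_measurable Lv.
  transitivity (Int (fun t => Int (fun x => v t * (cos (t * x) * B x)))).
    by apply: eq_Rintegral => t _; rewrite -RintegralZl //; exact: L1_cosM.
  rewrite (@Int_Fubini R (fun t x => v t * (cos (t * x) * B x)) v B) //; last 2 first.
  - apply: measurable_funM; first exact: measurable_fst_comp.
    by apply: measurable_cos2; exact: L1_measurable.
  - by move=> t x; rewrite !normrM ler_wpM2l // ler_piMl // cos_max.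
  apply: eq_Rintegral => x _; rewrite /ct -RintegralZl //; last exact: L1_cosM.
  by apply: eq_Rintegral => t _; rewrite (mulrC t); ring.
(* Then |x| d <= 1 for every x in F n, as [ct_indic_ge] requires. *)
pose d : R := (n%:R + 1)^-1.
have d0 : 0 < d by rewrite invr_gt0 ltr_wpDl.
pose u : R -> R := \1_(`[- d, d]%classic : set R).
have Lu : L1 u by exact: L1_indic_itv.
have mu := L1_measurable Lu.
have uM x : `|u x| <= 1 by rewrite /u indicE; case: (_ \in _); rewrite ?normr0 ?normr1.
have uoo : (Jp 2 u < +oo)%E by exact: Jp2_lty_of_bounded uM.
pose k := 2 * d * cos 1 * Int B.
have k0 : 0 < k by rewrite !mulr_gt0 // cos1_gt0.
have ug : k <= Int (fun t => u t * g t).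
  rewrite (pair _ Lu) /k -RintegralZl //; apply: le_Rintegral => //; first exact: L1Z.
    by apply: L1_bddm => //; exact: bddm_ct.
  move=> x _; rewrite mulrC /B indicE; case: (boolP (x \in F n)); last by rewrite !mul0r.
  rewrite inE /F /= in_itv /= -ler_norml !mul1r => -[_ xn]; apply: ct_indic_ge => //.
  by rewrite ler_pdivrMr ?ltr_wpDl // mul1r (le_trans xn) // lerDl.
set G := Int (fun t => g t ^+ 2).
have G0 : 0 <= G by apply: Rintegral_ge0 => t _; exact: sqr_ge0.
(* Weight in v g <= (s / 2) v^2 + g^2 / (2 s). The first term integrates to less than k / 2 because
   the approximation error is below k / s, the second because G / (G + 1) < 1; together they
   contradict [ug]. *)
pose s := (G + 1) / k.
have s0 : 0 < s by rewrite divr_gt0 // ltr_wpDl.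
have [cs hcs] := H u mu uoo _ (divr_gt0 k0 s0).
pose v t := u t - transl_comb psi cs t.
have Lcs := L1_transl_comb cs Lp.
have Lv : L1 v by exact: L1B.
have mv := L1_measurable Lv.
have voo : (Jp 2 v < +oo)%E by apply: lt_trans hcs _; rewrite ltry.
have vg : Int (fun t => u t * g t) = Int (fun t => v t * g t).
  rewrite (pair _ Lu) (pair _ Lv); apply: eq_Rintegral => x _.
  rewrite /B indicE; case: (boolP (x \in F n)); last by rewrite !mul0r.
  by rewrite inE => -[Zx _]; rewrite /v ctB // ct_transl_comb // subr0.
have LV2 := L1_sqr mv voo; have LG2 := L1_sqr mg goo.
have IV : Int (fun t => v t ^+ 2) < k / s by rewrite -lte_fin Int_sqr.
have h0 : Int (fun t => v t * g t) <= s / 2 * Int (fun t => v t ^+ 2) + (2 * s)^-1 * G.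
  rewrite /G -!RintegralZl // -RintegralD //; try exact: L1Z.
  apply: le_Rintegral => //; [exact: L1_bddm|by apply: L1D; exact: L1Z|].
  move=> t _.
  have -> : s / 2 * v t ^+ 2 + (2 * s)^-1 * g t ^+ 2 = (2 * s)^-1 * ((s * v t) ^+ 2 + g t ^+ 2).
    by field; rewrite gt_eqF.
  have s20 : 0 < 2 * s by exact: mulr_gt0.
  rewrite ler_pdivlMl //.
  by have := sqr_ge0 (s * v t - g t); nra.
have h1 : s / 2 * Int (fun t => v t ^+ 2) < k / 2.
  have -> : k / 2 = s / 2 * (k / s) by field; rewrite gt_eqF.
  by rewrite ltr_pM2l // divr_gt0.
have h2 : (2 * s)^-1 * G < k / 2.
  rewrite /s; have -> : (2 * ((G + 1) / k))^-1 * G = k / 2 * (G / (G + 1)).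
    by field; rewrite !gt_eqF // ltr_wpDl.
  by rewrite gtr_pMr ?divr_gt0 // ltr_pdivrMr ?ltr_wpDl // mul1r ltrDl.
have := le_lt_trans h0 (ltrD h1 h2); rewrite -splitr => h3.
by move: ug; rewrite vg leNgt h3.
Qed.

End WienerTheoremL2.

(** * The Andreief-Heine identity *)

Section IteratedIntegrals.
Variable R : realType.
Local Notation leb := (@lebesgue_measure R).
Local Notation Int := (Rintegral leb setT).

Fixpoint all_measurable d (T : measurableType d) (u : seq (T -> R)) : Prop :=
  if u is v :: u' then measurable_fun setT v /\ all_measurable u' else True.

Lemma all_measurable_rcons d (T : measurableType d) (u : seq (T -> R)) v :
  all_measurable u -> measurable_fun setT v -> all_measurable (rcons u v).
Proof. by elim: u => [|w u IH] //= [mw mu] mv; split => //; exact: IH. Qed.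

Lemma measurable_all_sum d (T : measurableType d) (u : seq (T -> R)) :
  all_measurable u -> measurable_fun setT (fun t => \sum_(v <- u) v t).
Proof.
elim: u => [|v u IH] /=; first by move=> _; under eq_fun do rewrite big_nil; exact: measurable_cst.
by move=> [mv mu]; under eq_fun do rewrite big_cons; apply: measurable_funD => //; exact: IH.
Qed.

Lemma measurable_all_nth d (T : measurableType d) (u : seq (T -> R)) i :
  all_measurable u -> measurable_fun setT (fun t => [seq v t | v <- u]`_i).
Proof.
elim: u i => [|v u IH] i /=.
  by move=> _; under eq_fun do rewrite nth_nil; exact: measurable_cst.
by case: i => [|i] [mv mu] //=; exact: IH.
Qed.

(* Measurability in all variables of a function of a list of length k, stated through
   substitution of measurable functions because lists carry no sigma-algebra. *)
Definition seq_measurable (k : nat) (F : seq R -> \bar R) :=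
  forall d (T : measurableType d) (u : seq (T -> R)), size u = k -> all_measurable u ->
    measurable_fun setT (fun t => F [seq v t | v <- u]).

(** Each integration variable joins the parameter space, T becoming T * R; hence the induction over
    all T and the hypothesis over all measurable maps into T. *)
Lemma measurable_iint (k : nat) d (T : measurableType d) (Phi : T -> seq R -> \bar R) :
  (forall d' (T' : measurableType d') (a : T' -> T) (u : seq (T' -> R)),
     measurable_fun setT a -> size u = k -> all_measurable u ->
     measurable_fun setT (fun t => Phi (a t) [seq v t | v <- u])) ->
  measurable_fun setT (fun t => iint k (Phi t)).
Proof.
elim: k d T Phi => [|k IH] d T Phi H /=.
  by apply: (H _ T id [::]) => //; exact: measurable_id.
apply: (measurable_paramE (F := fun t x => iint k (fun s => Phi t (x :: s)))).
apply: (IH _ _ (fun (z : T * R) s => Phi z.1 (z.2 :: s))) => d' T' a u ma su mu.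
apply: (H _ _ (fun t => (a t).1) ((fun t => (a t).2) :: u)) => /=.
- exact: (measurableT_comp measurable_fst ma).
- by rewrite su.
- by split => //; exact: (measurableT_comp measurable_snd ma).
Qed.

Lemma iint_ge0 (k : nat) (F : seq R -> \bar R) : (forall s, 0 <= F s)%E -> (0 <= iint k F)%E.
Proof.
elim: k F => [|k IH] F F0 //=.
by apply: integral_ge0 => x _; exact: IH.
Qed.

Lemma eq_iint (k : nat) (F G : seq R -> \bar R) :
  (forall s, size s = k -> F s = G s) -> iint k F = iint k G.
Proof.
elim: k F G => [|k IH] F G FG /=; first exact: FG.
by apply: eq_integral => x _; apply: IH => s sk; apply: FG; rewrite /= sk.
Qed.

(** The hyperplanes of coordinate sum t fill the space as t varies. In the induction, Tonelli brings
    the first variable x outside, and shifting t by x removes it from the sum at the price of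
    replacing g by its translate. *)
Lemma iint_hyperplane (k : nat) (g : R -> R) (F : seq R -> \bar R) :
  measurable_fun setT g -> (forall t, 0 <= g t) ->
  seq_measurable k.+1 F -> (forall s, 0 <= F s)%E ->
  (\int[leb]_t ((g t)%:E * iint k (fun s => F (rcons s (t - \sum_(x <- s) x)%R)))
   = iint k.+1 (fun s => (g (\sum_(x <- s) x)%R)%:E * F s))%E.
Proof.
elim: k g F => [|k IH] g F mg g0 mF F0.
  rewrite /=; apply: eq_integral => x _ /=.
  by rewrite big_nil subr0 big_cons big_nil addr0.
pose Psi (t x : R) := iint k (fun s => F (x :: rcons s (t - (x + \sum_(y <- s) y))%R)).
have Psi0 t x : (0 <= Psi t x)%E by exact: iint_ge0.
have mPsi : measurable_fun setT (fun z : R * R => Psi z.1 z.2).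
  apply: (measurable_iint (Phi := fun (z : R * R) s =>
    F (z.2 :: rcons s (z.1 - (z.2 + \sum_(y <- s) y))%R))) => d' T' a u ma su mu.
  have := mF _ T' ((fun t => (a t).2) :: rcons u (fun t => (a t).1 - ((a t).2 + \sum_(v <- u) v t))).
  rewrite /= size_rcons su => /(_ erefl) H.
  have ma1 := measurableT_comp measurable_fst ma.
  have ma2 := measurableT_comp measurable_snd ma.
  rewrite (_ : (fun t => _) = (fun t => F ((a t).2 :: [seq v t | v <- rcons u (fun t =>
    (a t).1 - ((a t).2 + \sum_(v <- u) v t))]))); last first.
    by apply/funext => t; rewrite map_rcons big_map.
  apply: H; split => //; apply: all_measurable_rcons => //.
  by apply: measurable_funB => //; apply: measurable_funD => //; exact: measurable_all_sum.
have mgPsi : measurable_fun setT (fun z : R * R => (g z.1)%:E * Psi z.1 z.2)%E.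
  by apply: emeasurable_funM => //; apply/measurable_EFinP; exact: measurable_fst_comp.
transitivity (\int[leb]_t \int[leb]_x ((g t)%:E * Psi t x))%E.
  apply: eq_integral => t _; rewrite ge0_integralZl //.
  - by congr (_ * _)%E; apply: eq_integral => x _; apply: eq_iint => s _; rewrite /= big_cons.
  - exact: (measurableT_comp mPsi (measurable_pair1 t)).
  - by rewrite lee_fin.
have gPsi0 (z : R * R) : (0 <= (g z.1)%:E * Psi z.1 z.2)%E.
  by apply: mule_ge0; [rewrite lee_fin|exact: Psi0].
have /= -> := @fubini_tonelli _ _ _ _ R leb leb (fun z => (g z.1)%:E * Psi z.1 z.2)%E mgPsi gPsi0.
apply: eq_integral => x _.
rewrite -(integral_shift x (f := fun t => (g t)%:E * Psi t x)%E); last first.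
  exact: (measurableT_comp mgPsi (measurable_pair2 x)).
transitivity (\int[leb]_t ((g (t + x)%R)%:E *
    iint k (fun s => F (x :: rcons s (t - \sum_(y <- s) y)%R))))%E.
  apply: eq_integral => t _; congr (_ * _)%E; apply: eq_iint => s _.
  by rewrite opprD addrA addrK.
rewrite (IH (fun t => g (t + x)) (fun s => F (x :: s))) //.
- rewrite -[RHS]/(iint k.+1 (fun s => (g (\sum_(y <- x :: s) y)%R)%:E * F (x :: s))%E).
  by apply: eq_iint => s _; rewrite big_cons addrC.
- exact: (measurable_shift x mg).
- move=> d T u su mu; have := mF _ T (cst x :: u); rewrite /= su => /(_ erefl); apply.
  by split => //; exact: measurable_cst.
Qed.

End IteratedIntegrals.

(** * Complex integrals and separable integrands *)

Section ComplexIntegrals.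
Variable R : realType.
Local Notation leb := (@lebesgue_measure R).
Local Notation Int := (Rintegral leb setT).
Local Notation re := (@complex.Re R).
Local Notation im := (@complex.Im R).
Local Notation C := R[i].

Definition cL1 (h : R -> C) := L1 (fun t => re (h t)) /\ L1 (fun t => im (h t)).

Definition cint (h : R -> C) : C := Complex (Int (fun t => re (h t))) (Int (fun t => im (h t))).

Lemma reD (z w : C) : re (z + w) = re z + re w. Proof. by case: z; case: w. Qed.
Lemma imD (z w : C) : im (z + w) = im z + im w. Proof. by case: z; case: w. Qed.
Lemma reM (z w : C) : re (z * w) = re z * re w - im z * im w.
Proof. by case: z; case: w. Qed.
Lemma imM (z w : C) : im (z * w) = re z * im w + im z * re w.
Proof. by case: z; case: w. Qed.

Lemma cL1Z (c : C) h : cL1 h -> cL1 (fun t => c * h t).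
Proof.
move=> [Lr Li]; split.
  by under eq_fun do rewrite reM; apply: L1B; exact: L1Z.
by under eq_fun do rewrite imM; apply: L1D; exact: L1Z.
Qed.

Lemma cintZ (c : C) h : cL1 h -> cint (fun t => c * h t) = c * cint h.
Proof.
move=> [Lr Li]; apply/eqP; rewrite eq_complex /cint reM imM /=; apply/andP; split; apply/eqP.
  rewrite -!RintegralZl // -RintegralB //; try exact: L1Z.
  by apply: eq_Rintegral => t _; rewrite reM.
rewrite -!RintegralZl // -RintegralD //; try exact: L1Z.
by apply: eq_Rintegral => t _; rewrite imM.
Qed.

Lemma cL1_sum (J : Type) (r : seq J) (h : J -> R -> C) :
  (forall j, cL1 (h j)) -> cL1 (fun t => \sum_(j <- r) h j t).
Proof.
move=> Lh; elim: r => [|j r IH].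
  by split; under eq_fun do rewrite big_nil; exact: L1_0.
have [[a b] [c d]] := (Lh j, IH).
by split; under eq_fun do rewrite big_cons ?reD ?imD; exact: L1D.
Qed.

Lemma cint_sum (J : Type) (r : seq J) (h : J -> R -> C) : (forall j, cL1 (h j)) ->
  cint (fun t => \sum_(j <- r) h j t) = \sum_(j <- r) cint (h j).
Proof.
move=> Lh; elim: r => [|j r IH].
  rewrite big_nil /cint; under eq_Rintegral do rewrite big_nil.
  rewrite [X in Complex _ X](_ : _ = 0); last first.
    by under eq_Rintegral do rewrite big_nil; rewrite /Rintegral integral0.
  by rewrite /Rintegral integral0.
rewrite big_cons -IH; apply/eqP; rewrite eq_complex reD imD /=.
have [[a b] [c d]] := (Lh j, cL1_sum r Lh).
apply/andP; split; apply/eqP.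
  by rewrite -RintegralD //; apply: eq_Rintegral => t _; rewrite big_cons reD.
by rewrite -RintegralD //; apply: eq_Rintegral => t _; rewrite big_cons imD.
Qed.

(** [iint] takes real integrands, so the real part stays outermost while the sum of products is
    integrated one variable at a time, each integral becoming part of the coefficient. *)
Lemma iint_separable (J : finType) (m : nat) (c : J -> C) (h : J -> nat -> R -> C) :
  (forall j i, cL1 (h j i)) ->
  iint m (fun s => (re (\sum_j c j * \prod_(i < m) h j i s`_i))%:E) =
  (re (\sum_j c j * \prod_(i < m) cint (h j i)))%:E.
Proof.
elim: m c h => [|m IH] c h Lh /=.
  by congr (re _)%:E; apply: eq_bigr => j _; rewrite !big_ord0.
transitivity (\int[leb]_x (re (\sum_j (c j * \prod_(i < m) cint (h j i.+1)) * h j 0%N x))%:E)%E.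
  apply: eq_integral => x _.
  rewrite (eq_iint (G := fun s => (re (\sum_j (c j * h j 0%N x) * \prod_(i < m) h j i.+1 s`_i))%:E)).
    rewrite (IH (fun j => c j * h j 0%N x) (fun j i => h j i.+1)) //.
    by congr (re _)%:E; apply: eq_bigr => j _; rewrite mulrAC.
  move=> s _; congr (re _)%:E; apply: eq_bigr => j _.
  by rewrite big_ord_recl /= mulrA.
have Ls : cL1 (fun x => \sum_j (c j * \prod_(i < m) cint (h j i.+1)) * h j 0%N x).
  by apply: cL1_sum => j; exact: cL1Z.
have [Lr _] := Ls.
rewrite -(L1_Int Lr); congr EFin.
rewrite -[LHS]/(re (cint (fun x => \sum_j (c j * \prod_(i < m) cint (h j i.+1)) * h j 0%N x))).
rewrite cint_sum; last by move=> j; exact: cL1Z.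
congr re; apply: eq_bigr => j _; rewrite cintZ //.
by rewrite big_ord_recl /= -mulrA (mulrC (\prod_(i < m) _)).
Qed.

End ComplexIntegrals.

(** * Expansion of the two Vandermonde determinants *)

Section Heine.
Variable R : realType.
Local Notation leb := (@lebesgue_measure R).
Local Notation Int := (Rintegral leb setT).
Local Notation re := (@complex.Re R).
Local Notation im := (@complex.Im R).
Local Notation C := R[i].
Local Notation inC := (real_complex R).

(* [expNi x t] is e^(-ixt). *)
Definition expNi (x t : R) : C := Complex (cos (x * t)) (- sin (x * t)).

Definition monomial_wave (f : R -> R) (x : R) (a : nat) (t : R) : C :=
  inC (t ^+ a * f t) * expNi x t.

(** The Fourier transform at x of t^a f (t). *)
Definition moment (f : R -> R) (x : R) (a : nat) : C :=
  Complex (ct (fun t => t ^+ a * f t) x) (- st (fun t => t ^+ a * f t) x).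

Definition moment_mx n (f : R -> R) (x : R) : 'M[C]_n := \matrix_(i, j) moment f x (i + j).

Lemma expNi0 x : expNi x 0 = 1.
Proof. by rewrite /expNi mulr0 cos0 sin0 oppr0. Qed.

Lemma expNiD x s t : expNi x (s + t) = expNi x s * expNi x t.
Proof.
apply/eqP; rewrite eq_complex reM imM /= mulrDr cosD sinD.
by apply/andP; split; apply/eqP; ring.
Qed.

Lemma expNi_sum x (s : seq R) n : size s = n ->
  expNi x (\sum_(y <- s) y) = \prod_(i < n) expNi x s`_i.
Proof.
move=> <-; rewrite (big_nth 0) big_mkord.
by apply: (big_morph (expNi x)); [exact: expNiD|exact: expNi0].
Qed.

Lemma re_monomial_wave f x a t : re (monomial_wave f x a t) = cos (x * t) * (t ^+ a * f t).
Proof. by rewrite /monomial_wave reM /= mul0r subr0 mulrC. Qed.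

Lemma im_monomial_wave f x a t : im (monomial_wave f x a t) = - (sin (x * t) * (t ^+ a * f t)).
Proof. by rewrite /monomial_wave imM /= mul0r addr0 mulrN mulrC. Qed.

Lemma cL1_monomial_wave (f : R -> R) x a : L1 (fun t => t ^+ a * f t) -> cL1 (monomial_wave f x a).
Proof.
move=> L; split.
  by under eq_fun do rewrite re_monomial_wave; exact: L1_cosM.
under eq_fun do rewrite im_monomial_wave -mulN1r.
by apply: L1Z; exact: L1_sinM.
Qed.

Lemma cint_monomial_wave f x a : L1 (fun t => t ^+ a * f t) ->
  cint (monomial_wave f x a) = moment f x a.
Proof.
move=> L; rewrite /cint /moment; congr Complex.
  by apply: eq_Rintegral => t _; exact: re_monomial_wave.
rewrite /st -IntN; last exact: L1_sinM.
by apply: eq_Rintegral => t _; exact: im_monomial_wave.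
Qed.

Lemma L1_moment (f : R -> R) n a : L1 f -> L1 (fun t => t ^+ n * f t) -> (a <= n)%N ->
  L1 (fun t => t ^+ a * f t).
Proof.
move=> Lf Ln an; apply: (L1_le (g := fun t => `|f t| + `|t ^+ n * f t|)).
- by apply: measurable_funM; [exact: measurable_funX|exact: L1_measurable].
- move=> t; rewrite [leRHS]ger0_norm ?addr_ge0 // !normrM !normrX -[X in X + _]mul1r -mulrDl.
  rewrite ler_wpM2r //; have [t1|t1] := leP `|t| 1.
    by rewrite (le_trans (@exprn_ile1 R a _ (normr_ge0 t) t1)) // lerDl exprn_ge0.
  by rewrite (le_trans (ler_weXn2l (ltW t1) an)) // lerDr.
- by apply: L1D; exact: L1_norm.
Qed.

Definition vandermonde_mx n (s : seq R) : 'M[R]_n := \matrix_(i, j) s`_i ^+ j.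

Lemma corr_integrandE (f : R -> R) (s : seq R) n : size s = n ->
  corr_integrand f s = (\det (vandermonde_mx n s)) ^+ 2 * \prod_(i < n) f s`_i.
Proof.
move=> sn; rewrite /corr_integrand sn [in X in _ * X](big_nth 0) sn [in X in _ * X]big_mkord; congr (_ * _).
have -> : vandermonde_mx n s = (Vandermonde n (\row_i s`_i))^T.
  by apply/matrixP => i j; rewrite !mxE.
rewrite det_tr det_Vandermonde -prodrXl [LHS]big_mkord; apply: eq_bigr => i _.
rewrite -prodrXl big_geq_mkord /=; apply: eq_big => j; first by [].
by move=> _; rewrite !mxE -sqrrN opprB.
Qed.

Lemma heine_expansion f x (s : seq R) n : size s = n ->
  expNi x (\sum_(y <- s) y) * inC (corr_integrand f s) =
  \sum_(p : 'S_n * 'S_n) ((-1) ^+ p.1 * (-1) ^+ p.2) *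
     \prod_(i < n) monomial_wave f x (p.1 i + p.2 i) s`_i.
Proof.
move=> sn; rewrite (corr_integrandE f sn) (expNi_sum x sn) rmorphM rmorphXn /= expr2.
have -> : inC (\det (vandermonde_mx n s)) = \sum_(q : 'S_n) (-1) ^+ q * \prod_(i < n) inC (s`_i ^+ q i).
  rewrite -det_map_mx /determinant; apply: eq_bigr => q _; congr (_ * _).
  by apply: eq_bigr => i _; rewrite !mxE.
rewrite -(pair_bigA _ (fun q r : 'S_n => ((-1) ^+ q * (-1) ^+ r) *
   \prod_(i < n) monomial_wave f x (q i + r i) s`_i)) /=.
rewrite -mulrA mulrCA mulr_suml; apply: eq_bigr => q _.
rewrite (mulrCA (\prod_(i < n) expNi x s`_i)) mulr_suml mulr_sumr; apply: eq_bigr => r _.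
rewrite rmorph_prod /= -(mulrA ((-1) ^+ r)) mulrACA; congr (_ * _).
rewrite -!big_split /=; apply: eq_bigr => i _.
by rewrite /monomial_wave exprD !rmorphM /=; ring.
Qed.

(** Writing the second permutation as q r, the signs combine to that of r; reindexing the product by
    q removes q altogether. Each of the n! choices of q thus gives the same determinant. *)
Lemma sum_perm_pairs_det n (m : nat -> C) :
  \sum_(p : 'S_n * 'S_n) ((-1) ^+ p.1 * (-1) ^+ p.2) * \prod_(i < n) m (p.1 i + p.2 i)%N =
  n`!%:R * \det (\matrix_(i < n, j < n) m (i + j)%N).
Proof.
rewrite -(pair_bigA _ (fun q r : 'S_n => ((-1) ^+ q * (-1) ^+ r) *
   \prod_(i < n) m (q i + r i)%N)) /=.
rewrite (eq_bigr (fun=> \det (\matrix_(i < n, j < n) m (i + j)%N))).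
  by rewrite sumr_const cardT -cardE card_Sn mulr_natl.
move=> q _; rewrite (reindex_inj (mulgI q)) /=.
rewrite /determinant; apply: eq_bigr => r _; rewrite odd_permM signr_addb mulrA -expr2 sqrr_sign mul1r.
congr (_ * _); rewrite [RHS](reindex_inj (@perm_inj _ q)) /=.
by apply: eq_bigr => i _; rewrite mxE permM.
Qed.

(** Two exponentials are carried along, so that the real weight can later be made nonnegative. The
    exponents that occur are sums of two numbers below n, hence the moments up to 2 n - 2. *)
Lemma iint_heine n (f : R -> R) (gam : bool -> C) (x : bool -> R) :
  (forall a, (a <= 2 * n - 2)%N -> L1 (fun t => t ^+ a * f t)) ->
  iint n (fun s => (re (\sum_(b : bool) gam b * expNi (x b) (\sum_(y <- s) y)) * corr_integrand f s)%:E) =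
  (re (\sum_(b : bool) gam b * (n`!%:R * \det (moment_mx n f (x b)))))%:E.
Proof.
move=> Lf.
pose J := (bool * ('S_n * 'S_n))%type.
pose c (p : J) : C := gam p.1 * ((-1) ^+ p.2.1 * (-1) ^+ p.2.2).
(* [iint_separable] indexes the factors by natural numbers; the default 0 for i >= n keeps their
   integrability true for every index. *)
pose e (p : J) (i : nat) : nat := if insub i is Some i' then (p.2.1 (i' : 'I_n) + p.2.2 i')%N else 0%N.
have eE p (i : 'I_n) : e p i = (p.2.1 i + p.2.2 i)%N by rewrite /e valK.
have Le p i : L1 (fun t => t ^+ e p i * f t).
  apply: Lf; rewrite /e; case: insubP => // i' _ _.
  have := ltn_ord (p.2.1 i'); have := ltn_ord (p.2.2 i'); lia.
rewrite (eq_iint (G := fun s => (re (\sum_(p : J) c p *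
    \prod_(i < n) monomial_wave f (x p.1) (e p i) s`_i))%:E)).
  rewrite (iint_separable n c (h := fun p i => monomial_wave f (x p.1) (e p i))); last first.
    by move=> p i; exact: cL1_monomial_wave.
  congr (re _)%:E.
  rewrite (eq_bigr (fun p : J => gam p.1 * (((-1) ^+ p.2.1 * (-1) ^+ p.2.2) *
     \prod_(i < n) moment f (x p.1) (p.2.1 i + p.2.2 i)))); last first.
    move=> p _; rewrite /c -mulrA; congr (_ * (_ * _)); apply: eq_bigr => i _.
    by rewrite cint_monomial_wave // eE.
  rewrite -(pair_bigA _ (fun b (q : 'S_n * 'S_n) => gam b * (((-1) ^+ q.1 * (-1) ^+ q.2) *
     \prod_(i < n) moment f (x b) (q.1 i + q.2 i)))) /=.
  apply: eq_bigr => b _; rewrite -mulr_sumr; congr (_ * _).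
  exact: (sum_perm_pairs_det n (moment f (x b))).
move=> s sn; congr EFin.
have -> (z : C) (r : R) : re z * r = re (z * inC r) by rewrite reM /= mulr0 subr0.
congr re; rewrite mulr_suml.
rewrite -(pair_bigA _ (fun b (q : 'S_n * 'S_n) => c (b, q) *
  \prod_(i < n) monomial_wave f (x b) (e (b, q) i) s`_i)) /=.
apply: eq_bigr => b _; rewrite -mulrA (heine_expansion f (x b) sn) mulr_sumr.
apply: eq_bigr => q _; rewrite /c /= -!mulrA; congr (_ * (_ * (_ * _))).
by apply: eq_bigr => i _; rewrite eE.
Qed.

Lemma corr_integrand_ge0 (f : R -> R) (s : seq R) : (forall t, 0 <= f t) -> 0 <= corr_integrand f s.
Proof.
move=> f0; rewrite /corr_integrand mulr_ge0 ?prodr_ge0 // => i _.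
by apply: prodr_ge0 => j _; exact: sqr_ge0.
Qed.

Lemma seq_measurable_corr (f : R -> R) n : measurable_fun setT f ->
  seq_measurable n (fun s => (corr_integrand f s)%:E).
Proof.
move=> mf d T u su mu; apply/measurable_EFinP; rewrite /corr_integrand.
under eq_fun do rewrite size_map big_map.
apply: measurable_funM.
  apply: measurable_prod => i _; apply: measurable_prod => j _.
  by apply: measurable_funX; apply: measurable_funB; exact: measurable_all_nth.
clear su; elim: u mu => [|v u IH] /=.
  by move=> _; under eq_fun do rewrite big_nil; exact: measurable_cst.
move=> [mv mu]; under eq_fun do rewrite big_cons.
by apply: measurable_funM; [exact: (measurableT_comp mf mv)|exact: IH].
Qed.

End Heine.

(** * The Fourier transform of the correlation function and the zeros of W_n *)

Section CorrelationTransform.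
Variables (R : realType) (n : nat) (f : R -> R).
Local Notation leb := (@lebesgue_measure R).
Local Notation Int := (Rintegral leb setT).
Local Notation re := (@complex.Re R).
Local Notation im := (@complex.Im R).
Local Notation C := R[i].
Hypotheses (n2 : (2 <= n)%N) (Lf : L1 f) (f0 : forall t, 0 <= f t)
  (Lfn : L1 (fun t => t ^+ (2 * n - 2) * f t)).

Let Lmom a : (a <= 2 * n - 2)%N -> L1 (fun t => t ^+ a * f t).
Proof. by move=> an; exact: L1_moment an. Qed.

(** This is the value at x of the Fourier transform of [nu n f], as [ct_nu] and [st_nu]
    establish. *)
Let E (x : R) : C := n`!%:R * \det (moment_mx n f x).

Let nS : n.-1.+1 = n.
Proof. by rewrite prednK //; lia. Qed.

Lemma nu_ext_ge0 t : (0 <= nu_ext n f t)%E.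
Proof. by apply: iint_ge0 => s; rewrite lee_fin corr_integrand_ge0. Qed.

Lemma measurable_nu_ext : measurable_fun setT (nu_ext n f).
Proof.
apply: (measurable_iint (Phi := fun (t : R) s =>
  (corr_integrand f (rcons s (t - \sum_(x <- s) x)))%:E)) => d T a u ma su mu.
have := @seq_measurable_corr R f n (L1_measurable Lf) _ T
  (rcons u (fun t => a t - \sum_(v <- u) v t)).
rewrite size_rcons su nS => /(_ erefl) H.
under eq_fun do rewrite big_map -[a _ - _]/((fun t => a t - \sum_(v <- u) v t) _) -map_rcons.
apply: H; apply: all_measurable_rcons => //.
by apply: measurable_funB => //; exact: measurable_all_sum.
Qed.

(* [nu_ext] is not yet known to be finite, so only nonnegative weights are allowed; 1, 1 + cos
   and 1 + sin (two exponentials each) suffice to recover the Fourier transform. *)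
Lemma integral_nu_ext (gam : bool -> C) (x : bool -> R) :
  (forall t, 0 <= re (\sum_(b : bool) gam b * expNi (x b) t)) ->
  (\int[leb]_t ((re (\sum_(b : bool) gam b * expNi (x b) t))%:E * nu_ext n f t) =
   (re (\sum_(b : bool) gam b * E (x b)))%:E)%E.
Proof.
move=> g0; pose g t := re (\sum_(b : bool) gam b * expNi (x b) t).
have mg : measurable_fun setT g.
  rewrite (_ : g = fun t => \sum_(b : bool) (re (gam b) * cos (x b * t) + im (gam b) * sin (x b * t))).
    apply: measurable_sum => b; apply: measurable_funD; apply: measurable_funM => //.
      exact: (bddm_cosM (x b)).1.
    exact: (bddm_sinM (x b)).1.
  by apply/funext => t; rewrite /g !big_bool /= reD !reM /= !mulrN !opprK.
rewrite (iint_hyperplane (g := g) (F := fun s => (corr_integrand f s)%:E) (k := n.-1)) //; last 2 first.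
- by rewrite nS; apply: seq_measurable_corr; exact: L1_measurable.
- by move=> s; rewrite lee_fin corr_integrand_ge0.
rewrite nS -(iint_heine (n := n) gam x Lmom).
by apply: eq_iint => s _; rewrite EFinM.
Qed.

Let w_one (b : bool) : C := if b then 1 else 0.

(** The right-hand side is a real number: this is where integrability of the correlation function
    comes from. *)
Lemma integral_nu_ext1 : (\int[leb]_t nu_ext n f t = (re (E 0))%:E)%E.
Proof.
have W t : re (\sum_(b : bool) w_one b * expNi 0 t) = 1.
  by rewrite big_bool reD reM reM /= !mul0r cos0 mul1r !subr0 addr0.
have := @integral_nu_ext w_one (fun=> 0).
rewrite big_bool reD reM reM [re (w_one true)]/= [im (w_one true)]/=
  [re (w_one false)]/= [im (w_one false)]/= !mul0r mul1r !subr0 addr0 => <-; last by move=> t; rewrite W.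
by apply: eq_integral => t _; rewrite W mul1e.
Qed.

(** [fine] replaces infinite values by 0, which integrability confines to a null set. *)
Lemma nu_ae : ae_eq leb setT (fun t => (nu n f t)%:E) (nu_ext n f).
Proof.
have iN : leb.-integrable setT (nu_ext n f).
  apply/integrableP; split; first exact: measurable_nu_ext.
  under eq_integral do rewrite gee0_abs ?nu_ext_ge0 //.
  by rewrite integral_nu_ext1 ltry.
have := integrable_ae measurableT iN; apply: filterS => t /= fint _.
by rewrite /nu fineK // fint.
Qed.

Lemma measurable_nu : measurable_fun setT (nu n f).
Proof. by apply: (measurableT_comp _ measurable_nu_ext). Qed.

Lemma nu_ge0 t : 0 <= nu n f t.
Proof. by rewrite /nu fine_ge0 // nu_ext_ge0. Qed.

Lemma integral_nu (g : R -> R) : measurable_fun setT g -> (forall t, 0 <= g t) ->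
  (\int[leb]_t (g t * nu n f t)%:E = \int[leb]_t ((g t)%:E * nu_ext n f t))%E.
Proof.
move=> mg g0; apply: ge0_ae_eq_integral => //.
- by apply/measurable_EFinP; apply: measurable_funM => //; exact: measurable_nu.
- by apply: emeasurable_funM; [exact/measurable_EFinP|exact: measurable_nu_ext].
- by move=> t _; rewrite lee_fin mulr_ge0 // nu_ge0.
- by move=> t _; rewrite mule_ge0 ?lee_fin ?nu_ext_ge0.
- by apply: filterS nu_ae => t /= H _; rewrite EFinM H.
Qed.

Lemma L1_nu : L1 (nu n f).
Proof.
apply: L1P; first exact: measurable_nu.
rewrite (_ : Jp 1 _ = (re (E 0))%:E) ?ltry // -integral_nu_ext1 /Jp.
transitivity (\int[leb]_t (1 * nu n f t)%:E)%E.
  by apply: eq_integral => t _; rewrite expr1 mul1r ger0_norm ?nu_ge0.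
rewrite (@integral_nu (fun=> 1)) //.
by apply: eq_integral => t _; rewrite mul1e.
Qed.

Lemma Int_nu : Int (nu n f) = re (E 0).
Proof.
apply: EFin_inj; rewrite L1_Int; last exact: L1_nu.
rewrite -integral_nu_ext1; transitivity (\int[leb]_t (1 * nu n f t)%:E)%E.
  by apply: eq_integral => t _; rewrite mul1r.
rewrite (@integral_nu (fun=> 1)) //.
by apply: eq_integral => t _; rewrite mul1e.
Qed.

Lemma ct_nu x : ct (nu n f) x = re (E x).
Proof.
pose xs (b : bool) := if b then x else 0.
have W t : re (\sum_(b : bool) 1 * expNi (xs b) t) = 1 + cos (x * t).
  by rewrite big_bool !mul1r reD /= mul0r cos0 addrC.
have W0 t : 0 <= 1 + cos (x * t) by have := cos_geN1 (x * t); lra.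
have mW : measurable_fun setT (fun t => 1 + cos (x * t)).
  by apply: measurable_funD => //; exact: (bddm_cosM x).1.
have H := @integral_nu_ext (fun=> 1) xs; move: H.
rewrite big_bool !mul1r reD /xs /= => H.
have H1 : (Int (fun t => (1 + cos (x * t)) * nu n f t))%:E = (re (E x) + re (E 0))%:E.
  rewrite L1_Int; last first.
    under eq_fun do rewrite mulrDl mul1r.
    by apply: L1D; [exact: L1_nu|apply: L1_cosM; exact: L1_nu].
  rewrite (integral_nu mW W0) -H; last by move=> t; rewrite W.
  by apply: eq_integral => t _; rewrite W.
move: (EFin_inj H1); under eq_Rintegral do rewrite mulrDl mul1r.
rewrite RintegralD //; [|exact: L1_nu|by apply: L1_cosM; exact: L1_nu].
by rewrite Int_nu addrC => /addIr.
Qed.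

Lemma st_nu x : st (nu n f) x = - im (E x).
Proof.
pose xs (b : bool) := if b then x else 0.
(* The real part of i e^(-ixt) is sin (x t). *)
pose gam (b : bool) : C := if b then 'i%C else 1.
have W t : re (\sum_(b : bool) gam b * expNi (xs b) t) = 1 + sin (x * t).
  by rewrite big_bool reD reM (_ : gam false = 1) // mul1r /= !mul0r mul1r cos0 sub0r opprK addrC.
have W0 t : 0 <= 1 + sin (x * t) by have := sin_geN1 (x * t); lra.
have mW : measurable_fun setT (fun t => 1 + sin (x * t)).
  by apply: measurable_funD => //; exact: (bddm_sinM x).1.
have H := @integral_nu_ext gam xs; move: H.
rewrite big_bool reD reM (_ : gam false = 1) // mul1r /xs /= mul0r sub0r mul1r => H.
have H1 : (Int (fun t => (1 + sin (x * t)) * nu n f t))%:E = (- im (E x) + re (E 0))%:E.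
  rewrite L1_Int; last first.
    under eq_fun do rewrite mulrDl mul1r.
    by apply: L1D; [exact: L1_nu|apply: L1_sinM; exact: L1_nu].
  rewrite (integral_nu mW W0) -H; last by move=> t; rewrite W.
  by apply: eq_integral => t _; rewrite W.
move: (EFin_inj H1); under eq_Rintegral do rewrite mulrDl mul1r.
rewrite RintegralD //; [|exact: L1_nu|by apply: L1_sinM; exact: L1_nu].
by rewrite Int_nu addrC => /addIr.
Qed.

(** Each differentiation under the integral brings down a factor -i t. The orders i + j in W_n go up
    to 2 n - 2, exactly as far as the moments. *)
Lemma derive1n_fourier k x : (k <= 2 * n - 2)%N ->
  cderivn k (fourier f) x = (- 'i%C) ^+ k * moment f x k.
Proof.
elim: k x => [|k IH] x kn.
  rewrite expr0 mul1r /cderivn /= /moment /ct /st.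
  by congr Complex; [|congr (- _)]; apply: eq_Rintegral => t _; rewrite expr0 mul1r.
have Lk : L1 (fun t => t ^+ k * f t) by apply: Lmom; exact: ltnW.
have LSk : L1 (fun t => t * (t ^+ k * f t)).
  by have := Lmom kn; under eq_fun do rewrite exprS -mulrA.
have SE : (fun t => t ^+ k.+1 * f t) = (fun t => t * (t ^+ k * f t)).
  by apply/funext => t; rewrite exprS mulrA.
set z := (- 'i%C) ^+ k : C.
have Ere : derive1n k (fun y => re (fourier f y)) =
    (fun y => re z * ct (fun t => t ^+ k * f t) y + im z * st (fun t => t ^+ k * f t) y).
  apply/funext => y; have /(congr1 re) /= -> := IH y (ltnW kn).
  by rewrite reM /= mulrN opprK.
have Eim : derive1n k (fun y => im (fourier f y)) =
    (fun y => im z * ct (fun t => t ^+ k * f t) y + - re z * st (fun t => t ^+ k * f t) y).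
  apply/funext => y; have /(congr1 im) /= -> := IH y (ltnW kn).
  by rewrite imM /= mulrN mulNr addrC.
rewrite /cderivn !derive1nS Ere Eim !derive1E.
have D (a b : R) : is_derive x 1 (fun y => a * ct (fun t => t ^+ k * f t) y + b * st (fun t => t ^+ k * f t) y)
    (a * - st (fun t => t ^+ k.+1 * f t) x + b * ct (fun t => t ^+ k.+1 * f t) x).
  by rewrite SE; apply: derive_add; apply: derive_scale; [exact: derive_ct|exact: derive_st].
have [_ ->] := D (re z) (im z); have [_ ->] := D (im z) (- re z).
have iz : (- 'i%C) * z = Complex (im z) (- re z) :> C.
  by apply/eqP; rewrite eq_complex reM imM /=; apply/andP; split; apply/eqP; ring.
apply/eqP; rewrite eq_complex exprS -/z iz reM imM /=.
by apply/andP; split; apply/eqP; ring.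
Qed.

(** The factor (-i)^(i + j) splits over rows and columns: the matrix of W_n is D M D with M the
    moment matrix and D the invertible diagonal matrix of the powers of -i. *)
Lemma Wn_eq0 x : (Wn n (fourier f) x == 0) = (norm_ft2 (nu n f) x == 0).
Proof.
have n1 : (n`!%:R : C) != 0.
  by rewrite pnatr_eq0 -lt0n fact_gt0.
have -> : (norm_ft2 (nu n f) x == 0) = (E x == 0).
  rewrite /norm_ft2 ct_nu st_nu paddr_eq0 ?sqr_ge0 // !sqrf_eq0 oppr_eq0.
  by rewrite [RHS]eq_complex.
rewrite /E mulf_eq0 (negbTE n1) /=.
pose D : 'M[C]_n := diag_mx (\row_i (- 'i%C) ^+ i).
have -> : Wn n (fourier f) x = \det (D *m moment_mx n f x *m D).
  rewrite /Wn; congr (\det _); apply/matrixP => i j.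
  rewrite mul_mx_diag mul_diag_mx !mxE derive1n_fourier; last first.
    have := ltn_ord i; have := ltn_ord j; lia.
  by rewrite exprD mulrAC.
have D0 : \det D != 0.
  rewrite det_diag prodf_seq_neq0; apply/allP => i _; apply/implyP => _.
  by rewrite mxE expf_neq0 // oppr_eq0 eq_complex /= oner_eq0 andbF.
by rewrite !det_mulmx !mulf_eq0 (negbTE D0) orbF.
Qed.

End CorrelationTransform.

Theorem theorem4p1 (R : realType) (n : nat) (f : R -> R) :
  (2 <= n)%N ->
  L1 f ->
  (forall t, 0 <= f t) ->
  L1 (fun t => t ^+ (2 * n - 2) * f t) ->
  ((forall x : R, Wn n (fourier f) x != 0) <-> transl_dense_L1 (nu n f))
  /\
  (L2 (nu n f) ->
     ((@lebesgue_measure R) [set x | Wn n (fourier f) x = 0] = 0%E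
      <-> transl_dense_L2 (nu n f))).
Proof.
move=> n2 Lf f0 Lfn; have Lnu := L1_nu n2 Lf f0 Lfn.
have W0 x := Wn_eq0 n2 Lf f0 Lfn x.
split.
  split=> [W|dense x].
    by apply: wiener_L1 => // x; rewrite -W0.
  by rewrite W0; exact: wiener_L1_converse dense x.
move=> [mnu Jnu].
have -> : [set x | Wn n (fourier f) x = 0] = [set x | norm_ft2 (nu n f) x = 0].
  by apply/seteqP; split=> x /= /eqP; [rewrite W0|rewrite -W0] => /eqP.
split=> [null g [mg Jg]|dense]; first exact: wiener_L2.
by apply: wiener_L2_converse => // g mg Jg; exact: dense.
Qed.
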